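(* Let $1\le p<\infty$, $r,s\in\mathbb{N}$ with $s\le 2r$, and let $(G_n)_{n\in\mathbb{N}}$ be a family of linear sampling operators with nodes $X_n=(x_{k,n})_{k=1}^n$ and separation constant $\gamma\in(0,1]$ (see context). Suppose that there are constants $K_1,K_2,K_3,K_5>0$ such that $$K_2\|f\|_{\ell_p(X_n)}\le\|G_n(f)\|_p\le K_1\|f\|_{\ell_p(X_n)}\quad\text{for all } f\in L_p(\mathbb{T}),\ n\in\mathbb{N},$$ $$\|f-G_n(f)\|_p\le K_3n^{-s}\|f^{(s)}\|_p\quad\text{for all } f\in W_p^s(\mathbb{T}),\ n\in\mathbb{N},$$ $$n^{-s}\|(G_n(f))^{(s)}\|_p\le K_5\,\omega_s(G_n(f),n^{-1})_p\quad\text{for all } f\in L_p(\mathbb{T}),\ n\in\mathbb{N}$$ (where it is understood that $G_n(f)\in W_p^s(\mathbb{T})$). Then for all $f\in L_p(\mathbb{T})$ and $n\in\mathbb{N}$ $$\|f_{\gamma/n,\,r}-f\|_{\ell_p(X_n)}+\omega_s(f,1/n)_p\asymp\|f-G_n(f)\|_p+n^{-s}\|(G_n(f))^{(s)}\|_p,$$ where $\asymp$ is a two-sided inequality with positive constants independent of $f$ and $n$.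
   Context: $\mathbb{T}=[0,1)$. For $1\le p<\infty$, $L_p(\mathbb{T})$ is the space of all 1-periodic measurable functions $f$, finite at every point, with $\|f\|_p=(\int_0^1|f(x)|^p\,dx)^{1/p}<\infty$; functions coinciding almost everywhere are not identified, so $f\in L_p(\mathbb{T})$ is given by its value at each point. For $s\in\mathbb{N}$, $f\in W_p^s(\mathbb{T})$ means that $f$ is 1-periodic, $f^{(s-1)}$ is absolutely continuous and $f^{(s)}\in L_p(\mathbb{T})$. For a set of $n$ points $X_n=(x_{k,n})_{k=1}^n$, $\|f\|_{\ell_p(X_n)}=\big(\frac1n\sum_{k=1}^n|f(x_{k,n})|^p\big)^{1/p}$. Modulus of smoothness: for $s\in\mathbb{N}$, $\delta>0$, $\omega_s(f,\delta)_p=\sup_{0<h<\delta}\|\Delta_h^sf\|_p$, where $\Delta_h^sf(x)=\sum_{\nu=0}^s\binom{s}{\nu}(-1)^\nu f(x+(s-\nu)h)$. Generalized Steklov average: for $r\in\mathbb{N}$, $\delta>0$ and integrable $f$, $$f_{\delta,r}(x)=(-1)^{r+1}\binom{2r}{r}^{-1}\frac2\delta\int_{-\delta/2}^{\delta/2}\sum_{\nu=0}^{r-1}(-1)^\nu\binom{2r}{\nu}f\Big(x+\frac{r-\nu}{r}t\Big)dt .$$ Sampling operators: for each $n\in\mathbb{N}$, $G_n(f)(x)=\sum_{k=1}^nf(x_{k,n})\varphi_{k,n}(x)$, where $\varphi_{k,n}\in L_p(\mathbb{T})$ are fixed 1-periodic functions and the nodes $X_n=(x_{k,n})_{k=1}^n$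 satisfy $0\le x_{1,n}<x_{2,n}<\dots<x_{n,n}<1$. It is assumed that $\gamma\in(0,1]$ is such that $\min_{1\le k\le n}(x_{k+1,n}-x_{k,n})\ge\gamma/n$ for all $n\in\mathbb{N}$, where $x_{n+1,n}=1+x_{1,n}$. *)

(* Defs.v *)
From HB Require Import structures.
From mathcomp Require Import all_boot all_order all_algebra.
From mathcomp Require Import all_classical all_reals all_analysis.

Set Implicit Arguments.
Unset Strict Implicit.
Unset Printing Implicit Defensive.

Import Order.TTheory GRing.Theory Num.Theory.
Import numFieldNormedType.Exports.

Local Open Scope ring_scope.
Local Open Scope classical_set_scope.

(* The real line with the sigma-algebra of all Lebesgue measurable sets (not
   only the Borel ones): the domain of [completed_lebesgue_measure]. *)
Notation lebesgueR R := (caratheodory_type ((@wlength R idfun)^*)%mu).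

Definition normLp (R : realType) (p : R) (f : R -> R) : \bar R :=
  ((\int[@completed_lebesgue_measure R]_(x in `[0%R, 1%R[)
      (`|f x| `^ p)%:E) `^ p^-1)%E.

(* Functions equal almost everywhere are not identified: an element of this
   set is given by its value at each point. *)
Definition Lp (R : realType) (p : R) : set (R -> R) :=
  [set f : R -> R |
     [/\ periodic f 1,
         measurable_fun [set: lebesgueR R] (f : lebesgueR R -> R)
       & (normLp p f < +oo)%E]].

Definition absolutely_continuous_on (R : realType) (u v : R) (f : R -> R) :=
  forall e : R, 0 < e -> exists2 d : R, 0 < d &
    forall (m : nat) (a b : 'I_m -> R),
      (forall i, [/\ u <= a i, a i <= b i & b i <= v]) ->
      trivIset setT (fun i => `]a i, b i[) ->
      \sum_(i < m) (b i - a i) < d ->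
      \sum_(i < m) `|f (b i) - f (a i)| < e.

(* [f^`(s)] is the library's total derivative: it takes a default value at the
   points where [f^`(s.-1)] is not differentiable, which form a null set when
   [f^`(s.-1)] is absolutely continuous. *)
Definition Wsp (R : realType) (s : nat) (p : R) : set (R -> R) :=
  [set f : R -> R |
     [/\ periodic f 1,
         forall k (x : R), (k.+1 < s)%N -> derivable (f^`(k)) x 1,
         forall u v, absolutely_continuous_on u v (f^`(s.-1))
       & Lp p (f^`(s))]].

(* The nodes of level [n] are [x 1, ..., x n]. *)
Definition normlp (R : realType) (p : R) (n : nat) (x : nat -> R)
    (f : R -> R) : R :=
  (n%:R^-1 * \sum_(1 <= k < n.+1) `|f (x k)| `^ p) `^ p^-1.

Definition fdiff (R : realType) (s : nat) (h : R) (f : R -> R) (x : R) : R :=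
  \sum_(0 <= nu < s.+1) 'C(s, nu)%:R * (-1) ^+ nu * f (x + (s - nu)%:R * h).

Definition modulus (R : realType) (s : nat) (f : R -> R) (delta : R) (p : R) :
    \bar R :=
  ereal_sup [set normLp p (fdiff s h f) | h in `]0, delta[].

Definition steklov (R : realType) (delta : R) (r : nat) (f : R -> R) (x : R) :
    R :=
  (-1) ^+ r.+1 * ('C(2 * r, r)%:R)^-1 * (2 / delta) *
  \int[@completed_lebesgue_measure R]_(t in `[- (delta / 2), delta / 2])
     \sum_(0 <= nu < r) (-1) ^+ nu * 'C(2 * r, nu)%:R *
        f (x + (r - nu)%:R / r%:R * t).

(* [x n k] is x_{k,n} with [1 <= k <= n], extended by x_{n+1,n} = 1 + x_{1,n}. *)
Definition separated_nodes (R : realType) (gamma : R) (x : nat -> nat -> R) :=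
  forall n, (0 < n)%N ->
    [/\ 0 <= x n 1%N,
        forall k, (1 <= k < n)%N -> x n k < x n k.+1,
        x n n < 1,
        x n n.+1 = 1 + x n 1%N
      & forall k, (1 <= k <= n)%N -> gamma / n%:R <= x n k.+1 - x n k].

Definition sampling (R : realType) (x : nat -> nat -> R)
    (phi : nat -> nat -> R -> R) (n : nat) (f : R -> R) (y : R) : R :=
  \sum_(1 <= k < n.+1) f (x n k) * phi n k y.

(* Main.v *)
Require Import Defs.
From HB Require Import structures.
From mathcomp Require Import all_boot all_order all_algebra.
From mathcomp Require Import all_classical all_reals all_analysis.
From mathcomp Require Import measurable_realfun ess_sup_inf.
From mathcomp Require Import lra ring zify.

(** Write g for G_n f, q for n^-s, N for the norm of L_p, L for the norm at the nodes, W for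
omega_s(f, 1/n)_p, D for q N(g^(s)) and f_d for the Steklov average with d = gamma / n.

Two estimates at the nodes carry the theorem. First, L(f_d) <= c N(f): the value f_d(y) is at
most a multiple of the mean of |f| over the window of length d centred at y, and the windows
around the nodes are disjoint modulo 1 because the nodes are separated, so Jensen's inequality
gives the bound ([normlp_steklov_le]). Secondly, L(g_d - g) <= c q N(g^(s)) for g in W_p^s:
g_d - g is the mean over |t| <= d/2 of a centred difference of order 2r, hence is controlled by
differences of order s <= 2r, and these by the integral of |g^(s)| over the same window
([normlp_steklov_sub_le]).

Upper estimate. Decompose f_d - f = (f - g)_d + (g_d - g) + (g - f). The first two terms are
handled by the estimates above, and stability with the Jackson inequality gives
K2 L(g - f) <= N(G_n g - g) <= K3 D. Moreover W <= 2^s N(f - g) + omega_s(g, 1/n)_p, where the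
last modulus is at most s D.

Lower estimate. Some F in W_p^s realizes the modulus: N(f - F) <= W and q N(F^(s)) <= c W
([smooth_approximation]). Then N(f - g) <= N(f - F) + N(F - G_n F) + N(G_n(F - f)); the Jackson
inequality bounds the second term, and the third is at most K1 L(F - f), where
F - f = (F - F_d) + (F - f)_d + (f_d - f) at the nodes is controlled by the two estimates. The
Bernstein inequality gives D <= K5 omega_s(g, 1/n)_p <= K5 (W + 2^s N(f - g)).

The function F is a combination of iterated averages of f. With A_t v(x) the mean of v over
[x, x + t] and h = 1/((s + 1) n), put
F = - (-1)^s (sum over 1 <= nu <= s of (-1)^(s - nu) C(s, nu) A_(nu h)^s f). Up to sign, f - F
is a mean of differences of f of order s with steps in [0, s h]; and since the derivative of
A_t v is the difference quotient (v(x + t) - v(x)) / t, F^(s) is a combination of the functions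
(nu h)^-s times the difference of f of order s and step nu h.

Derivatives of order s are those of absolutely continuous functions, which exist only almost
everywhere. The inequality |F(v) - F(u)| <= (integral of |F'| over [u, v]) is derived from the
Radon-Nikodym theorem: the total variation of an absolutely continuous function is absolutely
continuous, so F is a difference of nondecreasing functions whose Lebesgue-Stieltjes measures
have densities ([absolutely_continuous_le]). Changes of variables and exchanges of integrals
are carried out on Borel versions of the Lebesgue measurable functions at hand
([borel_version]). *)

Set Implicit Arguments.
Unset Strict Implicit.
Unset Printing Implicit Defensive.

Import Order.TTheory GRing.Theory Num.Theory.
Import numFieldNormedType.Exports.

Local Open Scope ring_scope.
Local Open Scope classical_set_scope.

(** * Borel versions and affine changes of variables *)

Section Transfer.
Context {R : realType}.
Notation mu := (@lebesgue_measure R).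
Notation cmu := (@completed_lebesgue_measure R).
Local Open Scope ereal_scope.

Lemma measurable_lebesgueR (A : set R) :
  measurable A -> measurable (A : set (lebesgueR R)).
Proof. exact: sub_caratheodory. Qed.

Lemma measurable_fun_lebesgueR d (T : measurableType d) (f : R -> T) :
  measurable_fun [set: R] f -> measurable_fun [set: lebesgueR R] f.
Proof.
by move=> mf mD A mA; apply: measurable_lebesgueR; apply: mf.
Qed.

(** The identity is measurable from the Lebesgue to the Borel sigma-algebra and pushes the
completed measure forward to Lebesgue measure. *)
Lemma ge0_integral_completed (D : set R) (g : R -> \bar R) :
  measurable D -> measurable_fun [set: R] g -> (forall x, 0 <= g x) ->
  \int[cmu]_(x in D) g x = \int[mu]_(x in D) g x.
Proof.
move=> mD mg g0.
have mid : measurable_fun [set: lebesgueR R] (idfun : lebesgueR R -> measurableTypeR R).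
  by move=> _ A mA; rewrite setTI; exact: measurable_lebesgueR.
have := @ge0_integral_pushforward _ _ _ _ R (idfun : lebesgueR R -> measurableTypeR R)
  mid cmu D g mD _ _.
rewrite preimage_id => <- //.
exact: measurable_funTS.
Qed.

Lemma ae_completed (P : R -> Prop) : {ae mu, forall x, P x} -> {ae cmu, forall x, P x}.
Proof.
move=> [N [mN N0 PN]]; exists N; split => //; exact: measurable_lebesgueR.
Qed.

(** Each superlevel set of f at a rational level is a Borel set up to a null Borel set. Off
the union N of these countably many null sets the superlevel sets of f are Borel, and v is f
set to 0 on N. *)
Lemma borel_version (f : R -> R) :
  measurable_fun [set: lebesgueR R] (f : lebesgueR R -> R) ->
  exists v : R -> R, exists N : set R, [/\ measurable_fun [set: R] v, measurable N,
    mu N = 0 & forall x, ~ N x -> f x = v x].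
Proof.
move=> mf.
have H (q : rat) : exists A B : set R, [/\ measurable A, measurable B, mu B = 0,
    A `<=` f @^-1` `](ratr q), +oo[ & f @^-1` `](ratr q), +oo[ `<=` A `|` B].
  have : measurable (f @^-1` `](ratr q)%R, +oo[ : set (lebesgueR R)).
    by rewrite -[X in measurable X]setTI; apply: mf => //; exact: measurable_itv.
  have -> : forall X : set (lebesgueR R), measurable X =
      (completed_algebra_gen mu).-sigma.-measurable X.
    by move=> X; rewrite completed_caratheodory_measurable.
  rewrite g_sigma_completed_algebra_genE => -[A mA [M [B [mB B0 MB]] AM]].
  exists A, B; split => //; first by rewrite -AM; exact: subsetUl.
  by rewrite -AM; exact: setUS.
have /choice[A /choice[B AB]] := H.
pose rt (n : nat) : rat := odflt 0%R (unpickle n).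
pose N := \bigcup_n B (rt n).
have mN : measurable N.
  by apply: bigcupT_measurable => n; have [] := AB (rt n).
have N0 : mu N = 0.
  apply: measure_negligible => //.
  apply: negligible_bigcup => n; have [_ mB B0 _ _] := AB (rt n).
  exists (B (rt n)); split => // .
have BN q : B q `<=` N.
  by move=> x Bx; exists (pickle q) => //; rewrite /rt pickleK.
pose v x := (if x \in N then 0 else f x)%R.
exists v, N; split => //; last first.
  by move=> x Nx; rewrite /v memNset.
apply: (measurability _ (RGenOInfty.measurableE R)) => // _ [_ [r ->] <-].
pose C n := if (r < ratr (rt n))%R then A (rt n) `\` N else set0.
have -> : setT `&` v @^-1` `]r, +oo[ =
    \bigcup_n C n `|` (if (r < 0)%R then N else set0).
  apply/seteqP; split => [x [_]|x].
    rewrite /v /= in_itv/= andbT.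
    have [Nx|Nx] := pselect (N x).
      by rewrite mem_set// => ->; right.
    rewrite memNset// => rf; left; have /(rat_in_itvoo)[q] := rf.
    rewrite in_itv/= => /andP[rq qf]; exists (pickle q) => //.
    rewrite /C /rt pickleK/= rq; split => //.
    have [_ _ _ _ /(_ x)] := AB q.
    by rewrite /= in_itv/= qf => /(_ isT)[//|/BN].
  case=> [[n _]|]; last first.
    case: ifPn => // r0 Nx; split => //.
    by rewrite /v /= mem_set// in_itv/= r0.
  rewrite /C; case: ifPn => // rn [Ax Nx]; split => //.
  rewrite /v /= memNset// in_itv/= andbT.
  have [_ _ _ /(_ x Ax) + _] := AB (rt n).
  by rewrite /= in_itv/= andbT; exact: lt_trans.
apply: measurableU; last by case: ifP.
apply: bigcupT_measurable => n; rewrite /C; case: ifP => // _.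
by apply: measurableD => //; have [] := AB (rt n).
Qed.

Lemma measurable_affine (c b : R) :
  measurable_fun [set: R] (fun x : R => c * x + b)%R.
Proof. by apply: measurable_funD => //; exact: measurable_funM. Qed.

Lemma preimage_affine_itvoc (c b u v : R) : (0 < c)%R ->
  (fun x => c * x + b)%R @^-1` `]u, v] = `]((u - b) / c)%R, ((v - b) / c)%R]%classic.
Proof.
move=> c0; apply/seteqP; split => x /=; rewrite !in_itv/=;
  by rewrite ltr_pdivrMr// ler_pdivlMr// ltrBlDr lerBrDr [(x * c)%R]mulrC.
Qed.

(** By uniqueness of Lebesgue measure: c times the push-forward by x |-> c x + b also gives
mass v - u to every interval ]u, v]. *)
Lemma lebesgue_measure_affine (c b : R) (A : set R) : (0 < c)%R ->
  measurable A -> mu ((fun x => c * x + b)%R @^-1` A) = c^-1%:E * mu A.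
Proof.
move=> c0 mA.
have mphi : @measurable_fun _ _ (measurableTypeR R) (measurableTypeR R) setT
  (fun x => c * x + b)%R by exact: measurable_affine.
have [pm pmE] : exists m : {measure set (measurableTypeR R) -> \bar R},
    forall A, m A = mu ((fun x => c * x + b)%R @^-1` A).
  eexists => B; rewrite -[RHS]/(pushforward mu
    ((fun x => c * x + b)%R : measurableTypeR R -> measurableTypeR R) B).
  reflexivity.
pose nu := mscale (NngNum (ltW c0)) pm.
have nuE B : nu B = c%:E * mu ((fun x => c * x + b)%R @^-1` B).
  by congr (_ * _); exact: pmE.
have -> : mu A = nu A.
  apply: lebesgue_measure_unique => // _ [[u v] _ <-].
  rewrite -[RHS]/(nu _) nuE preimage_affine_itvoc//.
  rewrite !lebesgue_measure_itv/= !lte_fin ltr_pM2r ?invr_gt0// ltrD2r.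
  case: ifPn => uv; last by rewrite mule0.
  rewrite -EFinB -EFinM; congr EFin.
  by rewrite -mulrBl opprB addrA subrK mulrC -mulrA mulVf ?mulr1// gt_eqF.
by rewrite nuE muleA -EFinM mulVf ?mul1e// gt_eqF.
Unshelve. exact: mphi.
Qed.

Lemma ge0_integral_affine (c b : R) (D : set R) (g : R -> \bar R) :
  (0 < c)%R -> measurable D -> measurable_fun [set: R] g -> (forall x, 0 <= g x) ->
  \int[mu]_(x in (fun x => c * x + b)%R @^-1` D) g (c * x + b)%R =
  c^-1%:E * \int[mu]_(x in D) g x.
Proof.
move=> c0 mD mg g0.
have cV0 : (0 <= c^-1)%R by rewrite invr_ge0 ltW.
pose phi : measurableTypeR R -> measurableTypeR R := (fun x => c * x + b)%R.
have /= <- := @ge0_integral_pushforward _ _ _ _ R phi _ mu D g mD _ _ => //.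
- transitivity (\int[mscale (NngNum cV0) mu]_(x in D) g x).
    apply: eq_measure_integral => [|mphi A mA AD]; first exact: measurable_affine.
    by rewrite /pushforward; have := lebesgue_measure_affine b c0 mA.
  by rewrite ge0_integral_mscale//; exact: measurable_funTS.
- exact: measurable_affine.
- exact: measurable_funTS.
Qed.

(** The affine preimage of a Lebesgue measurable set is handled through a Borel version:
preimages of null sets are null, and the measure is complete. *)
Lemma measurable_fun_lebesgueR_affine (c b : R) (f : R -> R) : (0 < c)%R ->
  measurable_fun [set: lebesgueR R] (f : lebesgueR R -> R) ->
  measurable_fun [set: lebesgueR R] ((fun x => f (c * x + b)%R) : lebesgueR R -> R).
Proof.
move=> c0 /borel_version[v [N [mv mN N0 fv]]].
apply/measurable_EFinP.
apply: (ae_measurable_fun (@completed_lebesgue_measure_is_complete R)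
  (f := fun x => (v (c * x + b)%R)%:E)).
  exists ((fun x => c * x + b)%R @^-1` N); split.
  - apply: measurable_lebesgueR; rewrite -[X in measurable X]setTI.
    exact: measurable_affine.
  - by rewrite /= -[LHS]/(mu _) lebesgue_measure_affine// N0 mule0.
  - move=> x /=; apply: contra_notP => Nx _; rewrite fv//.
apply/measurable_EFinP; apply: measurable_fun_lebesgueR.
apply: (measurableT_comp mv); exact: measurable_affine.
Qed.

Lemma ge0_integral_completed_affine (c b : R) (D : set R) (g : R -> R) :
  (0 < c)%R -> measurable D ->
  measurable_fun [set: lebesgueR R] (g : lebesgueR R -> R) -> (forall x, 0 <= g x)%R ->
  \int[cmu]_(x in (fun x => c * x + b)%R @^-1` D) (g (c * x + b)%R)%:E =
  c^-1%:E * \int[cmu]_(x in D) (g x)%:E.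
Proof.
move=> c0 mD mg g0.
have [v0 [N [mv0 mN N0 fv0]]] := borel_version mg.
pose v := (fun x => Num.max (v0 x) 0)%R.
have mv : measurable_fun [set: R] v by exact: measurable_maxr.
have v0_ge0 x : (0 <= v x)%R by rewrite /v le_max lexx orbT.
have fv x : ~ N x -> g x = v x.
  by move=> Nx; rewrite /v -fv0// max_l.
have mEv : measurable_fun [set: R] (EFin \o v) by exact/measurable_EFinP.
have mEg : measurable_fun [set: lebesgueR R] (fun x : lebesgueR R => (g x)%:E).
  exact/measurable_EFinP.
have mphi : measurable ((fun x => c * x + b)%R @^-1` D).
  by rewrite -[X in measurable X]setTI; exact: measurable_affine.
rewrite (@ge0_ae_eq_integral _ _ _ cmu _ (EFin \o g) (EFin \o v)).
- rewrite (@ge0_ae_eq_integral _ _ _ cmu _ (fun x => (g (c * x + b)%R)%:E)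
    (fun x => (v (c * x + b)%R)%:E)).
  + rewrite !ge0_integral_completed//.
    * by rewrite -(@ge0_integral_affine c b D (EFin \o v)).
    * apply/measurable_EFinP; apply: (measurableT_comp mv); exact: measurable_affine.
    * by move=> x; rewrite lee_fin.
  + exact: measurable_lebesgueR.
  + by apply/measurable_funTS/measurable_EFinP/measurable_fun_lebesgueR_affine.
  + apply/measurable_funTS/measurable_EFinP/measurable_fun_lebesgueR.
    apply: (measurableT_comp mv); exact: measurable_affine.
  + by move=> x _; rewrite lee_fin.
  + by move=> x _; rewrite lee_fin.
  + exists ((fun x => c * x + b)%R @^-1` N); split.
    * apply: measurable_lebesgueR; rewrite -[X in measurable X]setTI.
      exact: measurable_affine.
    * by rewrite /= -[LHS]/(mu _) lebesgue_measure_affine// N0 mule0.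
    * by move=> x /=; apply: contra_notP => Nx _; rewrite fv.
- exact: measurable_lebesgueR.
- exact/measurable_funTS.
- exact/measurable_funTS/measurable_EFinP/measurable_fun_lebesgueR.
- by move=> x _; rewrite lee_fin.
- by move=> x _; rewrite lee_fin.
- exists N; split => //; first exact: measurable_lebesgueR.
  by move=> x /=; apply: contra_notP => Nx _; rewrite /= fv.
Qed.

End Transfer.

(** * Integrals over a measurable set *)

Notation leb_fun u := (measurable_fun [set: lebesgueR _] (u : lebesgueR _ -> _)).

Section GeneralLp.
Context d (T : measurableType d) (R : realType).
Variable m : {measure set T -> \bar R}.
Local Open Scope ereal_scope.

Lemma measurable_norm_powR (f : T -> R) (p : R) :
  measurable_fun [set: T] f -> measurable_fun [set: T] (fun x => (`|f x| `^ p)%:E).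
Proof.
move=> mf; apply/measurable_EFinP.
apply: (@measurableT_comp _ _ _ _ _ _ (@powR R ^~ p)) => //.
exact: measurableT_comp.
Qed.

Lemma integral_norm_powR_patch (D : set T) (f : T -> R) (p : R) : (0 < p)%R ->
  \int[m]_(x in D) (`|f x| `^ p)%:E = \int[m]_x (`|(f \_ D) x| `^ p)%:E.
Proof.
move=> p0; rewrite integral_mkcond; apply: eq_integral => x _.
rewrite !patchE; case: ifPn => // _.
by rewrite normr0 powR0 ?gt_eqF.
Qed.

Lemma Lnorm_patch (D : set T) (f : T -> R) (p : R) : (0 < p)%R ->
  'N[m]_p%:E [EFin \o (f \_ D)] = (\int[m]_(x in D) (`|f x| `^ p)%:E) `^ p^-1.
Proof.
by move=> p0; rewrite integral_norm_powR_patch// unlock.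
Qed.

(** Minkowski's inequality for the functions cut to D, whose p-th powers vanish off D since
p > 0. *)
Lemma minkowski_on (D : set T) (f g : T -> R) (p : R) : (1 <= p)%R -> measurable D ->
  measurable_fun [set: T] f -> measurable_fun [set: T] g ->
  (\int[m]_(x in D) (`|f x + g x| `^ p)%:E) `^ p^-1 <=
  (\int[m]_(x in D) (`|f x| `^ p)%:E) `^ p^-1 +
  (\int[m]_(x in D) (`|g x| `^ p)%:E) `^ p^-1.
Proof.
move=> p1 mD mf mg; have p0 : (0 < p)%R by apply: lt_le_trans p1.
have := @minkowski_EFin _ _ _ m (f \_ D) (g \_ D) p.
rewrite !Lnorm_patch// => H.
have -> : \int[m]_(x in D) (`|f x + g x| `^ p)%:E =
    \int[m]_x (`|((f \_ D) \+ (g \_ D))%R x| `^ p)%:E.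
  rewrite (integral_norm_powR_patch D (fun x => f x + g x)%R p0).
  apply: eq_integral => x _; rewrite /= !patchE.
  by case: ifPn => // _; rewrite addr0.
apply: le_trans (H _ _ p1); last 2 first.
- by apply/(measurable_restrictT _ _).1 => //; exact: measurable_funTS.
- by apply/(measurable_restrictT _ _).1 => //; exact: measurable_funTS.
by rewrite unlock.
Qed.

(** Hoelder's inequality against the constant 1 on D. The case p = 1 is apart because its dual
exponent is infinite. *)
Lemma jensen_powR (D : set T) (f : T -> R) (p c : R) : (1 <= p)%R -> (0 < c)%R ->
  measurable D -> m D = c%:E -> measurable_fun [set: T] f ->
  (\int[m]_(x in D) `|f x|%:E) `^ p <=
  (c `^ (p - 1))%:E * \int[m]_(x in D) (`|f x| `^ p)%:E.
Proof.
move=> p1 c0 mD mDc mf; have p0 : (0 < p)%R by apply: lt_le_trans p1.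
move: p1; rewrite le_eqVlt => /predU1P[<-|p1].
  rewrite subrr powRr0 mul1e poweRe1; last by apply: integral_ge0.
  by under [leRHS]eq_integral do rewrite powRr1//.
pose q := (1 - p^-1)^-1%R.
have q0 : (0 < q)%R by rewrite invr_gt0 subr_gt0 invf_lt1.
have pq : (p^-1 + q^-1 = 1)%R by rewrite /q invrK addrC subrK.
pose one : T -> R := cst 1%R.
have m1 : measurable_fun [set: T] (one \_ D).
  by apply/(measurable_restrictT _ _).1 => //; exact: measurable_cst.
have mfD : measurable_fun [set: T] (f \_ D).
  by apply/(measurable_restrictT _ _).1 => //; exact: measurable_funTS.
have := hoelder m mfD m1 p0 q0 pq.
rewrite !Lnorm_patch//.
under [X in _ * X `^ _]eq_integral do rewrite normr1 powR1.
rewrite integral_cst// mul1e mDc poweR_EFin.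
have -> : ((f \_ D) \* (one \_ D))%R = f \_ D.
  apply/funext => x; rewrite /= !patchE; case: ifPn => _; by rewrite ?mulr1 ?mulr0.
rewrite Lnorm_patch//.
under eq_integral do rewrite powRr1//.
rewrite invr1 poweRe1; last by apply: integral_ge0.
move=> H; apply: le_trans (gt0_ler_poweR (ltW p0) _ _ H) _.
- by rewrite in_itv/= leey andbT integral_ge0.
- by rewrite in_itv/= leey andbT mule_ge0// ?poweR_ge0// lee_fin powR_ge0.
rewrite poweRM ?poweR_ge0//; last by rewrite lee_fin powR_ge0.
rewrite -poweRrM mulVf ?gt_eqF// poweRe1; last by apply: integral_ge0 => *; rewrite lee_fin powR_ge0.
rewrite muleC poweR_EFin -powRrM.
suff -> : (q^-1 * p = p - 1)%R by [].
by rewrite /q invrK mulrBl mul1r mulVf// gt_eqF.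
Qed.

End GeneralLp.

Section TonelliOn.
Context d1 d2 (T1 : measurableType d1) (T2 : measurableType d2) (R : realType).
Variables (m1 : {sigma_finite_measure set T1 -> \bar R})
          (m2 : {sigma_finite_measure set T2 -> \bar R}).
Local Open Scope ereal_scope.

Lemma tonelli_on (A : set T1) (B : set T2) (h : T1 * T2 -> \bar R) :
  measurable A -> measurable B -> measurable_fun setT h -> (forall z, 0 <= h z) ->
  \int[m1]_(x in A) \int[m2]_(y in B) h (x, y) =
  \int[m2]_(y in B) \int[m1]_(x in A) h (x, y).
Proof.
move=> mA mB mh h0.
pose H := h \_ (A `*` B).
have mH : measurable_fun setT H.
  apply/(measurable_restrictT _ _).1; first exact: measurableX.
  exact: measurable_funTS.
have H0 z : 0 <= H z by rewrite /H patchE; case: ifP.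
transitivity (\int[m1]_x \int[m2]_y H (x, y)).
  rewrite integral_mkcond; apply: eq_integral => x _.
  rewrite patchE; case: ifPn => xA.
    rewrite integral_mkcond; apply: eq_integral => y _.
    by rewrite /H !patchE in_setX xA.
  by rewrite integral0_eq// => y _; rewrite /H patchE in_setX (negbTE xA).
rewrite (@fubini_tonelli _ _ _ _ _ m1 m2 H mH H0).
rewrite [RHS]integral_mkcond; apply: eq_integral => y _.
rewrite patchE; case: ifPn => yB.
  rewrite [RHS]integral_mkcond; apply: eq_integral => x _.
  by rewrite /H !patchE in_setX yB andbT.
by rewrite integral0_eq// => x _; rewrite /H patchE in_setX (negbTE yB) andbF.
Qed.

Lemma measurable_integral_on (B : set T2) (h : T1 * T2 -> \bar R) :
  measurable B -> measurable_fun setT h -> (forall z, 0 <= h z) ->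
  measurable_fun setT (fun x => \int[m2]_(y in B) h (x, y)).
Proof.
move=> mB mh h0.
pose H := h \_ (setT `*` B).
have mH : measurable_fun setT H.
  apply/(measurable_restrictT _ _).1; first exact: measurableX.
  exact: measurable_funTS.
have H0 z : 0 <= H z by rewrite /H patchE; case: ifP.
have := measurable_fun_fubini_tonelli_F (m2 := m2) _ mH H0.
congr measurable_fun; apply/funext => x; rewrite /fubini_F [RHS]integral_mkcond.
by apply: eq_integral => y _; rewrite /H !patchE in_setX in_setT.
Qed.

End TonelliOn.

(** * The space of p-integrable periodic functions *)

Section Circle.
Context {R : realType}.
Notation cmu := (@completed_lebesgue_measure R).
Implicit Types (g f : R -> R) (a b c h p : R).
Local Open Scope ereal_scope.

Lemma measurable_lebesgueR_itv (i : interval R) : measurable ([set` i] : set (lebesgueR R)).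
Proof. by apply: measurable_lebesgueR; exact: measurable_itv. Qed.

Lemma leb_fun_EFin g D : leb_fun g -> measurable_fun (D : set (lebesgueR R)) (fun x => (g x)%:E).
Proof. by move=> mg; apply/measurable_funTS/measurable_EFinP. Qed.

Lemma ge0_subset_integral_itv (i j : interval R) (g : R -> R) :
  leb_fun g -> (forall x, 0 <= g x)%R -> [set` i] `<=` [set` j] ->
  \int[cmu]_(x in [set` i]) (g x)%:E <= \int[cmu]_(x in [set` j]) (g x)%:E.
Proof.
move=> mg g0 ij.
apply: ge0_subset_integral; last exact: ij.
- exact: measurable_lebesgueR_itv.
- exact: measurable_lebesgueR_itv.
- exact: leb_fun_EFin.
- by move=> x _; rewrite lee_fin.
Qed.

Lemma ge0_integralZl_itv (i : interval R) (k : R) (g : R -> \bar R) :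
  measurable_fun [set: lebesgueR R] (g : lebesgueR R -> \bar R) -> (forall x, 0 <= g x) ->
  (0 <= k)%R ->
  \int[cmu]_(x in [set` i]) (k%:E * g x) = k%:E * \int[cmu]_(x in [set` i]) g x.
Proof.
move=> mg g0 k0; apply: ge0_integralZl.
- exact: measurable_lebesgueR_itv.
- exact: measurable_funTS.
- by move=> x _.
- by rewrite lee_fin.
Qed.

Lemma completed_lebesgue_itv (a b : R) (x y : bool) : (a <= b)%R ->
  cmu [set` Interval (BSide x a) (BSide y b)] = (b - a)%:E.
Proof.
move=> ab; rewrite -[LHS]/(lebesgue_measure _) lebesgue_measure_itv/= lte_fin.
by case: ltP => // ba; rewrite (@le_anti _ _ a b) ?ab// subrr.
Qed.

Lemma preimage_affine_itv (c h a b : R) (x y : bool) : (0 < c)%R ->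
  (fun z => c * z + h)%R @^-1` [set` Interval (BSide x (c * a + h)%R) (BSide y (c * b + h)%R)] =
  [set` Interval (BSide x a) (BSide y b)].
Proof.
move=> c0; apply/seteqP; split => z /=;
  by case: x y => -[]; rewrite !in_itv/= ?lerD2r ?ler_pM2l ?ltrD2r ?ltr_pM2l.
Qed.

Lemma ge0_integral_affine_itv (c h a b : R) (x y : bool) g : (0 < c)%R ->
  leb_fun g -> (forall z, 0 <= g z)%R ->
  \int[cmu]_(z in [set` Interval (BSide x a) (BSide y b)]) (g (c * z + h)%R)%:E =
  c^-1%:E * \int[cmu]_(z in [set` Interval (BSide x (c * a + h)%R) (BSide y (c * b + h)%R)]) (g z)%:E.
Proof.
move=> c0 mg g0; rewrite -(@ge0_integral_completed_affine R c h _ g)//.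
by rewrite preimage_affine_itv.
Qed.

Lemma ge0_integral_shift_itv (h a b : R) (x y : bool) g :
  leb_fun g -> (forall z, 0 <= g z)%R ->
  \int[cmu]_(z in [set` Interval (BSide x a) (BSide y b)]) (g (z + h)%R)%:E =
  \int[cmu]_(z in [set` Interval (BSide x (a + h)%R) (BSide y (b + h)%R)]) (g z)%:E.
Proof.
move=> mg g0; have := @ge0_integral_affine_itv 1 h a b x y g ltr01 mg g0.
by rewrite invr1 mul1e !mul1r => <-; under [RHS]eq_integral do rewrite mul1r.
Qed.

Lemma ge0_integral_itv_co_cat a b c g : (a <= b)%R -> (b <= c)%R ->
  leb_fun g -> (forall z, 0 <= g z)%R ->
  \int[cmu]_(z in `[a, c[) (g z)%:E =
  \int[cmu]_(z in `[a, b[) (g z)%:E + \int[cmu]_(z in `[b, c[) (g z)%:E.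
Proof.
move=> ab bc mg g0.
rewrite (@itv_bndbnd_setU _ _ (BLeft a) (BLeft b) (BLeft c)) ?bnd_simp//.
apply: ge0_integral_setU.
- exact: measurable_lebesgueR_itv.
- exact: measurable_lebesgueR_itv.
- exact: leb_fun_EFin mg.
- by move=> x _; rewrite lee_fin.
- apply/disj_setPLR => z /=; rewrite !in_itv/= => /andP[_ zb].
  by apply/negP; rewrite negb_and -ltNge zb.
Qed.

Lemma periodicz g (n : int) : periodic g 1%R -> forall x, g (x + n%:~R)%R = g x.
Proof.
move=> pg x; case: n => n.
  by rewrite -pmulrn -[n%:R]/(1 *+ n)%R periodicn.
rewrite NegzE mulrNz -pmulrn -[in RHS](subrK n.+1%:R x)%R.
by rewrite -[in RHS]/(1 *+ n.+1)%R periodicn.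
Qed.

(** An integer shift brings a into [0, 1[; then [a, 1[ and [1, a + 1[ make up a period, the
second piece being a translate of [0, a[. *)
Lemma ge0_integral_period a g : leb_fun g -> (forall z, 0 <= g z)%R -> periodic g 1%R ->
  \int[cmu]_(z in `[a, (a + 1)%R[) (g z)%:E = \int[cmu]_(z in `[0%R, 1%R[) (g z)%:E.
Proof.
move=> mg g0 pg.
wlog : a / (0 <= a < 1)%R => [wlg|/andP[a0 a1]].
  pose n := Num.floor a.
  have -> : \int[cmu]_(z in `[a, (a + 1)%R[) (g z)%:E =
      \int[cmu]_(z in `[(a - n%:~R)%R, ((a - n%:~R) + 1)%R[) (g z)%:E.
    have := @ge0_integral_shift_itv n%:~R (a - n%:~R)%R (a - n%:~R + 1)%R true true g mg g0.
    rewrite subrK addrAC subrK => <-.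
    by apply: eq_integral => z _; rewrite periodicz.
  apply: wlg; rewrite subr_ge0 ltrBlDl; apply/andP; split; first exact: floor_le_tmp.
  by have := floorD1_gt a; rewrite intrD.
rewrite (@ge0_integral_itv_co_cat _ 1)//; [|exact: ltW|lra].
rewrite (@ge0_integral_itv_co_cat 0 a 1)//; last exact: ltW.
rewrite addeC; congr (_ + _).
rewrite -{1}(add0r 1%R) -ge0_integral_shift_itv//.
by apply: eq_integral => z _; rewrite pg.
Qed.

Lemma periodic_norm_powR f p : periodic f 1%R -> periodic (fun x => `|f x| `^ p)%R 1%R.
Proof. by move=> pf x; rewrite pf. Qed.

Lemma leb_fun_norm_powR f p : leb_fun f -> leb_fun (fun x => `|f x| `^ p)%R.
Proof. by move=> mf; apply/measurable_EFinP; exact: measurable_norm_powR. Qed.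

Lemma leb_fun_shift f h : leb_fun f -> leb_fun (fun x => f (x + h)%R).
Proof.
move=> /(measurable_fun_lebesgueR_affine h ltr01).
by under eq_fun do rewrite mul1r.
Qed.

Lemma normLp_shift p f h : leb_fun f -> periodic f 1%R ->
  normLp p (fun x => f (x + h)%R) = normLp p f.
Proof.
move=> mf pf; have m := leb_fun_norm_powR p mf.
have g0 z : (0 <= `|f z| `^ p)%R := powR_ge0 _ _.
have E := @ge0_integral_shift_itv h 0 1 true true (fun x => `|f x| `^ p)%R m g0.
rewrite add0r addrC (ge0_integral_period h m g0 (periodic_norm_powR p pf)) in E.
by rewrite /normLp E.
Qed.

Lemma normLp_ge0 p f : 0 <= normLp p f.
Proof. exact: poweR_ge0. Qed.

Lemma normLpD p f g : (1 <= p)%R -> leb_fun f -> leb_fun g ->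
  normLp p (f \+ g)%R <= normLp p f + normLp p g.
Proof. by move=> p1 mf mg; apply: minkowski_on => //; exact: measurable_lebesgueR_itv. Qed.

Lemma normLpZ p f c : (1 <= p)%R -> leb_fun f ->
  normLp p (fun x => c * f x)%R = `|c|%:E * normLp p f.
Proof.
move=> p1 mf; rewrite /normLp; have p0 : (0 < p)%R by apply: lt_le_trans p1.
under eq_integral do rewrite normrM powRM// EFinM.
rewrite ge0_integralZl_itv; [|exact: leb_fun_EFin (leb_fun_norm_powR p mf)| |exact: powR_ge0].
  rewrite poweRM; first last.
  + by apply: integral_ge0 => *; rewrite lee_fin powR_ge0.
  + by rewrite lee_fin powR_ge0.
  by rewrite poweR_EFin -powRrM mulfV ?gt_eqF// powRr1.
by move=> x; rewrite lee_fin powR_ge0.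
Qed.

Lemma eq_normLp p f g : f =1 g -> normLp p f = normLp p g.
Proof. by move=> fg; congr normLp; apply/funext. Qed.

Lemma eq_norm_normLp p f g : (forall x, `|f x| = `|g x|)%R -> normLp p f = normLp p g.
Proof.
by move=> fg; rewrite /normLp; under eq_integral => x _ do rewrite fg.
Qed.

Lemma ae_eq_normLp p f g : leb_fun f -> leb_fun g ->
  {ae cmu, forall x, f x = g x} -> normLp p f = normLp p g.
Proof.
move=> mf mg fg.
suff E : \int[cmu]_(x in `[0%R, 1%R[) (`|f x| `^ p)%:E = \int[cmu]_(x in `[0%R, 1%R[) (`|g x| `^ p)%:E.
  by rewrite /normLp E.
apply: ge0_ae_eq_integral.
- exact: measurable_lebesgueR_itv.
- by apply: leb_fun_EFin; exact: leb_fun_norm_powR.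
- by apply: leb_fun_EFin; exact: leb_fun_norm_powR.
- by move=> *; rewrite lee_fin powR_ge0.
- by move=> *; rewrite lee_fin powR_ge0.
- apply: filterS fg; first exact: (ae_filter_ringOfSetsType cmu).
  by move=> x /= -> .
Qed.

Lemma leb_fun_ae f g : leb_fun f -> {ae cmu, forall x, f x = g x} -> leb_fun g.
Proof.
move=> mf fg; apply/measurable_EFinP.
apply: (ae_measurable_fun (@completed_lebesgue_measure_is_complete R) (f := EFin \o f)).
  apply: filterS fg; first exact: (ae_filter_ringOfSetsType cmu).
  by move=> x /= ->.
exact/measurable_EFinP.
Qed.

Lemma LpD p f g : (1 <= p)%R -> Lp p f -> Lp p g -> Lp p (f \+ g)%R.
Proof.
move=> p1 [pf mf nf] [pg mg ng]; split.
- by move=> x; rewrite /= pf pg.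
- exact: measurable_funD.
- exact: le_lt_trans (normLpD p1 mf mg) (lte_add_pinfty nf ng).
Qed.

Lemma LpZ p f c : (1 <= p)%R -> Lp p f -> Lp p (fun x => c * f x)%R.
Proof.
move=> p1 [pf mf nf]; split.
- by move=> x; rewrite /= pf.
- exact: measurable_funM.
- by rewrite normLpZ// lte_mul_pinfty// lee_fin.
Qed.

Lemma LpB p f g : (1 <= p)%R -> Lp p f -> Lp p g -> Lp p (f \- g)%R.
Proof.
move=> p1 lf lg; have := LpD p1 lf (LpZ (-1) p1 lg).
by congr Lp; apply/funext => x /=; rewrite mulN1r.
Qed.

Lemma Lp_shift p f h : Lp p f -> Lp p (fun x => f (x + h)%R).
Proof.
move=> [pf mf nf]; split; last by rewrite normLp_shift.
- by move=> x; rewrite addrAC pf.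
- exact: leb_fun_shift.
Qed.

Lemma Lp_sum p (I : Type) (s : seq I) (F : I -> R -> R) : (1 <= p)%R ->
  (forall i, Lp p (F i)) -> Lp p (fun x => \sum_(i <- s) F i x)%R.
Proof.
move=> p1 LF; elim: s => [|i s IH].
  have -> : (fun x => \sum_(i <- [::]) F i x)%R = (fun=> 0%R) :> (R -> R).
    by apply/funext => x; rewrite big_nil.
  split => //; rewrite /normLp.
  under eq_integral do rewrite normr0 powR0 ?gt_eqF ?(lt_le_trans _ p1)//.
  by rewrite integral0 poweR0r// invr_neq0// gt_eqF// (lt_le_trans _ p1).
have := LpD p1 (LF i) IH; congr Lp; apply/funext => x /=.
by rewrite big_cons.
Qed.

Lemma normLp_sum p (I : Type) (s : seq I) (F : I -> R -> R) : (1 <= p)%R ->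
  (forall i, leb_fun (F i)) ->
  normLp p (fun x => \sum_(i <- s) F i x)%R <= \sum_(i <- s) normLp p (F i).
Proof.
move=> p1 LF; elim: s => [|i s IH].
  rewrite (@eq_normLp _ _ (fun=> 0%R)); last by move=> x; rewrite big_nil.
  rewrite big_nil /normLp.
  under eq_integral do rewrite normr0 powR0 ?gt_eqF ?(lt_le_trans _ p1)//.
  by rewrite integral0 poweR0r// invr_neq0// gt_eqF// (lt_le_trans _ p1).
rewrite big_cons; apply: (@le_trans _ _ (normLp p (F i) + normLp p (fun x => \sum_(i <- s) F i x)%R)).
  rewrite (@eq_normLp _ _ (F i \+ (fun x => \sum_(i <- s) F i x))%R); last first.
    by move=> x; rewrite big_cons.
  exact: normLpD p1 (LF i) (measurable_sum _ LF).
exact: leeD (lexx _) IH.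
Qed.

Lemma normLp_fine p f : Lp p f -> normLp p f = (fine (normLp p f))%:E.
Proof. by move=> [_ _ nf]; rewrite fineK// ge0_fin_numE// normLp_ge0. Qed.

Lemma normLp_pow p f : (1 <= p)%R ->
  normLp p f `^ p = \int[cmu]_(x in `[0%R, 1%R[) (`|f x| `^ p)%:E.
Proof.
move=> p1; rewrite -poweRrM mulVf ?gt_eqF ?(lt_le_trans _ p1)// poweRe1//.
by apply: integral_ge0 => *; rewrite lee_fin powR_ge0.
Qed.

Lemma normLp_le p f c : (1 <= p)%R -> (0 <= c)%R ->
  \int[cmu]_(x in `[0%R, 1%R[) (`|f x| `^ p)%:E <= (c `^ p)%:E -> normLp p f <= c%:E.
Proof.
move=> p1 c0 H; have p0 : (0 < p)%R by apply: lt_le_trans p1.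
have -> : c%:E = ((c `^ p)%:E) `^ p^-1.
  by rewrite poweR_EFin -powRrM mulfV ?gt_eqF// powRr1.
apply: gt0_ler_poweR => //; first by rewrite invr_ge0 ltW.
- by rewrite in_itv/= leey andbT; apply: integral_ge0 => *; rewrite lee_fin powR_ge0.
- by rewrite in_itv/= leey andbT lee_fin powR_ge0.
Qed.

(** Finitely many periods cover [a, b[. *)
Lemma Lp_integral_powR_lty p f a b : (1 <= p)%R -> Lp p f ->
  \int[cmu]_(x in `[a, b[) (`|f x| `^ p)%:E < +oo.
Proof.
move=> p1 [pf mf nf].
have mp := leb_fun_norm_powR p mf.
have g0 z : (0 <= `|f z| `^ p)%R by exact: powR_ge0.
have pp := periodic_norm_powR p pf.
have I1 : \int[cmu]_(x in `[0%R, 1%R[) (`|f x| `^ p)%:E < +oo.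
  by rewrite -normLp_pow//; exact: poweR_lty.
pose N := (Num.truncn (b - a)).+1.
have bN : (b <= a + N%:R)%R by rewrite -lerBlDl ltW// truncnS_gt.
apply: (@le_lt_trans _ _ (\int[cmu]_(x in `[a, (a + N%:R)%R[) (`|f x| `^ p)%:E)).
  by apply: (ge0_subset_integral_itv mp g0); apply: subset_itvl; rewrite bnd_simp.
elim: N {bN} => [|n IH]; first by rewrite addr0 set_itvco0 integral_set0.
rewrite (@ge0_integral_itv_co_cat _ (a + n%:R)%R)//; last 2 first.
  by rewrite lerDl.
  by rewrite lerD2l ler_nat.
rewrite lte_add_pinfty// -natr1 addrA (ge0_integral_period _ mp g0 pp).
exact: I1.
Qed.

Lemma Lp_integral_norm_lty p f a b : (1 <= p)%R -> Lp p f ->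
  \int[cmu]_(x in `[a, b]) `|f x|%:E < +oo.
Proof.
move=> p1 lf; have [_ mf _] := lf.
have p0 : (0 < p)%R by apply: lt_le_trans p1.
apply: (@le_lt_trans _ _ (\int[cmu]_(x in `[a, (Num.max a b + 1)%R[) `|f x|%:E)).
  have mnf : leb_fun (fun x => `|f x|)%R by exact: measurableT_comp.
  apply: (ge0_subset_integral_itv mnf) => [x|]; first exact: normr_ge0.
  apply: subset_itvl; rewrite bnd_simp (@le_lt_trans _ _ (Num.max a b))//.
    by rewrite le_max lexx orbT.
  by rewrite ltrDl.
have aM : (a < Num.max a b + 1)%R.
  by rewrite (@le_lt_trans _ _ (Num.max a b)) ?le_max ?lexx// ltrDl.
have := @jensen_powR _ _ _ cmu `[a, (Num.max a b + 1)%R[ f p (Num.max a b + 1 - a)%R p1.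
rewrite subr_gt0 aM => /(_ isT (measurable_lebesgueR_itv _) (completed_lebesgue_itv true true (ltW aM)) mf) H.
apply: (@lty_poweRy _ _ p); first by rewrite gt_eqF.
apply: (le_lt_trans H); apply: lte_mul_pinfty => //.
- by rewrite lee_fin powR_ge0.
- exact: Lp_integral_powR_lty.
Qed.

Lemma Lp_integrable p f a b : (1 <= p)%R -> Lp p f ->
  cmu.-integrable `[a, b] (EFin \o f).
Proof.
move=> p1 lf; have [_ mf _] := lf.
apply/integrableP; split; first exact: leb_fun_EFin.
exact: Lp_integral_norm_lty p1 lf.
Qed.

End Circle.

(** * Absolute continuity and total variation *)

Section IntervalFamilies.
Context {R : realType}.
Implicit Types (p q : R * R) (s l : seq (R * R)) (F : R -> R).

Definition disj_itv p q := (p.2 <= q.1) || (q.2 <= p.1).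

Definition sub_itv (u v : R) p := [&& u <= p.1, p.1 <= p.2 & p.2 <= v].

Lemma disj_itvC p q : disj_itv p q = disj_itv q p.
Proof. by rewrite /disj_itv orbC. Qed.

(** Absolute continuity for sequences of endpoint pairs, the form on which the inductions
below run. *)
Lemma absolutely_continuous_seq (u v : R) F (e : R) :
  absolutely_continuous_on u v F -> 0 < e ->
  exists2 d : R, 0 < d & forall s, all (sub_itv u v) s -> pairwise disj_itv s ->
    \sum_(p <- s) (p.2 - p.1) < d -> \sum_(p <- s) `|F p.2 - F p.1| < e.
Proof.
move=> acF e0; have [d d0 H] := acF e e0; exists d => // s sub dis sd.
pose x0 : R * R := (0, 0).
rewrite (big_nth x0) big_mkord.
apply: (H (size s) (fun i => (nth x0 s i).1) (fun i => (nth x0 s i).2)).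
- by move=> i; move/(all_nthP x0)/(_ i (ltn_ord i))/and3P : sub.
- apply/trivIsetP => i j _ _ ij; apply/seteqP; split => // x /=.
  rewrite !in_itv/= => -[/andP[ix xi] /andP[jx xj]].
  have : disj_itv (nth x0 s i) (nth x0 s j).
    have : (i != j :> nat) by [].
    rewrite neq_ltn => /orP[|] ?; last rewrite disj_itvC;
      by move/(pairwiseP x0) : dis; apply; rewrite ?inE ?ltn_ord.
  by rewrite /disj_itv => /orP[|]; [rewrite leNgt (lt_trans jx)|
    rewrite leNgt (lt_trans ix)].
- by rewrite (big_nth x0) big_mkord in sd.
Qed.

(** When p meets a member q of s, the two are replaced by their convex hull, whose length is at
most the sum of theirs, and the hull is inserted in the shorter sequence. *)
Lemma insert_disjoint (u v : R) n s p : (size s <= n)%N ->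
  all (sub_itv u v) (p :: s) -> pairwise disj_itv s ->
  exists l, [/\ all (sub_itv u v) l, pairwise disj_itv l,
    \sum_(q <- l) (q.2 - q.1) <= (p.2 - p.1) + \sum_(q <- s) (q.2 - q.1) &
    forall x, has (fun q => q.1 < x <= q.2) (p :: s) -> has (fun q => q.1 < x <= q.2) l].
Proof.
elim: n s p => [|n IH] s p.
  rewrite leqn0 size_eq0 => /eqP -> ps _; exists [:: p]; split => //.
  by rewrite big_seq1 big_nil addr0.
move=> sn /= /andP[up us] dis.
have [ps|/allPn[q qs pq]] := boolP (all (disj_itv p) s).
  by exists (p :: s); rewrite /= up us ps dis big_cons.
have := perm_to_rem qs => pe.
pose h := (Num.min p.1 q.1, Num.max p.2 q.2).
have uq : sub_itv u v q by move/allP : us => /(_ _ qs).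
have sub_rem : subseq (rem q s) s by exact: rem_subseq.
have [|||l [ul dl sl xl]] := IH (rem q s) h.
- by rewrite size_rem// -ltnS; case: (s) qs sn.
- rewrite /=; apply/andP; split; last first.
    by apply/allP => z /mem_rem zs; move/allP : us; exact.
  move: up uq; rewrite /sub_itv /h /= => /and3P[? ? ?] /and3P[? ? ?].
  by rewrite le_min ge_max ge_min le_max; apply/and3P; split; lra.
- exact: subseq_pairwise dis.
exists l; split => //.
- apply: (le_trans sl).
  rewrite (perm_big _ pe) big_cons/= addrA lerD2r /h /=.
  move: pq up uq; rewrite /disj_itv /sub_itv negb_or -!ltNge.
  move=> /andP[? ?] /and3P[? ? ?] /and3P[? ? ?].
  by case: (leP p.1 q.1) => ?; case: (leP p.2 q.2) => ?; lra.
- move=> x; rewrite /= (perm_has _ pe)/= => /orP[xp|/orP[xq|xr]]; apply: xl => /=.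
  + move: xp => /andP[? ?]; rewrite gt_min le_max.
    by apply/orP; left; apply/andP; split; apply/orP; left.
  + move: xq => /andP[? ?]; rewrite gt_min le_max.
    by apply/orP; left; apply/andP; split; apply/orP; right.
  + by rewrite xr orbT.
Qed.

(** Covers of null sets may overlap, while absolute continuity speaks of disjoint intervals. *)
Lemma disjoint_cover (u v : R) s : all (sub_itv u v) s ->
  exists l, [/\ all (sub_itv u v) l, pairwise disj_itv l,
    \sum_(q <- l) (q.2 - q.1) <= \sum_(q <- s) (q.2 - q.1) &
    forall x, has (fun q => q.1 < x <= q.2) s -> has (fun q => q.1 < x <= q.2) l].
Proof.
elim: s => [_|p s IH /= /andP[up us]]; first by exists [::].
have [l [ul dl sl xl]] := IH us.
have [||//|l' [ul' dl' sl' xl']] := @insert_disjoint u v (size l) l p => //.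
  by rewrite /= up.
exists l'; split => //; first by rewrite big_cons (le_trans sl')// lerD2l.
move=> x /orP[xp|xs]; apply: xl' => /=; first by rewrite xp.
by rewrite xl ?orbT.
Qed.

Fixpoint cells (x : R) (l : seq R) : seq (R * R) :=
  if l is y :: l' then (x, y) :: cells y l' else [::].

Lemma cells_ge x (l : seq R) : path <%R x l -> all (fun p => (x <= p.1) && (p.1 <= p.2) && (p.2 <= last x l)) (cells x l).
Proof.
elim: l x => // y l IH x /= /andP[xy pl]; rewrite lexx ltW//=; apply/andP; split.
  have : all (>= y) l.
    have := order_path_min (@lt_trans _ _) pl.
    by apply: sub_all => z /ltW.
  move=> /allP yl; have := mem_last y l; rewrite inE => /predU1P[->//|].
  exact: yl.
apply: sub_all (IH _ pl) => p /andP[/andP[yp ->] ->]; rewrite !andbT.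
by rewrite (le_trans (ltW xy)).
Qed.

Lemma cells_disj x (l : seq R) : path <%R x l -> pairwise disj_itv (cells x l).
Proof.
elim: l x => // y l IH x /= /andP[xy pl]; rewrite IH// andbT.
apply: sub_all (cells_ge pl) => p /andP[/andP[yp _] _].
by rewrite /disj_itv /= yp.
Qed.

Lemma cells_sum x (l : seq R) : \sum_(p <- cells x l) (p.2 - p.1) = last x l - x.
Proof.
elim: l x => [x|y l IH x]; first by rewrite big_nil/= subrr.
by rewrite big_cons/= IH addrC subrKA.
Qed.

Lemma cells_variation x y F (l : seq R) :
  variation x y F l = \sum_(p <- cells x l) `|F p.2 - F p.1|.
Proof.
elim: l x => [x|z l IH x]; first by rewrite variation_nil big_nil.
rewrite big_cons/= -IH /variation /= big_nat_recl//=.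
Qed.

(** The intervals may be cut along the partitions that define their total variations: the
resulting family is still disjoint and has the same total length. *)
Lemma absolutely_continuous_TV (u v : R) F (e : R) :
  absolutely_continuous_on u v F -> 0 < e ->
  exists2 d : R, 0 < d & forall s, all (sub_itv u v) s -> pairwise disj_itv s ->
    \sum_(p <- s) (p.2 - p.1) < d ->
    (\sum_(p <- s) total_variation p.1 p.2 F <= e%:E)%E.
Proof.
move=> acF e0; have [d d0 H] := absolutely_continuous_seq acF e0; exists d => //.
(* The intervals of s are cut one after the other, t being the cells obtained so far. *)
suff K s t : all (sub_itv u v) (s ++ t) -> pairwise disj_itv (s ++ t) ->
    \sum_(p <- s ++ t) (p.2 - p.1) < d ->
    (\sum_(p <- s) total_variation p.1 p.2 F + (\sum_(p <- t) `|F p.2 - F p.1|)%:E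
       <= e%:E)%E.
  move=> s sub dis sd; have := K s [::]; rewrite cats0 big_nil adde0; exact.
elim: s t => [t sub dis sd|p s IH t].
  by rewrite big_nil add0e lee_fin ltW// H.
move=> /= /andP[up us] /andP[dp dis]; rewrite big_cons => sd.
have p12 : p.1 <= p.2 by case/and3P : up.
have sd' : \sum_(q <- s ++ t) (q.2 - q.1) < d.
  by apply: le_lt_trans sd; rewrite lerDr subr_ge0.
have IHt := IH t us dis sd'.
set X := (\sum_(q <- s) total_variation q.1 q.2 F)%E.
have X0 : (0 <= X)%E.
  rewrite /X big_seq; apply: sume_ge0 => q qs; apply: total_variation_ge0.
  by move/allP : us => /(_ q); rewrite mem_cat qs => /(_ isT)/and3P[].
have Xfin : X \is a fin_num.
  rewrite ge0_fin_numE//; have : (X + (\sum_(p <- t) `|F p.2 - F p.1|)%:E < +oo)%E.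
    by apply: (le_lt_trans IHt); rewrite ltry.
  by apply: le_lt_trans; rewrite leeDl// lee_fin sumr_ge0.
rewrite big_cons -/X -addeA -leeBrDr; last by rewrite fin_numD Xfin.
apply: ge_ereal_sup => _ [_ [l [pl /eqP lp] <-] <-].
rewrite leeBrDr; last by rewrite fin_numD Xfin.
rewrite cells_variation addeCA -EFinD -big_cat/=.
have cp q : q \in cells p.1 l -> sub_itv p.1 p.2 q.
  move=> ql; move/allP : (cells_ge pl) => /(_ q ql).
  by rewrite lp /sub_itv andbA.
have cd q z : q \in cells p.1 l -> disj_itv p z -> disj_itv q z.
  move=> /cp /and3P[? ? ?]; rewrite /disj_itv => /orP[|] ?; apply/orP; [left|right]; lra.
apply: IH.
- rewrite !all_cat; move: us; rewrite all_cat => /andP[-> ->]; rewrite andbT/=.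
  apply/allP => q /cp; move: up; rewrite /sub_itv => /and3P[? ? ?] /and3P[? ? ?].
  by apply/and3P; split; lra.
- move: dis dp; rewrite !pairwise_cat !all_cat => /and3P[st ss tt] /andP[ps pt].
  rewrite ss tt cells_disj//= andbT; apply/andP; split.
    rewrite allrel_catr st andbT; apply/allrelP => a b /= sa lb.
    by rewrite disj_itvC; apply: cd lb _; move/allP : ps; exact.
  by apply/allrelP => a b /= la tb; apply: cd la _; move/allP : pt; exact.
- rewrite !big_cat/= cells_sum lp; move: sd; rewrite big_cat/=; lra.
Qed.

(** [u, v] is a finite union of intervals of length d / 2, on each of which the variation is at
most 1. *)
Lemma absolutely_continuous_BV (u v : R) F : u <= v ->
  absolutely_continuous_on u v F -> bounded_variation u v F.
Proof.
move=> uv acF; apply/bounded_variationP => //.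
have [d d0 H] := absolutely_continuous_TV acF (@ltr01 R).
have H1 x y : u <= x -> x <= y -> y <= v -> y - x < d ->
    (total_variation x y F <= 1%:E)%E.
  move=> ux xy yv xyd; have := H [:: (x, y)]; rewrite !big_seq1/= /sub_itv /= ux xy yv.
  by apply.
suff K (n : nat) :
    (total_variation u (Num.min v (u + n%:R * (d / 2)))%R F <= n%:R%:E)%E.
  rewrite ge0_fin_numE ?total_variation_ge0//.
  pose m := (Num.truncn ((v - u) / (d / 2))).+1.
  have := K m; rewrite min_l; first by move/le_lt_trans; apply; rewrite ltry.
  rewrite -lerBlDl -ler_pdivrMr ?divr_gt0// ltW//.
  exact: truncnS_gt.
elim: n => [|n IH].
  by rewrite mul0r addr0 min_r// total_variationxx.
set x := Num.min v (u + n%:R * (d / 2)); set y := Num.min v _.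
have nd : 0 <= n%:R * (d / 2) by rewrite mulr_ge0// ltW// divr_gt0.
have ux : u <= x by rewrite le_min uv lerDl.
have yE : y = Num.min v ((u + n%:R * (d / 2)) + d / 2).
  by rewrite /y -natr1 mulrDl mul1r addrA.
have xy : x <= y.
  by rewrite yE /x le_min !ge_min lexx/=; apply/orP; right; lra.
have yv : y <= v by rewrite /y ge_min lexx.
rewrite (total_variationD _ ux xy) -natr1 EFinD leeD// H1//.
rewrite yE /x; set a := (u + n%:R * (d / 2)).
by case: (leP v (a + d / 2)) => ?; case: (leP v a) => ?; lra.
Qed.

End IntervalFamilies.

(** * Densities of monotone absolutely continuous functions *)

Section MonotoneDensity.
Context {R : realType}.
Notation mu := (@lebesgue_measure R).

Lemma lebesgue_stieltjes_itvoc (f : cumulative R R) (x y : R) : x <= y ->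
  lebesgue_stieltjes_measure f `]x, y] = (f y - f x)%:E.
Proof.
move=> xy; rewrite /lebesgue_stieltjes_measure /measure_extension/=.
by rewrite measurable_mu_extE/= ?wlength_itv_bnd//; exact: is_ocitv.
Qed.

(** Composition with this map extends a function on [u, v] by constants. *)
Definition clamp (u v x : R) := Num.max u (Num.min v x).

Lemma clamp_id u v x : u <= x -> x <= v -> clamp u v x = x.
Proof. by move=> ux xv; rewrite /clamp min_r// max_r. Qed.

Lemma clampP u v x : u <= v -> u <= clamp u v x <= v.
Proof. by move=> uv; rewrite /clamp le_max lexx ge_max uv ge_min lexx. Qed.

Lemma clamp_le u v x y : x <= y -> clamp u v x <= clamp u v y.
Proof.
move=> xy; rewrite /clamp; case: (leP v x) => ?; case: (leP v y) => ?;
  case: (leP u v) => ?; case: (leP u x) => ?; case: (leP u y) => ?; lra.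
Qed.

Lemma clamp_dist u v x y : x <= y -> clamp u v y - clamp u v x <= y - x.
Proof.
move=> xy; rewrite /clamp; case: (leP v x) => ?; case: (leP v y) => ?;
  case: (leP u v) => ?; case: (leP u x) => ?; case: (leP u y) => ?; lra.
Qed.

(** The Lebesgue-Stieltjes measure of the extension of G by constants is absolutely continuous:
a null set is covered by intervals of small total length, a disjoint family covers these at no
greater length, and G grows little on it. The density is the Radon-Nikodym derivative. The
smallness hypothesis is in the form <= e, which suprema such as total variations satisfy. *)
Lemma monotone_density (u v : R) (G : R -> R) : u <= v ->
  (forall x y, u <= x -> x <= y -> y <= v -> G x <= G y) ->
  (forall e : R, 0 < e -> exists2 d : R, 0 < d &
    forall s, all (sub_itv u v) s -> pairwise disj_itv s ->
    \sum_(p <- s) (p.2 - p.1) < d -> \sum_(p <- s) (G p.2 - G p.1) <= e) ->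
  exists2 f : R -> R, mu.-integrable [set: R] (EFin \o f) &
    forall x y, u <= x -> x <= y -> y <= v ->
      (G y - G x)%:E = (\int[mu]_(t in `]x, y]) (f t)%:E)%E.
Proof.
move=> uv Gnd GH.
pose H x := G (clamp u v x).
have Hnd : nondecreasing H.
  move=> x y xy; have /andP[? ?] := clampP x uv; have /andP[? ?] := clampP y uv.
  by apply: Gnd => //; exact: clamp_le.
have Hrc : right_continuous H.
  move=> x; apply/cvgrPdist_le => e e0.
  have [d d0 He] := GH _ e0; near=> y.
  have xy : x <= y by near: y; exact: nbhs_right_ge.
  have yxd : y - x < d.
    rewrite ltrBlDl; near: y; apply: nbhs_right_lt; lra.
  rewrite distrC ger0_norm ?subr_ge0; last exact: Hnd.
  have := He [:: (clamp u v x, clamp u v y)]; rewrite !big_seq1/= /sub_itv/=.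
  have /andP[-> _] := clampP x uv; have /andP[_ ->] := clampP y uv.
  rewrite clamp_le//; apply => //.
  by apply: le_lt_trans yxd; exact: clamp_dist.
pose C : cumulative R R := HB.pack H (isCumulative.Build R _ R H Hnd Hrc).
pose m : {measure set (measurableTypeR R) -> \bar R} := lebesgue_stieltjes_measure C.
have mE x y : x <= y -> m `]x, y]%classic = (H y - H x)%:E.
  exact: lebesgue_stieltjes_itvoc.
have muv : (m `]u, v]%classic < +oo)%E by rewrite mE// ltry.
have mD : measurable (`]u, v]%classic : set (measurableTypeR R)) by exact: measurable_itv.
pose mr : {finite_measure set (measurableTypeR R) -> \bar R} := mfrestr mD muv.
pose nu : {charge set (measurableTypeR R) -> \bar R} := charge_of_finite_measure mr.
pose S (s : seq (R * R)) : set R := [set z | has (fun p => p.1 < z <= p.2) s].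
have SE p s : S (p :: s) = `]p.1, p.2]%classic `|` S s.
  apply/seteqP; split => z /=; first by move=> /orP[?|?]; [left|right].
  by move=> [/= ?|?]; apply/orP; [left|right].
have S0 : S [::] = set0 by apply/seteqP; split.
have mS s : measurable (S s : set (measurableTypeR R)).
  elim: s => [|p s IH]; first by rewrite S0; exact: measurable0.
  by rewrite SE; apply: measurableU => //; exact: measurable_itv.
have Sle s : all (sub_itv u v) s -> (m (S s) <= (\sum_(p <- s) (G p.2 - G p.1))%:E)%E.
  elim: s => [_|p s IH /= /andP[/and3P[up p12 pv] us]].
    by rewrite S0 measure0 big_nil.
  rewrite SE big_cons EFinD; apply: le_trans (leeD _ (IH us)).
    by apply: measureU2 => //; exact: measurable_itv.
  rewrite -[X in (X <= _)%E]/(m _) mE//.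
  by rewrite /H !clamp_id// ?(le_trans p12)// (le_trans up).
have Scover e d : 0 < e ->
    (forall s, all (sub_itv u v) s -> pairwise disj_itv s ->
    \sum_(p <- s) (p.2 - p.1) < d -> \sum_(p <- s) (G p.2 - G p.1) <= e) ->
    forall s, all (sub_itv u v) s -> \sum_(p <- s) (p.2 - p.1) < d -> (m (S s) <= e%:E)%E.
  move=> e0 He s us sd; have [l [ul dl sl xl]] := disjoint_cover us.
  apply: (@le_trans _ _ (m (S l))); first by apply: le_measure; rewrite ?inE.
  by apply: le_trans (Sle _ ul) _; rewrite lee_fin He// (le_lt_trans sl).
(* An outer cover of a null set A by half-open intervals, clamped to [u, v]; finite parts of it
are handled by Scover, the whole by continuity of m from below. *)
have numu : nu `<< mu.
  apply/null_content_dominatesP => A mA A0.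
  have mA' : measurable (A `&` `]u, v] : set (measurableTypeR R)) by exact: measurableI.
  apply/eqP; rewrite eq_le measure_ge0 andbT.
  rewrite -[X in (X <= _)%E]/(m (A `&` `]u, v])).
  apply/lee_addgt0Pr => e e0; rewrite add0e.
  have [d d0 He] := GH _ e0.
  have [F [mF AF] Fd] : exists2 F, @measurable_cover _ (ocitv_type R) A F &
     (\sum_(0 <= k <oo) wlength idfun (F k) < d%:E)%E.
    have : mu A \is a fin_num by rewrite A0.
    move=> /lb_ereal_inf_adherent => /(_ _ d0)[_ [F AF <-] Fd]; exists F => //.
    by move: Fd; rewrite -[ereal_inf _]/(mu A) A0 add0e.
  have /choice[ab abF] : forall k, exists ab : R * R, F k = `]ab.1, ab.2]%classic.
    by move=> k; have [ab _ <-] := mF k; exists ab.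
  pose g k := (clamp u v (ab k).1, clamp u v (Num.max (ab k).1 (ab k).2)).
  pose s n := map g (iota 0 n).
  have us n : all (sub_itv u v) (s n).
    apply/allP => _ /mapP[k _ ->]; rewrite /sub_itv /g /=.
    have /andP[-> _] := clampP (ab k).1 uv.
    by have /andP[_ ->] := clampP (Num.max (ab k).1 (ab k).2) uv;
      rewrite clamp_le// le_max lexx.
  have sd n : \sum_(p <- s n) (p.2 - p.1) < d.
    rewrite -lte_fin; apply: le_lt_trans Fd.
    apply: (@le_trans _ _ (\sum_(0 <= k < n) wlength idfun (F k))%E); last first.
      exact: nneseries_lim_ge.
    rewrite /s big_map /index_iota subn0 -sumEFin; apply: lee_sum => k _.
    rewrite abF wlength_itv/= lte_fin.
    have := @clamp_dist u v (ab k).1 (Num.max (ab k).1 (ab k).2).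
    rewrite le_max lexx => /(_ isT); rewrite /g /= -lee_fin => /le_trans; apply.
    by case: (ltP (ab k).1 (ab k).2) => ?; rewrite ?subrr// EFinB.
  apply: (@le_trans _ _ (m (\bigcup_n S (s n)))).
    apply: le_measure; rewrite ?inE//; first exact: bigcupT_measurable.
    move=> z [Az]; rewrite /= in_itv/= => /andP[uz zv].
    have [k _] := AF z Az; rewrite abF/= in_itv/= => /andP[az zb].
    exists k.+1 => //=; apply/hasP; exists (g k).
      by rewrite map_f// mem_iota/= add0n.
    rewrite /g /clamp /= gt_max uz/= gt_min az orbT/= le_max le_min zv/= le_max zb.
    by rewrite !orbT.
  have mU : measurable (\bigcup_n (S \o s) n : set (measurableTypeR R)).
    by apply: bigcupT_measurable => n; exact: mS.
  have ndS : nondecreasing_seq (S \o s).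
    move=> i j ij; apply/subsetPset => z /= /hasP[p /mapP[k ki ->] pz].
    apply/hasP; exists (g k) => //; apply: map_f.
    by move: ki; rewrite !mem_iota/= !add0n => /leq_trans; apply.
  have cv := @nondecreasing_cvg_mu _ _ _ m (S \o s) (fun n => mS (s n)) mU ndS.
  rewrite -(cvg_lim (@ereal_hausdorff R) cv); apply: lime_le.
    by apply/cvg_ex; eexists; exact: cv.
  by apply: nearW => n /=; exact: Scover He _ _ _.
exists (fine \o Radon_Nikodym nu mu).
  have := Radon_Nikodym_integrable numu.
  apply: eq_integrable => // z _ /=; rewrite fineK//.
  exact: Radon_Nikodym_fin_num.
move=> x y ux xy yv.
transitivity (nu `]x, y]%classic).
  rewrite -[RHS]/(m (`]x, y] `&` `]u, v])) setIidl.
    by rewrite mE// /H !clamp_id// ?(le_trans xy)// (le_trans ux).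
  by apply: subset_itv; rewrite bnd_simp.
rewrite (Radon_Nikodym_integral numu); last exact: measurable_itv.
by apply: eq_integral => z _ /=; rewrite fineK//; exact: Radon_Nikodym_fin_num.
Unshelve. all: by end_near. Qed.

End MonotoneDensity.

(** * The fundamental theorem of calculus for absolutely continuous functions *)

Section AbsolutelyContinuous.
Context {R : realType}.
Notation mu := (@lebesgue_measure R).
Notation cmu := (@completed_lebesgue_measure R).

(** With V the total variation from u, both V and V - F are nondecreasing and absolutely
continuous; F is their difference. *)
Lemma absolutely_continuous_primitive (u v : R) (F : R -> R) : u <= v ->
  absolutely_continuous_on u v F ->
  exists2 f : R -> R, mu.-integrable [set: R] (EFin \o f) &
    forall x y, u <= x -> x <= y -> y <= v ->
      (F y - F x)%:E = (\int[mu]_(t in `]x, y]) (f t)%:E)%E.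
Proof.
move=> uv acF.
have bvF := absolutely_continuous_BV uv acF.
have TVfin x y : u <= x -> x <= y -> y <= v -> total_variation x y F \is a fin_num.
  move=> ux xy yv; apply/bounded_variationP => //.
  exact: (bounded_variationl xy yv (bounded_variationr ux (le_trans xy yv) bvF)).
pose V x := fine (total_variation u x F).
have VE x y : u <= x -> x <= y -> y <= v -> (V y - V x)%:E = total_variation x y F.
  move=> ux xy yv; rewrite /V (total_variationD F ux xy).
  by rewrite fineD ?TVfin// ?(le_trans xy)// addrC addKr fineK// TVfin.
have FV x y : u <= x -> x <= y -> y <= v -> `|F y - F x| <= V y - V x.
  by move=> ux xy yv; rewrite -lee_fin VE// total_variation_ge.
have Vs s : all (sub_itv u v) s ->
    (\sum_(p <- s) (V p.2 - V p.1))%:E = (\sum_(p <- s) total_variation p.1 p.2 F)%E.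
  move=> us; rewrite -sumEFin; apply: eq_big_seq => p ps.
  by move/allP : us => /(_ _ ps)/and3P[? ? ?]; rewrite VE.
have [||f1 if1 f1E] := @monotone_density _ u v V uv.
- move=> x y ux xy yv; rewrite -subr_ge0.
  by apply: le_trans (FV _ _ ux xy yv).
- move=> e e0; have [d d0 H] := absolutely_continuous_TV acF e0.
  by exists d => // s us ds sd; rewrite -lee_fin Vs// H.
have [||f2 if2 f2E] := @monotone_density _ u v (fun x => V x - F x) uv.
- move=> x y ux xy yv; have := FV _ _ ux xy yv; rewrite ler_norml; lra.
- move=> e e0; have e20 : 0 < e / 2 by rewrite divr_gt0.
  have [d d0 H] := absolutely_continuous_TV acF e20.
  exists d => // s us ds sd; have := H s us ds sd; rewrite -Vs// lee_fin => Hs.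
  apply: (@le_trans _ _ (\sum_(p <- s) (V p.2 - V p.1) *+ 2)); last first.
    by rewrite sumrMnl mulr2n; lra.
  rewrite big_seq [leRHS]big_seq; apply: ler_sum => p ps.
  move/allP : us => /(_ _ ps)/and3P[up pp pv].
  by have := FV _ _ up pp pv; rewrite ler_norml => /andP[? ?]; lra.
exists (fun x => f1 x - f2 x).
  by apply: eq_integrable (integrableB _ if1 if2).
move=> x y ux xy yv.
have i1 : mu.-integrable `]x, y] (EFin \o f1).
  by apply: integrableS if1.
have i2 : mu.-integrable `]x, y] (EFin \o f2).
  by apply: integrableS if2.
under eq_integral do rewrite EFinB.
rewrite integralB_EFin// -f1E// -f2E// -EFinB; congr EFin; lra.
Qed.

(** Lebesgue's differentiation theorem. Being a primitive is assumed on [u, v] only, and the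
derivative at a point sees a neighbourhood of it. *)
Lemma primitive_derivable (u v : R) (F f : R -> R) :
  mu.-integrable [set: R] (EFin \o f) ->
  (forall x, u <= x -> x <= v -> (F x - F u)%:E = (\int[mu]_(t in `]u, x]) (f t)%:E)%E) ->
  {ae mu, forall x, u < x < v -> derivable F x 1 /\ F^`() x = f x}.
Proof.
move=> intf FE.
have locf : locally_integrable [set: R] f by apply: open_integrable_locally => //; exact: openT.
have intfy (y : R) : mu.-integrable [set` Interval (BRight u) (BRight y)] (EFin \o f).
  by apply: integrableS intf.
have := FTC1 intfy locf.
apply: filterS; first exact: (ae_filter_ringOfSetsType mu).
move=> x /= H /andP[ux xv].
have [|dF0 F0E] := H; first by rewrite lte_fin.
set F0 := (fun y => _) in dF0 F0E.
have nF : \near x, F u + F0 x = F x.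
  have /near_in_itvoo : x \in `]u, v[%R by rewrite in_itv/= ux xv.
  apply: filterS => y; rewrite in_itv/= => /andP[/ltW uy /ltW yv].
  by rewrite /F0 /Rintegral -FE//= addrC subrK.
have dFu : derivable (cst (F u) : R -> R) x 1 := @derivable_cst _ _ _ (F u) x 1.
have dF : derivable (fun y => F u + F0 y) x 1 := derivableD dFu dF0.
split; first exact: near_eq_derivable nF dF.
rewrite derive1E -(near_eq_derive _ nF) (deriveD dFu dF0).
by rewrite derive_cst add0r -derive1E.
Qed.

(** F has a density, which is the derivative almost everywhere; the default values of the total
derivative are taken on a null set. *)
Lemma absolutely_continuous_le (u v : R) (F : R -> R) : u <= v ->
  absolutely_continuous_on u v F ->
  measurable_fun [set: lebesgueR R] (F^`() : lebesgueR R -> R) ->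
  (`|F v - F u|%:E <= \int[cmu]_(x in `[u, v]) `|derive1 F x|%:E)%E.
Proof.
move=> uv acF mF.
have [f intf fE] := absolutely_continuous_primitive uv acF.
have fE' x : u <= x -> x <= v -> (F x - F u)%:E = (\int[mu]_(t in `]u, x]) (f t)%:E)%E.
  by move=> ux xv; rewrite fE.
have dF := primitive_derivable intf fE'.
rewrite -abse_EFin fE'//.
have iuv : mu.-integrable `]u, v] (EFin \o f) by apply: integrableS intf.
apply: le_trans (le_abse_integral _ _ _) _ => //.
  exact: measurable_int iuv.
have mf : measurable_fun [set: R] f by apply/measurable_EFinP; exact: measurable_int intf.
have mnf : measurable_fun [set: R] (fun x => `|f x|%:E).
  by apply/measurable_EFinP; exact: measurableT_comp.
rewrite -integral_itv_bndo_bndc; last exact: measurable_funTS.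
rewrite -ge0_integral_completed//.
apply: (@le_trans _ _ (\int[cmu]_(x in `]u, v[) `|derive1 F x|%:E)%E); last first.
  have mnF : leb_fun (fun x => `|derive1 F x|) by exact: measurableT_comp.
  apply: (ge0_subset_integral_itv mnF) => [x|]; first exact: normr_ge0.
  by apply: subset_itv; rewrite bnd_simp.
rewrite le_eqVlt; apply/orP; left; apply/eqP.
apply: ge0_ae_eq_integral.
- exact: measurable_lebesgueR_itv.
- exact/measurable_funTS/measurable_fun_lebesgueR.
- by apply/measurable_funTS/measurable_EFinP; exact: measurableT_comp.
- by move=> x _; rewrite lee_fin.
- by move=> x _; rewrite lee_fin.
- apply: filterS (ae_completed dF); first exact: (ae_filter_ringOfSetsType cmu).
  move=> x H; by rewrite /= in_itv/= => /H[_ ->].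
Qed.
End AbsolutelyContinuous.

(** * Finite differences *)

Section FiniteDifferences.
Context {R : realType}.
Implicit Types (F g : R -> R) (h x y : R).

Lemma fdiff0 h F x : fdiff 0 h F x = F x.
Proof.
by rewrite /fdiff big_nat1 bin0 expr0 !mul1r subn0 mul0r addr0.
Qed.

Lemma fdiffS s h F x : fdiff s.+1 h F x = fdiff s h F (x + h) - fdiff s h F x.
Proof.
rewrite /fdiff big_nat_recl//= !bin0 subn0.
under eq_bigr do rewrite binS natrD mulrDl mulrDl subSS.
rewrite big_split/= addrA; congr (_ + _); last first.
  by rewrite -sumrN; apply: eq_bigr => i _; rewrite exprS; ring.
rewrite big_nat_recr//= bin_small// !mul0r addr0 [RHS]big_nat_recl//=.
congr (_ + _); first by rewrite bin0 subn0 -natr1; congr (_ * F _); ring.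
rewrite !big_nat; apply: eq_bigr => i /andP[_ si]; congr (_ * F _).
by rewrite -{1}(@subnSK i s)// -natr1; ring.
Qed.

Lemma fdiffSr s h F x : fdiff s.+1 h F x = fdiff s h (fun z => F (z + h) - F z) x.
Proof.
rewrite fdiffS /fdiff -sumrB; apply: eq_bigr => i _.
by rewrite -mulrBr addrAC.
Qed.

Lemma fdiff_zero_step (n : nat) (g : R -> R) (y : R) : (0 < n)%N -> fdiff n 0 g y = 0.
Proof. by case: n => // n _; rewrite fdiffS addr0 subrr. Qed.

(** The terms nu and 2r - nu of a difference of order 2r sit at opposite places around the
centre: both half-sums are the integrand of the Steklov average, at t and at -t. *)
Lemma fdiff_centered (r : nat) (g : R -> R) (y t : R) : (0 < r)%N ->
  fdiff (2 * r) (t / r%:R) g (y - t) =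
  \sum_(0 <= nu < r) ((-1) ^+ nu * 'C(2 * r, nu)%:R) * g (y + (r - nu)%:R / r%:R * t) +
  \sum_(0 <= nu < r) ((-1) ^+ nu * 'C(2 * r, nu)%:R) * g (y + (r - nu)%:R / r%:R * - t) +
  (-1) ^+ r * 'C(2 * r, r)%:R * g y.
Proof.
move=> r0; have rN0 : r%:R != 0 :> R by rewrite pnatr_eq0 -lt0n.
rewrite /fdiff (@big_cat_nat _ _ _ r)//=; last by lia.
rewrite -[RHS]addrA; congr (_ + _).
  rewrite !big_nat; apply: eq_bigr => nu /andP[_ nr].
  rewrite [_%:R * _]mulrC; congr (_ * g _).
  rewrite (_ : 2 * r - nu = r + (r - nu))%N; last by lia.
  by rewrite natrD; field.
rewrite big_nat_recl//; last by lia.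
rewrite addrC; congr (_ + _); last first.
  rewrite [_%:R * _]mulrC; congr (_ * g _).
  by rewrite (_ : 2 * r - r = r)%N; [field|lia].
rewrite big_nat_rev/=.
rewrite -[X in \sum_(X <= _ < _) _]add0n big_addn (_ : 2 * r - r = r)%N; last by lia.
rewrite !big_nat; apply: eq_bigr => nu /andP[_ nr].
rewrite (_ : (r + 2 * r - (nu + r).+1).+1 = 2 * r - nu)%N; last by lia.
rewrite bin_sub; last by lia.
rewrite [_%:R * _]mulrC (_ : 2 * r - (2 * r - nu) = nu)%N; last by lia.
rewrite natrB; last exact: ltnW.
have -> : (-1) ^+ (2 * r - nu) = (-1) ^+ nu :> R.
  by rewrite -signr_odd -[RHS]signr_odd oddB ?oddM//; lia.
by congr (_ * g _); field.
Qed.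

Lemma fdiff_centeredN (r : nat) (g : R -> R) (y t : R) : (0 < r)%N ->
  fdiff (2 * r) (- t / r%:R) g (y + t) = fdiff (2 * r) (t / r%:R) g (y - t).
Proof.
move=> r0; have -> : y + t = y - (- t) by rewrite opprK.
by rewrite !fdiff_centered// opprK; congr (_ + _); rewrite addrC.
Qed.

Lemma fdiffB s h f g x : fdiff s h (f \- g) x = fdiff s h f x - fdiff s h g x.
Proof. by rewrite /fdiff -sumrB; apply: eq_bigr => i _; rewrite mulrBr. Qed.

Lemma derive1_shift F h : derive1 (fun z => F (z + h)) = (fun z => derive1 F (z + h)).
Proof.
apply/funext => z; rewrite /derive1.
have -> : (fun t => t^-1 *: (F (t + z + h) - F (z + h))) =
          (fun t => t^-1 *: (F (t + (z + h)) - F (z + h))) by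
  apply/funext => t; rewrite addrA.
by [].
Qed.

Lemma derive1n_shift F h k : derive1n k (fun z => F (z + h)) = (fun z => derive1n k F (z + h)).
Proof. by elim: k => //= k ->; rewrite derive1_shift. Qed.

Lemma periodic_derive1n F k : periodic F 1 -> periodic (derive1n k F) 1.
Proof.
move=> pF x; have FE : (fun z => F (z + 1)) = F by apply/funext => z; exact: pF.
by have := congr1 (@^~ x) (derive1n_shift F 1 k); rewrite FE => /esym.
Qed.

Lemma derivable_shift F h x : derivable F (x + h) 1 -> derivable (fun z => F (z + h)) x 1.
Proof.
move=> dF; rewrite /derivable.
have -> : (fun k => k^-1 *: (F (k *: 1 + x + h) - F (x + h))) =
  (fun k => k^-1 *: (F (k *: (1 : R) + (x + h)) - F (x + h))).
  by apply/funext => k; rewrite addrA.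
exact: dF.
Qed.

Lemma derive1n_diff F h n : (forall k x, (k < n)%N -> derivable (derive1n k F) x 1) ->
  derive1n n (fun z => F (z + h) - F z) = (fun z => derive1n n F (z + h) - derive1n n F z).
Proof.
elim: n => // n IH dF /=; rewrite IH; last by move=> k x kn; apply: dF; exact: ltnW.
apply/funext => z; rewrite derive1E deriveB.
- by rewrite -!derive1E derive1_shift.
- by apply: derivable_shift; exact: dF.
- exact: dF.
Qed.

(** m applications of the mean value theorem, the last difference being kept as an increment of
the m-th derivative, which in the Sobolev case is only absolutely continuous. *)
Lemma fdiff_mean_value m h F y : 0 < h ->
  (forall k x, (k < m)%N -> derivable (derive1n k F) x 1) ->
  exists2 z, y <= z <= y + m%:R * h &
    fdiff m.+1 h F y = h ^+ m * (derive1n m F (z + h) - derive1n m F z).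
Proof.
move=> h0; elim: m F => [|m IH] F dF.
  exists y; first by rewrite mul0r addr0 lexx.
  by rewrite fdiffS !fdiff0 expr0 mul1r.
rewrite fdiffSr; set G := (fun z => F (z + h) - F z).
have dFm k x : (k < m)%N -> derivable (derive1n k F) x 1.
  by move=> km; apply: dF; exact: ltnW.
have GE k : (k <= m)%N -> derive1n k G = (fun z => derive1n k F (z + h) - derive1n k F z).
  by move=> km; apply: derive1n_diff => j x jk; apply: dF; rewrite ltnS ltnW// (leq_trans jk).
have dG k x : (k <= m)%N -> derivable (derive1n k G) x 1.
  move=> km; rewrite GE//; apply: derivableB; last exact: dF.
  by apply: derivable_shift; exact: dF.
have [|z /andP[yz zy] ->] := IH G; first by move=> k x km; apply: dG; exact: ltnW.
have zh : z < z + h by rewrite ltrDl.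
have [||c] := @MVT R (derive1n m G) (derive1n m.+1 G) _ _ zh.
- by move=> x _; rewrite /= derive1E; apply: DeriveDef => //; exact: dG.
- by apply: derivable_within_continuous => x _; exact: dG.
rewrite in_itv/= => /andP[zc cz] ->.
exists c; first by rewrite -natr1; apply/andP; split; lra.
have -> : derive1 (derive1n m G) c =
    derive1 (derive1n m F) (c + h) - derive1 (derive1n m F) c.
  rewrite GE// derive1E deriveB; last 2 first.
  - by apply: derivable_shift; exact: dF.
  - exact: dF.
  by rewrite -!derive1E derive1_shift.
by rewrite exprSr; move: (derive1 _ (c + h)) (derive1 _ c) => a b; ring.
Qed.

(** A difference of higher order is an iterated difference of the differences of order m, and
each of the n further steps at most doubles the bound. *)
Lemma fdiff_order_le m n h F y (M : R) : 0 <= h ->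
  (forall z, y <= z <= y + n%:R * h -> `|fdiff m h F z| <= M) ->
  `|fdiff (n + m) h F y| <= 2 ^+ n * M.
Proof.
move=> h0; elim: n y => [|n IH] y H.
  by rewrite expr0 mul1r; apply: H; rewrite mul0r addr0 lexx.
rewrite addSn fdiffS; apply: le_trans (ler_normB _ _) _.
have H1 : `|fdiff (n + m) h F (y + h)| <= 2 ^+ n * M.
  apply: IH => z /andP[yz zy]; apply: H; rewrite -natr1; apply/andP; split; lra.
have H2 : `|fdiff (n + m) h F y| <= 2 ^+ n * M.
  apply: IH => z /andP[yz zy]; apply: H; rewrite -natr1; apply/andP; split; lra.
by rewrite exprS; lra.
Qed.

End FiniteDifferences.

(** * Differences of Sobolev functions *)

Section SobolevBounds.
Context {R : realType}.
Notation mu := (@lebesgue_measure R).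
Notation cmu := (@completed_lebesgue_measure R).
Local Open Scope ereal_scope.

Lemma ge0_borel_version (g : R -> R) : leb_fun g -> (forall x, 0 <= g x)%R ->
  exists v : R -> R, [/\ measurable_fun [set: R] v, (forall x, 0 <= v x)%R &
    {ae cmu, forall x, g x = v x}].
Proof.
move=> mg g0; have [v0 [N [mv0 mN N0 gv]]] := borel_version mg.
exists (fun x => Num.max (v0 x) 0)%R; split => //.
- exact: measurable_maxr.
- by move=> x; rewrite le_max lexx orbT.
- exists N; split => //; first exact: measurable_lebesgueR.
  by move=> x /=; apply: contra_notP => Nx; rewrite -gv// max_l.
Qed.

(** One Borel version of g serves all windows at once, as joint measurability in Tonelli's
theorem requires. *)
Lemma window_borel (g : R -> R) (L : R) : (0 <= L)%R ->
  leb_fun g -> (forall x, 0 <= g x)%R ->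
  exists v : R -> R, [/\ measurable_fun [set: R] v, (forall x, 0 <= v x)%R,
    forall i : interval R,
      \int[cmu]_(z in [set` i]) (g z)%:E = \int[mu]_(z in [set` i]) (v z)%:E &
    forall y, \int[cmu]_(z in `[y, (y + L)%R]) (g z)%:E =
      \int[mu]_(z in `[0%R, L]) (v (z + y)%R)%:E].
Proof.
move=> L0 mg g0.
have [v [mv v0 gv]] := ge0_borel_version mg g0.
have mEv : measurable_fun [set: R] (EFin \o v) by exact/measurable_EFinP.
have lv : leb_fun v by exact: measurable_fun_lebesgueR.
have gvI (i : interval R) : \int[cmu]_(z in [set` i]) (g z)%:E = \int[mu]_(z in [set` i]) (v z)%:E.
  rewrite -ge0_integral_completed//.
  apply: ge0_ae_eq_integral.
  - exact: measurable_lebesgueR_itv.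
  - exact: leb_fun_EFin.
  - exact: leb_fun_EFin.
  - by move=> x _; rewrite lee_fin.
  - by move=> x _; rewrite lee_fin.
  - apply: filterS gv; first exact: (ae_filter_ringOfSetsType cmu).
    by move=> x /= ->.
exists v; split => // y; rewrite gvI.
have := @ge0_integral_shift_itv R y 0 L true false v lv v0.
rewrite add0r [(L + y)%R]addrC !ge0_integral_completed//.
  by apply/measurable_EFinP; apply: (measurableT_comp mv); exact: measurable_funD.
by move=> x; rewrite lee_fin.
Qed.

Lemma integral_itv_cc_co (a b : R) (g : R -> R) : leb_fun g -> (forall z, 0 <= g z)%R ->
  \int[cmu]_(z in `[a, b]) (g z)%:E = \int[cmu]_(z in `[a, b[) (g z)%:E.
Proof.
move=> mg g0; have [v [mv v0 gvI _]] := window_borel (lexx 0%R) mg g0.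
rewrite !gvI -integral_itv_bndo_bndc//.
by apply: measurable_funTS; apply/measurable_EFinP.
Qed.

Lemma measurable_shift_pair (v : R -> R) : measurable_fun [set: R] v ->
  measurable_fun [set: (measurableTypeR R * measurableTypeR R)%type]
    (fun z => (v (z.2 + z.1)%R)%:E).
Proof.
move=> mv; apply/measurable_EFinP; apply: (measurableT_comp mv).
by apply: measurable_funD.
Qed.

Lemma measurable_window (g : R -> R) (L : R) : (0 <= L)%R ->
  leb_fun g -> (forall x, 0 <= g x)%R ->
  measurable_fun [set: R] (fun y => \int[cmu]_(z in `[y, (y + L)%R]) (g z)%:E).
Proof.
move=> L0 mg g0; have [v [mv v0 _ key]] := window_borel L0 mg g0.
rewrite (_ : (fun y => _) = (fun y => \int[mu]_(z in `[0%R, L]) (v (z + y)%R)%:E)); last first.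
  by apply/funext => y; exact: key.
have := @measurable_integral_on _ _ _ _ _ mu `[0%R, L] _ (measurable_itv _) (measurable_shift_pair mv).
by apply => z; rewrite lee_fin.
Qed.

(** By Tonelli's theorem: at a fixed distance t from the left end of the window, the integral of
g (y + t) over y in a period does not depend on t. *)
Lemma integral_window (g : R -> R) (L : R) : (0 <= L)%R ->
  leb_fun g -> (forall x, 0 <= g x)%R -> periodic g 1%R ->
  \int[cmu]_(y in `[0%R, 1%R[) \int[cmu]_(z in `[y, (y + L)%R]) (g z)%:E =
  L%:E * \int[cmu]_(y in `[0%R, 1%R[) (g y)%:E.
Proof.
move=> L0 mg g0 pg.
have [v [mv v0 gvI key]] := window_borel L0 mg g0.
have mEv : measurable_fun [set: R] (EFin \o v) by exact/measurable_EFinP.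
have lv : leb_fun v by exact: measurable_fun_lebesgueR.
have mW := measurable_window L0 mg g0.
rewrite ge0_integral_completed//; last by move=> x; apply: integral_ge0 => *; rewrite lee_fin.
transitivity (\int[mu]_(y in `[0%R, 1%R[) \int[mu]_(z in `[0%R, L]) (v (z + y)%R)%:E).
  by apply: eq_integral => y _; exact: key.
have /= -> := @tonelli_on _ _ _ _ R mu mu `[0%R, 1%R[ `[0%R, L] _
  (measurable_itv _) (measurable_itv _) (measurable_shift_pair mv); last by move=> z; rewrite lee_fin.
transitivity (\int[mu]_(t in `[0%R, L]) \int[cmu]_(y in `[0%R, 1%R[) (g y)%:E).
  apply: eq_integral => t _.
  transitivity (\int[cmu]_(y in `[0%R, 1%R[) (v (y + t)%R)%:E).
    rewrite ge0_integral_completed//.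
    - by apply: eq_integral => y _; rewrite addrC.
    - by apply/measurable_EFinP; apply: (measurableT_comp mv); exact: measurable_funD.
    - by move=> x; rewrite lee_fin.
  have := @ge0_integral_shift_itv R t 0 1 true true v lv v0.
  rewrite add0r => ->; rewrite ge0_integral_completed// -gvI addrC.
  exact: ge0_integral_period.
rewrite integral_cst; last exact: measurable_itv.
rewrite muleC; congr (_ * _).
by have := @completed_lebesgue_itv R 0 L true false L0; rewrite subr0.
Qed.

(** The mean value form leaves an increment of the absolutely continuous g^(s-1) over a step h
inside the window. *)
Lemma Wsp_fdiff_le (s : nat) (p h : R) (g : R -> R) (y : R) :
  (0 < s)%N -> (0 < h)%R -> Wsp s p g ->
  `|fdiff s h g y|%:E <=
  (h ^+ s.-1)%:E * \int[cmu]_(z in `[y, (y + s%:R * h)%R]) `|derive1n s g z|%:E.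
Proof.
case: s => // s _ h0 [pg dg acg [_ mgs _]].
have [k x ks|z /andP[yz zy] ->] := @fdiff_mean_value R s h g y h0.
  by apply: dg; rewrite ltnS.
rewrite normrM (ger0_norm (exprn_ge0 _ (ltW h0))) EFinM.
apply: lee_wpmul2l; first by rewrite lee_fin exprn_ge0// ltW.
have zh : (z <= z + h)%R by rewrite lerDl ltW.
have := @absolutely_continuous_le R z (z + h)%R (derive1n s g) zh (acg _ _) mgs.
move=> /le_trans; apply.
apply: ge0_subset_integral_itv.
- exact: measurableT_comp.
- by move=> x; exact: normr_ge0.
- by apply: subset_itv; rewrite bnd_simp// -natr1; lra.
Qed.

Lemma leb_fun_continuous (f : R -> R) : continuous f -> leb_fun f.
Proof. by move=> cf; apply: measurable_fun_lebesgueR; exact: continuous_measurable_fun. Qed.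

Lemma absolutely_continuous_continuous (F : R -> R) :
  (forall u v, absolutely_continuous_on u v F) -> continuous F.
Proof.
move=> acF x; apply/cvgrPdist_lt => e e0.
have [d d0 H] := absolutely_continuous_seq (acF (x - 1) (x + 1))%R e0.
have H' u v : (x - 1 <= u)%R -> (u <= v)%R -> (v <= x + 1)%R -> (v - u < d)%R ->
    (`|F v - F u| < e)%R.
  move=> xu uv vx vud; have := H [:: (u, v)]; rewrite !big_seq1/= /sub_itv/= xu uv vx.
  by apply.
near=> y.
have xyd : (`|x - y| < d)%R by near: y; apply: cvgr_dist_lt => //; exact: cvg_id.
have xy1 : (`|x - y| < 1)%R by near: y; apply: cvgr_dist_lt => //; exact: cvg_id.
move: xyd xy1; rewrite ltr_norml => /andP[y1 y2]; rewrite ltr_norml => /andP[y3 y4].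
have [xy|yx] := leP x y.
  by rewrite distrC; apply: H' => //; lra.
by apply: H' => //; lra.
Unshelve. all: by end_near. Qed.

Lemma Wsp_continuous (s : nat) (p : R) (g : R -> R) : (0 < s)%N -> Wsp s p g -> continuous g.
Proof.
case: s => [//|[|s]] _ [pg dg acg _]; first exact: absolutely_continuous_continuous.
move=> x; apply: differentiable_continuous; apply/derivable1_diffP.
exact: (dg 0%N).
Qed.

Lemma leb_fun_fdiff (s : nat) (h : R) (f : R -> R) : leb_fun f -> leb_fun (fdiff s h f).
Proof.
move=> mf; rewrite /fdiff; apply: measurable_sum => i.
by apply: measurable_funM; [exact: measurable_cst|exact: leb_fun_shift].
Qed.

Lemma periodic_fdiff (s : nat) (h : R) (f : R -> R) : periodic f 1%R -> periodic (fdiff s h f) 1%R.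
Proof.
by move=> pf x; rewrite /fdiff; apply: eq_bigr => i _; rewrite addrAC pf.
Qed.

Lemma Lp_fdiff (p : R) s (h : R) (f : R -> R) : (1 <= p)%R -> Lp p f -> Lp p (fdiff s h f).
Proof.
move=> p1 Lf; apply: (Lp_sum _ p1) => i.
exact: (LpZ _ p1 (Lp_shift _ Lf)).
Qed.

(** A first difference is a difference of two translates, which have the same norm. *)
Lemma normLp_fdiff_le (p : R) s (h : R) (f : R -> R) : (1 <= p)%R -> Lp p f ->
  normLp p (fdiff s h f) <= (2 ^+ s)%:E * normLp p f.
Proof.
move=> p1 Lf; elim: s => [|s IH].
  by rewrite expr0 mul1e (@eq_normLp _ _ _ f)// => x; exact: fdiff0.
have [_ lfd _] := Lp_fdiff s h p1 Lf; have [pf _ _] := Lf.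
rewrite (@eq_normLp _ _ _ ((fun x => fdiff s h f (x + h)) \+ (fun x => -1 * fdiff s h f x))%R); last first.
  by move=> x; rewrite fdiffS/= mulN1r.
apply: le_trans (normLpD p1 (leb_fun_shift h lfd) _) _.
  by apply: measurable_funM; [exact: measurable_cst|exact: lfd].
rewrite normLpZ// normrN1 mul1e (normLp_shift _ _ lfd); last exact: periodic_fdiff.
rewrite exprS mulr_natl mulr2n EFinD ge0_muleDl ?lee_fin ?exprn_ge0//.
exact: (leeD IH IH).
Qed.

(** Jensen's inequality on the window of length s h, followed by integration of the windows over
a period: the powers of the length add up to (s h)^(p - 1) (s h), whence the factor s. *)
Lemma normLp_fdiff_Wsp (s : nat) (p h : R) (g : R -> R) : (1 <= p)%R ->
  (0 < s)%N -> (0 < h)%R -> Wsp s p g ->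
  normLp p (fdiff s h g) <= (s%:R * h ^+ s)%:E * normLp p (derive1n s g).
Proof.
move=> p1 s0 h0 Wg; have p0 : (0 < p)%R by apply: lt_le_trans p1.
have [_ _ _ LpG] := Wg.
set G := derive1n s g in LpG *; have [pG mG nG] := LpG.
have sh : (0 < s%:R * h :> R)%R by rewrite mulr_gt0// ltr0n.
have cg := Wsp_continuous s0 Wg.
have mg := leb_fun_continuous cg.
pose N := fine (normLp p G).
have NE : normLp p G = N%:E by rewrite fineK// ge0_fin_numE ?normLp_ge0.
have N0 : (0 <= N)%R by rewrite fine_ge0// normLp_ge0.
rewrite NE -EFinM; apply: normLp_le => //.
  by rewrite mulr_ge0// mulr_ge0// exprn_ge0// ltW.
pose cc := ((h ^+ s.-1) `^ p * (s%:R * h) `^ (p - 1))%R.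
have cc0 : (0 <= cc)%R by rewrite mulr_ge0// powR_ge0.
pose W y := \int[cmu]_(z in `[y, (y + s%:R * h)%R]) (`|G z| `^ p)%:E.
have mW : measurable_fun [set: lebesgueR R] (W : lebesgueR R -> \bar R).
  apply: measurable_fun_lebesgueR; apply: measurable_window; first exact: ltW.
    exact: leb_fun_norm_powR.
  by move=> z; exact: powR_ge0.
have W0 y : 0 <= W y by apply: integral_ge0 => z _; rewrite lee_fin powR_ge0.
apply: (@le_trans _ _ (\int[cmu]_(y in `[0%R, 1%R[) (cc%:E * W y))).
  apply: ge0_le_integral.
  - exact: measurable_lebesgueR_itv.
  - by move=> y _; rewrite lee_fin powR_ge0.
  - by apply: leb_fun_EFin; exact: leb_fun_norm_powR (leb_fun_fdiff _ _ mg).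
  - by apply: measurable_funTS; exact: measurable_funeM.
  - move=> y _.
    have H := @Wsp_fdiff_le s p h g y s0 h0 Wg.
    rewrite -poweR_EFin; apply: (le_trans (gt0_ler_poweR (ltW p0) _ _ H)).
    + by rewrite in_itv/= leey andbT lee_fin.
    + by rewrite in_itv/= leey andbT mule_ge0 ?integral_ge0// lee_fin exprn_ge0// ltW.
    rewrite poweRM; first last.
    + exact: integral_ge0.
    + by rewrite lee_fin exprn_ge0// ltW.
    rewrite poweR_EFin /cc EFinM -muleA; apply: lee_wpmul2l.
      by rewrite lee_fin powR_ge0.
    apply: jensen_powR => //.
    + exact: measurable_lebesgueR_itv.
    + have := @completed_lebesgue_itv R y (y + s%:R * h)%R true false.
      by rewrite lerDl (ltW sh) addrAC subrr add0r; exact.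
rewrite (ge0_integralZl_itv _ mW W0 cc0).
rewrite (integral_window (ltW sh) (leb_fun_norm_powR p mG) _ (periodic_norm_powR p pG)); last first.
  by move=> z; exact: powR_ge0.
rewrite -normLp_pow// NE poweR_EFin -!EFinM lee_fin le_eqVlt; apply/orP; left; apply/eqP.
rewrite /cc mulrA.
have -> : ((h ^+ s.-1) `^ p * (s%:R * h) `^ (p - 1) * (s%:R * h) =
   (h ^+ s.-1) `^ p * (s%:R * h) `^ p)%R.
  rewrite -mulrA; congr (_ * _)%R.
  rewrite -{2}(powRr1 (ltW sh)) -powRD ?subrK//.
  by rewrite (gt_eqF sh) implybT.
rewrite -powRM ?exprn_ge0 ?(ltW h0) ?(ltW sh)// -powRM//; last first.
  by rewrite mulr_ge0 ?exprn_ge0 ?(ltW h0) ?(ltW sh).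
congr (_ `^ _)%R; rewrite -(prednK s0) exprS/= ; ring.
Qed.

End SobolevBounds.

(** * Disjoint windows around the nodes *)

Section Nodes.
Context {R : realType}.
Notation cmu := (@completed_lebesgue_measure R).
Implicit Types (p gamma : R) (x : nat -> nat -> R).
Local Open Scope ereal_scope.

(** The windows are disjoint since consecutive points are at least d apart. *)
Lemma sum_windows (g : R -> R) (y : nat -> R) (d : R) n : (0 <= d)%R ->
  leb_fun g -> (forall z, 0 <= g z)%R ->
  (forall k, (1 <= k <= n)%N -> d <= y k.+1 - y k)%R ->
  \sum_(1 <= k < n.+1) \int[cmu]_(z in `[y k, (y k + d)%R[) (g z)%:E <=
  \int[cmu]_(z in `[y 1%N, y n.+1[) (g z)%:E.
Proof.
move=> d0 mg g0; elim: n => [|n IH] yd.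
  by rewrite big_geq//; apply: integral_ge0 => z _; rewrite lee_fin.
have ymono m : (m <= n.+1)%N -> (y 1%N <= y m.+1)%R.
  elim: m => // m IHm mn; apply: (le_trans (IHm (ltnW mn))).
  by rewrite -subr_ge0 (le_trans d0)// yd.
rewrite big_nat_recr//= (@ge0_integral_itv_co_cat _ (y 1%N) (y n.+1) (y n.+2))//; last 2 first.
- exact: ymono.
- by rewrite -subr_ge0 (le_trans d0)// yd// ltnS leqnn.
apply: leeD; first by apply: IH => k /andP[k1 kn]; apply: yd; rewrite k1 leqW.
apply: ge0_subset_integral_itv => //.
apply: subset_itvl; rewrite bnd_simp addrC -lerBrDr.
by apply: yd; rewrite ltnS leqnn.
Qed.

(** By Jensen's inequality |w(x_k)|^p is at most B^p / d times the integral of |u|^p over the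
window of length d = gamma / n around x_k. Separation makes these windows disjoint modulo 1,
also across the end of the period, and n^-1 / d = gamma^-1. *)
Lemma normlp_le_window p gamma x n (w u : R -> R) (B : R) :
  (1 <= p)%R -> (0 < gamma)%R -> separated_nodes gamma x -> (0 < n)%N -> (0 <= B)%R ->
  Lp p u ->
  (forall y, `|w y|%:E <= (B / (gamma / n%:R))%:E *
     \int[cmu]_(z in `[(y - gamma / n%:R / 2)%R, (y + gamma / n%:R / 2)%R]) `|u z|%:E) ->
  (normlp p n (x n) w)%:E <= (B * gamma^-1 `^ p^-1)%:E * normLp p u.
Proof.
move=> p1 g0 sx n0 B0 Lu wu; have p0 : (0 < p)%R by apply: lt_le_trans p1.
have [pu mu nu] := Lu.
have [x10 xinc xn1 xS xsep] := sx n n0.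
set d := (gamma / n%:R)%R in wu xsep.
have n0R : (0 < n%:R :> R)%R by rewrite ltr0n.
have d0 : (0 < d)%R by rewrite divr_gt0.
pose N := fine (normLp p u).
have NE : normLp p u = N%:E by rewrite fineK// ge0_fin_numE ?normLp_ge0.
have N0 : (0 <= N)%R by rewrite fine_ge0// normLp_ge0.
have H y : ((`|w y| `^ p)%:E <= ((B `^ p) / d)%:E *
    \int[cmu]_(z in `[(y - d / 2)%R, (y - d / 2 + d)%R[) (`|u z| `^ p)%:E).
  have -> : (y - d / 2 + d = y + d / 2)%R by lra.
  rewrite -integral_itv_cc_co; [|exact: leb_fun_norm_powR|by move=> z; exact: powR_ge0].
  rewrite -poweR_EFin; apply: (le_trans (gt0_ler_poweR (ltW p0) _ _ (wu y))).
  - by rewrite in_itv/= leey andbT lee_fin.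
  - rewrite in_itv/= leey andbT mule_ge0//; first by rewrite lee_fin divr_ge0// ltW.
    by apply: integral_ge0 => z _; rewrite lee_fin.
  rewrite poweRM; [|by rewrite lee_fin divr_ge0// ltW|by apply: integral_ge0 => z _; rewrite lee_fin].
  have cI : cmu `[(y - d / 2)%R, (y + d / 2)%R] = d%:E.
    rewrite completed_lebesgue_itv; last lra.
    by congr EFin; lra.
  have J := @jensen_powR _ _ _ cmu _ u p d p1 d0 (measurable_lebesgueR_itv _) cI mu.
  rewrite poweR_EFin.
  apply: (@le_trans _ _ (((B / d) `^ p)%:E * ((d `^ (p - 1))%:E *
    \int[cmu]_(z in `[(y - d / 2)%R, (y + d / 2)%R]) (`|u z| `^ p)%:E))).
    by apply: lee_wpmul2l J; rewrite lee_fin powR_ge0.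
  rewrite muleA -EFinM; apply: lee_wpmul2r.
    by apply: integral_ge0 => z _; rewrite lee_fin powR_ge0.
  rewrite lee_fin powRM ?invr_ge0 ?(ltW d0)// -mulrA ler_wpM2l ?powR_ge0//.
  rewrite powRD; last by rewrite (gt_eqF d0) implybT.
  rewrite mulrA -powRM ?invr_ge0 ?(ltW d0)// mulVf ?(gt_eqF d0)// powR1 mul1r.
  by rewrite powR_inv1// ltW.
have S : (\sum_(1 <= k < n.+1) `|w (x n k)| `^ p <= (B `^ p) / d * N `^ p)%R.
  rewrite -lee_fin -sumEFin.
  apply: (@le_trans _ _ (\sum_(1 <= k < n.+1) (((B `^ p) / d)%:E *
     \int[cmu]_(z in `[(x n k - d / 2)%R, (x n k - d / 2 + d)%R[) (`|u z| `^ p)%:E))).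
    by apply: lee_sum => k _; exact: H.
  rewrite -ge0_sume_distrr; last by move=> k _; apply: integral_ge0 => z _; rewrite lee_fin powR_ge0.
  rewrite (EFinM (B `^ p / d)%R (N `^ p)%R); apply: lee_wpmul2l.
    by rewrite lee_fin divr_ge0 ?powR_ge0// ltW.
  apply: (le_trans (sum_windows (y := fun k => (x n k - d / 2)%R) (ltW d0)
     (leb_fun_norm_powR p mu) _ _)).
  - by move=> z; exact: powR_ge0.
  - by move=> k kn; have := xsep k kn; lra.
  rewrite /= xS -poweR_EFin -NE normLp_pow//.
  have -> : (1 + x n 1%N - d / 2 = (x n 1%N - d / 2) + 1)%R by lra.
  rewrite (ge0_integral_period (x n 1%N - d / 2)%R (leb_fun_norm_powR p mu) _
    (periodic_norm_powR p pu)); first exact: lexx.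
  by move=> z; exact: powR_ge0.
rewrite NE -EFinM lee_fin /normlp.
have -> : (B * gamma^-1 `^ p^-1 * N = (gamma^-1 * (B `^ p) * N `^ p) `^ p^-1)%R.
  have BN : ((B `^ p * N `^ p) `^ p^-1 = B * N)%R.
    by rewrite -powRM// -powRrM mulfV ?gt_eqF// powRr1// mulr_ge0.
  rewrite -[in RHS]mulrA [RHS]powRM ?BN; first by ring.
  - by rewrite invr_ge0 ltW.
  - by rewrite mulr_ge0 ?powR_ge0.
apply: ge0_ler_powR; first by rewrite invr_ge0 ltW.
- by rewrite nnegrE mulr_ge0 ?invr_ge0// sumr_ge0// => k _; exact: powR_ge0.
- by rewrite nnegrE mulr_ge0 ?mulr_ge0 ?invr_ge0 ?powR_ge0// ltW.
apply: (@le_trans _ _ (n%:R^-1 * (B `^ p / d * N `^ p))%R).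
  by rewrite ler_wpM2l// invr_ge0 ltW.
rewrite le_eqVlt; apply/orP; left; apply/eqP; rewrite /d; field.
by rewrite !gt_eqF.
Qed.

End Nodes.

(** * Size of Steklov averages *)

Section RintegralLincomb.
Context d (T : measurableType d) (R : realType).
Variable m : {measure set T -> \bar R}.

Lemma Rintegral_lincomb (D : set T) (n : nat) (a : nat -> R) (f : nat -> T -> R) :
  measurable D -> (forall i, (i < n)%N -> m.-integrable D (EFin \o f i)) ->
  m.-integrable D (EFin \o (fun t => \sum_(0 <= i < n) a i * f i t)) /\
  \int[m]_(t in D) (\sum_(0 <= i < n) a i * f i t) =
  \sum_(0 <= i < n) a i * \int[m]_(t in D) f i t.
Proof.
move=> mD; elim: n => [|n IH] intf.
  have -> : (fun t => \sum_(0 <= i < 0) a i * f i t) = cst 0.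
    by apply/funext => t; rewrite big_geq.
  by rewrite big_geq// Rintegral_cst// mul0r; split => //; exact: integrable0.
have [|intn IHn] := IH; first by move=> i ni; apply: intf; exact: ltnW.
have intfn : m.-integrable D (EFin \o (fun t => a n * f n t)).
  have := integrableZl mD (a n) (intf n (ltnSn n)).
  by apply: eq_integrable => // t _ /=; rewrite EFinM.
have -> : (fun t => \sum_(0 <= i < n.+1) a i * f i t) =
          (fun t => (\sum_(0 <= i < n) a i * f i t) + a n * f n t).
  by apply/funext => t; rewrite big_nat_recr.
split.
  have := integrableD mD intn intfn.
  by apply: eq_integrable => // t _ /=; rewrite EFinD.
rewrite RintegralD// IHn RintegralZl//; last exact: intf.
by rewrite [RHS]big_nat_recr.
Qed.

End RintegralLincomb.

Section Steklov.
Context {R : realType}.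
Notation cmu := (@completed_lebesgue_measure R).

Lemma ge0_integral_affine_abs (u : R -> R) (c y a b : R) : 0 < c -> leb_fun u ->
  (\int[cmu]_(t in `[a, b]) `|u (y + c * t)|%:E =
   c^-1%:E * \int[cmu]_(z in `[(c * a + y)%R, (c * b + y)%R]) `|u z|%:E)%E.
Proof.
move=> c0 mu.
have mau : leb_fun (fun z => `|u z|) by exact: measurableT_comp.
have au z : 0 <= `|u z| by exact: normr_ge0.
rewrite -(@ge0_integral_affine_itv R c y a b true false (fun z => `|u z|) c0 mau au).
by apply: eq_integral => t _; rewrite addrC.
Qed.

Lemma Lp_integrable_affine (p : R) (u : R -> R) (c y a b : R) :
  1 <= p -> 0 < c -> Lp p u ->
  cmu.-integrable `[a, b] (EFin \o (fun t => u (y + c * t))).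
Proof.
move=> p1 c0 Lu; have [_ mu _] := Lu; apply/integrableP; split.
  apply: leb_fun_EFin; have := measurable_fun_lebesgueR_affine y c0 mu.
  by under eq_fun do rewrite addrC.
rewrite (ge0_integral_affine_abs y a b c0 mu).
apply: lte_mul_pinfty => //; first by rewrite lee_fin invr_ge0 ltW.
exact: Lp_integral_norm_lty p1 Lu.
Qed.

Lemma steklov_ratio (r nu : nat) : (nu < r)%N ->
  0 < (r - nu)%:R / r%:R :> R /\ (r - nu)%:R / r%:R <= 1 :> R /\
  ((r - nu)%:R / r%:R)^-1 <= r%:R :> R.
Proof.
move=> nr; have r0 : 0 < r%:R :> R by rewrite ltr0n (leq_trans _ nr).
have rn : 1 <= (r - nu)%:R :> R by rewrite ler1n subn_gt0.
split; first by rewrite divr_gt0// (lt_le_trans _ rn).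
split; first by rewrite ler_pdivrMr// mul1r ler_nat leq_subr.
rewrite invf_div ler_pdivrMr; last by rewrite (lt_le_trans _ rn).
by rewrite -[leLHS]mulr1 ler_wpM2l// ltW.
Qed.

Lemma steklovE (p delta : R) (r : nat) (u : R -> R) (y : R) : 1 <= p -> Lp p u ->
  steklov delta r u y = (-1) ^+ r.+1 * ('C(2 * r, r)%:R)^-1 * (2 / delta) *
    \sum_(0 <= nu < r) ((-1) ^+ nu * 'C(2 * r, nu)%:R) *
      \int[cmu]_(t in `[- (delta / 2), delta / 2]) u (y + (r - nu)%:R / r%:R * t).
Proof.
move=> p1 Lu; rewrite /steklov; congr (_ * _).
apply: (Rintegral_lincomb _ (measurable_lebesgueR_itv _) _).2 => nu nr.
by have [c0 _] := @steklov_ratio r nu nr; exact: Lp_integrable_affine Lu.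
Qed.

Lemma steklovB (p delta : R) (r : nat) (u v : R -> R) (y : R) : 1 <= p ->
  Lp p u -> Lp p v ->
  steklov delta r (u \- v) y = steklov delta r u y - steklov delta r v y.
Proof.
move=> p1 Lu Lv; rewrite (steklovE _ _ _ p1 Lu) (steklovE _ _ _ p1 Lv)
  (steklovE _ _ _ p1 (LpB p1 Lu Lv)).
rewrite -mulrBr -sumrB; congr (_ * _); rewrite !big_nat; apply: eq_bigr => nu /andP[_ nr].
rewrite -mulrBr; congr (_ * _); have [c0 _] := @steklov_ratio r nu nr.
rewrite -RintegralB//.
- exact: measurable_lebesgueR_itv.
- exact: Lp_integrable_affine Lu.
- exact: Lp_integrable_affine Lv.
Qed.

(** The factor r bounds the Jacobians r / (r - nu) of the dilations in the Steklov average. *)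
Definition steklov_const (r : nat) : R :=
  2 * ('C(2 * r, r)%:R)^-1 * (r%:R * \sum_(0 <= nu < r) 'C(2 * r, nu)%:R).

Lemma steklov_const_ge0 r : 0 <= steklov_const r.
Proof.
by rewrite /steklov_const mulr_ge0// ?mulr_ge0// ?invr_ge0// sumr_ge0.
Qed.

(** The dilations have ratio at most 1, so they map the interval of integration into the
window. *)
Lemma steklov_le (p delta : R) (r : nat) (u : R -> R) (y : R) : 1 <= p -> 0 < delta ->
  Lp p u ->
  (`|steklov delta r u y|%:E <= (steklov_const r / delta)%:E *
   \int[cmu]_(z in `[(y - delta / 2)%R, (y + delta / 2)%R]) `|u z|%:E)%E.
Proof.
move=> p1 d0 Lu; have [_ mu _] := Lu.
set I := (\int[cmu]_(z in _) _)%E.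
have I0 : (0 <= I)%E by apply: integral_ge0 => z _; rewrite lee_fin.
have Ifin : I \is a fin_num by rewrite ge0_fin_numE//; exact: Lp_integral_norm_lty p1 Lu.
rewrite -(fineK Ifin) -EFinM lee_fin; set J := fine I.
have J0 : 0 <= J by exact: fine_ge0.
have K nu : (nu < r)%N ->
   `|\int[cmu]_(t in `[- (delta / 2), delta / 2]) u (y + (r - nu)%:R / r%:R * t)| <= r%:R * J.
  move=> nr; have [c0 [c1 cr]] := @steklov_ratio r nu nr.
  set c := _ / _ in c0 c1 cr *.
  have iu := @Lp_integrable_affine p u c y (- (delta / 2)) (delta / 2) p1 c0 Lu.
  apply: (le_trans (le_normr_Rintegral (measurable_lebesgueR_itv _) iu)).
  rewrite -lee_fin /Rintegral fineK; last first.
    rewrite ge0_fin_numE; last by apply: integral_ge0 => z _; rewrite lee_fin.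
    by have /integrableP[] := iu.
  rewrite (ge0_integral_affine_abs y _ _ c0 mu).
  apply: (@le_trans _ _ (c^-1%:E * I)%E).
    apply: lee_wpmul2l; first by rewrite lee_fin invr_ge0 ltW.
    apply: ge0_subset_integral_itv.
    - exact: measurableT_comp.
    - by move=> z; exact: normr_ge0.
    - have cd : c * (delta / 2) <= delta / 2.
        by rewrite -[leRHS]mul1r ler_wpM2r// divr_ge0// ltW.
      by apply: subset_itv; rewrite bnd_simp; lra.
  by rewrite -(fineK Ifin) -EFinM lee_fin ler_wpM2r.
rewrite (steklovE _ _ _ p1 Lu) normrM.
have C0 : 0 <= ('C(2 * r, r)%:R)^-1 :> R by rewrite invr_ge0.
have D0 : 0 <= 2 / delta by rewrite divr_ge0// ltW.
have -> : `|(-1) ^+ r.+1 / 'C(2 * r, r)%:R * (2 / delta)| = ('C(2 * r, r)%:R)^-1 * (2 / delta).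
  by rewrite normrM (ger0_norm D0) normrM normrX normrN1 expr1n mul1r (ger0_norm C0).
have -> : steklov_const r / delta * J = ('C(2 * r, r)%:R)^-1 * (2 / delta) *
   ((\sum_(0 <= nu < r) 'C(2 * r, nu)%:R) * (r%:R * J)).
  by rewrite /steklov_const; ring.
apply: ler_wpM2l; first by rewrite mulr_ge0.
apply: (le_trans (ler_norm_sum _ _ _)); rewrite big_distrl/= !big_nat.
apply: ler_sum => nu /andP[_ nr].
rewrite !normrM normrX normrN1 expr1n mul1r normr_nat.
by apply: ler_wpM2l => //; exact: K.
Qed.

End Steklov.

(** * Steklov averages of Sobolev functions *)

Section SteklovSmooth.
Context {R : realType}.
Notation mu := (@lebesgue_measure R).
Notation cmu := (@completed_lebesgue_measure R).

Lemma integral_completed (D : set R) (g : R -> \bar R) :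
  measurable D -> measurable_fun [set: R] g ->
  (\int[cmu]_(x in D) g x = \int[mu]_(x in D) g x)%E.
Proof.
move=> mD mg; rewrite integralE [RHS]integralE.
rewrite (ge0_integral_completed mD (measurable_funepos mg))//.
by rewrite (ge0_integral_completed mD (measurable_funeneg mg)).
Qed.

Lemma integral_reflect (f : R -> R) (d : R) : 0 <= d -> continuous f ->
  (\int[cmu]_(t in `[(- d)%R, d]) (f (- t))%:E = \int[cmu]_(t in `[(- d)%R, d]) (f t)%:E)%E.
Proof.
move=> d0 cf.
have mf : measurable_fun [set: R] f by exact: continuous_measurable_fun.
rewrite integral_completed; last 2 first.
- exact: measurable_itv.
- by apply/measurable_EFinP; exact: (measurableT_comp mf).
rewrite integral_completed; last 2 first.
- exact: measurable_itv.
- exact/measurable_EFinP.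
have := @integration_by_substitution_oppr R f (- d) d.
rewrite opprK => -> //; first by lra.
exact: continuous_subspaceT.
Qed.

(** The centred difference of order 2r is made of differences of order s with step |t| / r, all
supported in [y - |t|, y + |t|]. Symmetry in t reduces to t >= 0. *)
Lemma fdiff_centered_le (p delta : R) (r s : nat) (g : R -> R) (y t : R) :
  (0 < r)%N -> (0 < s)%N -> (s <= 2 * r)%N -> 1 <= p -> Wsp s p g ->
  - (delta / 2) <= t -> t <= delta / 2 ->
  `|fdiff (2 * r) (t / r%:R) g (y - t)| <= 2 ^+ (2 * r - s) * (delta ^+ s.-1 *
    \int[cmu]_(z in `[y - delta / 2, y + delta / 2]) `|derive1n s g z|).
Proof.
move=> r0 s0 s2r p1 Wg.
have [_ _ _ LG] := Wg; have [_ mG _] := LG.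
set G := derive1n s g in LG mG *.
have Ifin : (\int[cmu]_(z in `[(y - delta / 2)%R, (y + delta / 2)%R]) `|G z|%:E)%E \is a fin_num.
  rewrite ge0_fin_numE; first exact: Lp_integral_norm_lty p1 LG.
  by apply: integral_ge0 => z _; rewrite lee_fin.
have rR : 0 < r%:R :> R by rewrite ltr0n.
wlog t0 : t / 0 <= t => [wlg td1 td2|].
  have [t0|t0] := leP 0 t; first exact: wlg.
  rewrite -fdiff_centeredN// -[y + t]/(y + t) -{2}(opprK t).
  by apply: wlg; lra.
move=> td1 td2.
have dl0 : 0 <= delta by lra.
have I0 : 0 <= \int[cmu]_(z in `[y - delta / 2, y + delta / 2]) `|G z|.
  by apply: Rintegral_ge0.
move: t0; rewrite le_eqVlt => /predU1P[<-|t0].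
  by rewrite mul0r fdiff_zero_step ?normr0 ?mulr_ge0 ?exprn_ge0// muln_gt0.
have h0 : 0 < t / r%:R by rewrite divr_gt0.
have hr : r%:R * (t / r%:R) = t by rewrite mulrC divfK// gt_eqF.
rewrite -{1}(subnK s2r); apply: fdiff_order_le; first exact: ltW.
move=> z /andP[yz zy].
have := @Wsp_fdiff_le R s p (t / r%:R) g z s0 h0 Wg.
rewrite -lee_fin => /le_trans; apply.
rewrite /Rintegral EFinM fineK//; apply: lee_pmul.
- by rewrite lee_fin exprn_ge0// ltW.
- by apply: integral_ge0 => w _; rewrite lee_fin.
- rewrite lee_fin lerXn2r ?nnegrE// ?(ltW h0)//.
  rewrite ler_pdivrMr//; have : 1 <= r%:R :> R by rewrite ler1n.
  by move=> r1; rewrite (@le_trans _ _ (delta * 1))//; [lra|rewrite ler_wpM2l].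
apply: ge0_subset_integral_itv.
- exact: measurableT_comp.
- by move=> w; exact: normr_ge0.
- have E : (2 * r - s)%:R + s%:R = 2 * r%:R :> R by rewrite -natrD subnK// natrM.
  have E2 : (2 * r - s)%:R * (t / r%:R) + s%:R * (t / r%:R) = 2 * t.
    by rewrite -mulrDl E -mulrA hr.
  by apply: subset_itv; rewrite bnd_simp; lra.
Qed.

(** Reflection t |-> -t equates the integrals of the two half-sums of the centred difference, so
its mean over |t| <= delta / 2 is, up to sign and the central binomial coefficient, the
difference between the Steklov average and g. *)
Lemma steklov_sub_le (p delta : R) (r s : nat) (g : R -> R) (y : R) :
  (0 < r)%N -> (0 < s)%N -> (s <= 2 * r)%N -> 1 <= p -> 0 < delta ->
  Lp p g -> Wsp s p g ->
  (`|steklov delta r g y - g y|%:E <=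
   (('C(2 * r, r)%:R)^-1 * 2 ^+ (2 * r - s) * delta ^+ s / delta)%:E *
   \int[cmu]_(z in `[(y - delta / 2)%R, (y + delta / 2)%R]) `|derive1n s g z|%:E)%E.
Proof.
move=> r0 s0 s2r p1 dl0 Lg Wg.
have [_ _ _ LG] := Wg; have [_ mG _] := LG.
have cg := Wsp_continuous s0 Wg.
pose G := derive1n s g; rewrite -/G in LG mG *.
have Ifin : (\int[cmu]_(z in `[(y - delta / 2)%R, (y + delta / 2)%R]) `|G z|%:E)%E \is a fin_num.
  rewrite ge0_fin_numE; first exact: Lp_integral_norm_lty p1 LG.
  by apply: integral_ge0 => z _; rewrite lee_fin.
pose I := \int[cmu]_(z in `[y - delta / 2, y + delta / 2]) `|G z|.
rewrite -(fineK Ifin) -EFinM lee_fin -[fine _]/I.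
set d := delta / 2; have d0 : 0 < d by rewrite divr_gt0.
have mD := @measurable_lebesgueR_itv R `[- d, d]%R.
have muI : cmu `[- d, d] = delta%:E.
  by rewrite completed_lebesgue_itv; [congr EFin; rewrite /d|]; lra.
have cstI (k : R) : \int[cmu]_(t in `[- d, d]) k = k * delta.
  by rewrite (Rintegral_cst cmu mD k) [X in fine X]muI.
have icst (k : R) : cmu.-integrable `[- d, d] (EFin \o (fun=> k)).
  apply/integrableP; split; first exact: measurable_cst.
  by rewrite (integral_cst cmu mD `|k|%:E) [X in (_ * X)%E]muI -EFinM ltry.
pose a nu : R := (-1) ^+ nu * 'C(2 * r, nu)%:R.
pose f nu t := g (y + (r - nu)%:R / r%:R * t).
have intf nu : (nu < r)%N -> cmu.-integrable `[- d, d] (EFin \o f nu).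
  by move=> nr; have [c0 _] := @steklov_ratio R r nu nr; exact: Lp_integrable_affine p1 c0 Lg.
have cf nu : continuous (f nu).
  have ca : continuous (fun t : R => y + (r - nu)%:R / r%:R * t).
    by move=> t; apply: continuousD; [exact: cst_continuous|exact: mulrl_continuous].
  by move=> t; exact: (@continuous_comp _ _ _ _ g t (ca t) (cg _)).
have cfN nu : continuous (fun t => f nu (- t)).
  have ca : continuous (fun t : R => y + (r - nu)%:R / r%:R * - t).
    move=> t; apply: cvgD; first exact: cvg_cst.
    by apply: cvgM; [exact: cvg_cst|apply: cvgN; exact: cvg_id].
  by move=> t; exact: (@continuous_comp _ _ _ _ g t (ca t) (cg _)).
have intfN nu : (nu < r)%N -> cmu.-integrable `[- d, d] (EFin \o (fun t => f nu (- t))).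
  move=> nr; apply/integrableP; split.
    apply: leb_fun_EFin; apply: leb_fun_continuous => t.
    exact: cfN.
  have cfa : continuous (fun t => `|f nu t|).
    by move=> t; exact: (@continuous_comp _ _ _ (f nu) Num.norm t (cf nu t) (@norm_continuous _ _ _)).
  have /integrableP[_ fin] := intf nu nr.
  by apply: le_lt_trans fin; rewrite le_eqVlt; apply/orP; left; apply/eqP; exact: (integral_reflect (ltW d0) cfa).
have [iA EA] := @Rintegral_lincomb _ _ R cmu _ r a f mD intf.
have [iB EB] := @Rintegral_lincomb _ _ R cmu _ r a (fun nu t => f nu (- t)) mD intfN.
have EAB : \int[cmu]_(t in `[- d, d]) (\sum_(0 <= i < r) a i * f i (- t)) =
    \int[cmu]_(t in `[- d, d]) (\sum_(0 <= i < r) a i * f i t).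
  rewrite EA EB !big_nat; apply: eq_bigr => nu /andP[_ nr].
  by rewrite /Rintegral (integral_reflect (ltW d0) (cf nu)).
pose c0 := (-1) ^+ r * 'C(2 * r, r)%:R * g y.
have iC := icst c0.
pose Q t := fdiff (2 * r) (t / r%:R) g (y - t).
have QE t : Q t = (\sum_(0 <= i < r) a i * f i t + \sum_(0 <= i < r) a i * f i (- t)) + c0.
  exact: fdiff_centered.
have iAB : cmu.-integrable `[- d, d]
    (EFin \o (fun t => \sum_(0 <= i < r) a i * f i t + \sum_(0 <= i < r) a i * f i (- t))).
  by have := integrableD mD iA iB; apply: eq_integrable => // t _ /=; rewrite EFinD.
have iQ : cmu.-integrable `[- d, d] (EFin \o Q).
  by have := integrableD mD iAB iC; apply: eq_integrable => // t _ /=; rewrite QE EFinD.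
have IQ : \int[cmu]_(t in `[- d, d]) Q t =
    2 * \int[cmu]_(t in `[- d, d]) (\sum_(0 <= i < r) a i * f i t) + c0 * delta.
  transitivity (\int[cmu]_(t in `[- d, d])
    ((\sum_(0 <= i < r) a i * f i t + \sum_(0 <= i < r) a i * f i (- t)) + c0)).
    by apply: eq_Rintegral => t _; exact: QE.
  rewrite (RintegralD mD iAB iC) (RintegralD mD iA iB) EAB.
  by rewrite cstI mulr_natl mulr2n.
have C0 : 0 < 'C(2 * r, r)%:R :> R by rewrite ltr0n bin_gt0 leq_pmull.
have SE : steklov delta r g y - g y =
    (-1) ^+ r.+1 * ('C(2 * r, r)%:R)^-1 * delta^-1 * \int[cmu]_(t in `[- d, d]) Q t.
  have -> : steklov delta r g y = (-1) ^+ r.+1 * ('C(2 * r, r)%:R)^-1 * (2 / delta) *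
     \int[cmu]_(t in `[- d, d]) (\sum_(0 <= i < r) a i * f i t) by [].
  rewrite IQ /c0.
  have s1 : (-1) ^+ r * (-1) ^+ r = 1 :> R by rewrite -expr2 sqrr_sign.
  set S := \int[cmu]_(t in _) _; rewrite exprS.
  move: ((-1) ^+ r) s1 S => e e1 S.
  apply/eqP; rewrite -subr_eq0; apply/eqP.
  transitivity ((e * e - 1) * g y); last by rewrite e1 subrr mul0r.
  by field; rewrite !gt_eqF.
have M0 : 0 <= 2 ^+ (2 * r - s) * (delta ^+ s.-1 * I).
  by rewrite !mulr_ge0 ?exprn_ge0 ?(ltW dl0)//; exact: Rintegral_ge0.
have QM : \int[cmu]_(t in `[- d, d]) `|Q t| <= 2 ^+ (2 * r - s) * (delta ^+ s.-1 * I) * delta.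
  have -> : 2 ^+ (2 * r - s) * (delta ^+ s.-1 * I) * delta =
     \int[cmu]_(t in `[- d, d]) (2 ^+ (2 * r - s) * (delta ^+ s.-1 * I)).
    by rewrite cstI.
  apply: (le_Rintegral mD).
  - exact: integrable_norm iQ.
  - exact: icst.
  - move=> t; rewrite /= in_itv/= => /andP[t1 t2].
    have H := @fdiff_centered_le p delta r s g y t r0 s0 s2r p1 Wg t1 t2.
    exact: H.
rewrite SE normrM normrM normrM normrX normrN1 expr1n mul1r.
rewrite (ger0_norm (x := ('C(2 * r, r)%:R)^-1)) ?invr_ge0//.
rewrite (ger0_norm (x := delta^-1)) ?invr_ge0 ?(ltW dl0)//.
have := le_trans (le_normr_Rintegral mD iQ) QM => H.
apply: (@le_trans _ _ (('C(2 * r, r)%:R)^-1 / delta *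
   (2 ^+ (2 * r - s) * (delta ^+ s.-1 * I) * delta))).
  by apply: ler_wpM2l H; rewrite divr_ge0 ?invr_ge0// ltW.
rewrite le_eqVlt; apply/orP; left; apply/eqP.
have -> : delta ^+ s = delta * delta ^+ s.-1 by rewrite -exprS prednK.
move: (delta ^+ s.-1) (2 ^+ (2 * r - s)) => A B; field.
by rewrite !gt_eqF.
Qed.

End SteklovSmooth.

(** * Norms of averages *)

Section BorelLp.
Context {R : realType}.
Notation mu := (@lebesgue_measure R).
Notation cmu := (@completed_lebesgue_measure R).

(** Borel measurability makes v (x + tau t) jointly measurable in x and t. *)
Definition borelLp (p : R) (v : R -> R) := measurable_fun [set: R] v /\ Lp p v.

(** The exceptional null set is first enlarged to the union M of its integer translates: setting
the version to 0 on M then keeps it periodic. *)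
Lemma Lp_borel_version (p : R) (f : R -> R) : 1 <= p -> Lp p f ->
  exists2 u, borelLp p u & {ae cmu, forall x, f x = u x}.
Proof.
move=> p1 [pf mf nf]; have [v [N [mv mN N0 fv]]] := borel_version mf.
pose sh (k : int) (x : R) : R := 1 * x + k%:~R.
pose z (n : nat) : int := if odd n then - (n./2)%:Z else (n./2)%:Z.
pose M : set R := \bigcup_n (sh (z n) @^-1` N).
have zE (k : int) : exists n, z n = k.
  case: k => k; first by exists k.*2; rewrite /z odd_double doubleK.
  exists (k.+1).*2.+1; rewrite /z /= odd_double/= NegzE; congr (- Posz _).
  by rewrite uphalf_double.
have mshN n : measurable (sh (z n) @^-1` N).
  by rewrite -[X in measurable X]setTI; exact: (measurable_affine 1 (z n)%:~R).
have mM : measurable M by apply: bigcupT_measurable.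
have M0 : mu M = 0%E.
  apply: measure_negligible => //; apply: negligible_bigcup => n.
  exists (sh (z n) @^-1` N); split; [exact: mshN| |by []].
  by have := lebesgue_measure_affine (z n)%:~R ltr01 mN; rewrite N0 mule0 => H; exact: H.
have NM : N `<=` M.
  move=> x Nx; have [n zn] := zE 0; exists n => //.
  by rewrite /= /sh zn mul1r addr0.
have pM x : M (x + 1) <-> M x.
  split=> -[n _]; rewrite /= /sh mul1r => H.
    have [m zm] := zE (1 + z n); exists m => //.
    by rewrite /= /sh zm mul1r intrD addrA.
  have [m zm] := zE (z n - 1); exists m => //.
  by rewrite /= /sh zm mul1r intrB addrACA subrr addr0.
pose u := v \_ (~` M).
have fu x : ~ M x -> f x = u x.
  move=> Mx; rewrite /u patchE mem_set// fv// => Nx; exact/Mx/NM.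
have mu_ : measurable_fun [set: R] u.
  by apply/(measurable_restrictT _ _).1; [exact: measurableC|exact: measurable_funTS].
have ae_fu : {ae cmu, forall x, f x = u x}.
  exists M; split => //; first exact: measurable_lebesgueR.
  by move=> x /=; apply: contra_notP => Mx; exact: fu.
have lu : leb_fun u by exact: measurable_fun_lebesgueR.
exists u; last exact: ae_fu.
split; [exact: mu_|split; [|exact: lu|]].
- move=> x; have [Mx|Mx] := pselect (M x).
    have Mx1 : M (x + 1) by apply/pM.
    by rewrite /u !patchE !memNset//; apply.
  have Mx1 : ~ M (x + 1) by move/pM.
  by rewrite -(fu _ Mx) -(fu _ Mx1) pf.
- by rewrite -(ae_eq_normLp p mf lu ae_fu).
Qed.

Lemma integrable_completed (D : set R) (g : R -> R) :
  measurable D -> measurable_fun [set: R] g ->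
  cmu.-integrable D (EFin \o g) -> mu.-integrable D (EFin \o g).
Proof.
move=> mD mg /integrableP[_ fin]; apply/integrableP; split.
  by apply: measurable_funTS; exact/measurable_EFinP.
rewrite -ge0_integral_completed//.
by apply/measurable_EFinP; exact: measurableT_comp.
Qed.

Lemma borelLp_integrable p v a b : 1 <= p -> borelLp p v ->
  mu.-integrable `[a, b] (EFin \o v).
Proof.
move=> p1 [mv Lv]; apply: integrable_completed => //; exact: Lp_integrable Lv.
Qed.

Lemma borelLp_integrable_affine p v c y a b : 1 <= p -> 0 <= c -> borelLp p v ->
  mu.-integrable `[a, b] (EFin \o (fun t => v (y + c * t))).
Proof.
move=> p1; rewrite le_eqVlt => /predU1P[<-|c0] [mv Lv].
  have -> : EFin \o (fun t => v (y + 0 * t)) = cst (v y)%:E.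
    by apply/funext => t /=; rewrite mul0r addr0.
  have muf : (mu `[a, b]%classic < +oo)%E.
    by rewrite lebesgue_measure_itv/=; case: ifP => _; rewrite -?EFinB ltry.
  apply/integrableP; split; first exact: measurable_cst.
  rewrite (integral_cst mu (measurable_itv _) `|v y|%:E).
  by apply: lte_mul_pinfty; [rewrite lee_fin| |exact: muf].
apply: integrable_completed => //; last exact: Lp_integrable_affine Lv.
by apply: (measurableT_comp mv); apply: measurable_funD => //; exact: measurable_funM.
Qed.

Lemma measurable_Rintegral (B : set R) (h : R * R -> R) : measurable B ->
  measurable_fun [set: measurableTypeR R * measurableTypeR R] h ->
  measurable_fun [set: R] (fun x => \int[mu]_(t in B) h (x, t)).
Proof.
move=> mB mh.
have mhE : measurable_fun [set: measurableTypeR R * measurableTypeR R] (EFin \o h).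
  exact/measurable_EFinP.
have mp := @measurable_integral_on _ _ _ _ _ mu B _ mB (measurable_funepos mhE)
  (funepos_ge0 (EFin \o h)).
have mn := @measurable_integral_on _ _ _ _ _ mu B _ mB (measurable_funeneg mhE)
  (funeneg_ge0 (EFin \o h)).
have mi : measurable_fun [set: measurableTypeR R] (fun x => \int[mu]_(t in B) (h (x, t))%:E)%E.
  have := emeasurable_funB mp mn.
  congr measurable_fun; apply/funext => x /=; rewrite [RHS]integralE.
  by congr (_ - _)%E; apply: eq_integral => y _; rewrite ?funeposE ?funenegE.
exact: (measurableT_comp (fine_measurable measurableT) mi).
Qed.

(** Minkowski's integral inequality on a probability space: Jensen's inequality in t, then
Tonelli's theorem. *)
Lemma normLp_average (p W : R) (h : R -> R -> R) : 1 <= p -> 0 <= W ->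
  measurable_fun [set: measurableTypeR R * measurableTypeR R] (fun z => h z.1 z.2) ->
  (forall t, 0 <= t <= 1 -> (normLp p (h ^~ t) <= W%:E)%E) ->
  (normLp p (fun x => (\int[mu]_(t in `[0, 1]) h x t)%R) <= W%:E)%E.
Proof.
move=> p1 W0 mh hW; have p0 : 0 < p by apply: lt_le_trans p1.
have mhx x : measurable_fun [set: R] (h x).
  exact: (measurableT_comp mh (@pair1_measurable _ _ (measurableTypeR R) (measurableTypeR R) x)).
have mht t : measurable_fun [set: R] (h ^~ t).
  exact: (measurableT_comp mh (@pair2_measurable _ _ (measurableTypeR R) (measurableTypeR R) t)).
pose H (z : R * R) := ((`|h z.1 z.2| `^ p)%:E).
have mH : measurable_fun [set: measurableTypeR R * measurableTypeR R] H.
  exact: measurable_norm_powR.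
have H0 z : (0 <= H z)%E by rewrite lee_fin powR_ge0.
have m01 : mu `[0%R, 1%R]%classic = 1%:E.
  by rewrite lebesgue_measure_itv/= lte_fin ltr01 oppr0 adde0.
apply: normLp_le => //.
have mA := @measurable_Rintegral `[0, 1] _ (measurable_itv _) mh.
rewrite ge0_integral_completed; last 3 first.
- exact: measurable_itv.
- exact: measurable_norm_powR.
- by move=> x; rewrite lee_fin powR_ge0.
apply: (@le_trans _ _ (\int[mu]_(x in `[0%R, 1%R[) \int[mu]_(t in `[0%R, 1%R]) H (x, t))%E).
  apply: ge0_le_integral.
  - exact: measurable_itv.
  - by move=> x _; rewrite lee_fin powR_ge0.
  - by apply: measurable_funTS; exact: measurable_norm_powR.
  - apply: measurable_funTS.
    exact: (@measurable_integral_on _ _ _ _ _ mu `[0%R, 1%R] _ (measurable_itv _) mH).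
  - move=> x _; have J := @jensen_powR _ _ _ mu `[0%R, 1%R] (h x) p 1 p1 ltr01
      (measurable_itv _) m01 (mhx x).
    rewrite powR1 mul1e in J; apply: le_trans J.
    rewrite -poweR_EFin; apply: gt0_ler_poweR; first exact: ltW.
    + by rewrite in_itv/= leey andbT lee_fin.
    + by rewrite in_itv/= leey andbT; apply: integral_ge0 => t _; rewrite lee_fin.
    have mhx1 : measurable_fun (`[0%R, 1%R] : set (measurableTypeR R)) (EFin \o h x).
      by apply/measurable_EFinP; apply: measurable_funTS; exact: (mhx x).
    have := @le_abse_integral _ _ R mu _ _ (measurable_itv `[(0:R), 1]%R) mhx1.
    apply: le_trans; rewrite /Rintegral.
    by case: (\int[mu]_(t in _) _)%E => [z| |] //=; rewrite normr0 leey.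
rewrite (@tonelli_on _ _ _ _ R mu mu `[0%R, 1%R[ `[0%R, 1%R] _ (measurable_itv _) (measurable_itv _) mH H0).
apply: (@le_trans _ _ (\int[mu]_(t in `[0%R, 1%R]) (W `^ p)%:E)%E); last first.
  by rewrite (integral_cst mu (measurable_itv _) (W `^ p)%:E) [X in (_ * X)%E]m01 mule1.
apply: ge0_le_integral.
- exact: measurable_itv.
- by move=> t _; apply: integral_ge0.
- apply: measurable_funTS.
  have msw : measurable_fun [set: measurableTypeR R * measurableTypeR R] (H \o (fun z => (z.2, z.1))).
    by apply: (measurableT_comp mH); exact: measurable_fun_pair.
  by apply: (@measurable_integral_on _ _ _ _ _ mu `[0%R, 1%R[ _ (measurable_itv _) msw) => z; exact: H0.
- exact: measurable_cst.
- move=> t; rewrite /= in_itv/= => t01.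
  have := hW t t01 => /(gt0_ler_poweR (ltW p0) _ _).
  rewrite !in_itv/= !leey normLp_ge0 lee_fin W0 => /(_ isT isT).
  rewrite normLp_pow//; apply: le_trans.
  have P0 z : (0 <= (`|h z t| `^ p)%:E)%E by rewrite lee_fin powR_ge0.
  by rewrite (ge0_integral_completed (measurable_itv _) (measurable_norm_powR p (mht t)) P0).
Qed.

End BorelLp.

(** * Averages along a segment *)

Section Averages.
Context {R : realType}.
Notation mu := (@lebesgue_measure R).
Notation cmu := (@completed_lebesgue_measure R).
Implicit Types (u v w : R -> R) (p tau h a x : R).

Definition avg tau v x : R := \int[mu]_(t in `[0, 1]) v (x + tau * t).

Definition diff_quot tau v x : R := tau^-1 * (v (x + tau) - v x).

Lemma borelLp_shift p v a : borelLp p v -> borelLp p (fun x => v (x + a)).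
Proof.
move=> [mv Lv]; split; last exact: Lp_shift.
by apply: (measurableT_comp mv); exact: measurable_funD.
Qed.

Lemma borelLp_diff_quot p tau v : 1 <= p -> borelLp p v -> borelLp p (diff_quot tau v).
Proof.
move=> p1 bv; have [mv Lv] := bv; have [mvt Lvt] := borelLp_shift tau bv.
split; last exact: (LpZ _ p1 (LpB p1 Lvt Lv)).
by apply: measurable_funM; [exact: measurable_cst|exact: measurable_funB].
Qed.

Lemma borelLp_iter_diff_quot p tau k v : 1 <= p -> borelLp p v -> borelLp p (iter k (diff_quot tau) v).
Proof. by move=> p1 bv; elim: k => [|k IH]; [exact: bv|exact: borelLp_diff_quot p1 IH]. Qed.

Lemma measurable_pair_affine (v : R -> R) (b c : R) (e : R) : measurable_fun [set: R] v ->
  measurable_fun [set: measurableTypeR R * measurableTypeR R]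
    (fun z => v (e * z.1 + (b + c * z.2))).
Proof.
move=> mv; apply: (measurableT_comp mv); apply: measurable_funD.
  by apply: measurable_funM; [exact: measurable_cst|exact: measurable_fst].
apply: measurable_funD; first exact: measurable_cst.
by apply: measurable_funM; [exact: measurable_cst|exact: measurable_snd].
Qed.

Lemma borelLp_avg p tau v : 1 <= p -> borelLp p v -> borelLp p (avg tau v).
Proof.
move=> p1 [mv Lv]; have [pv lv nv] := Lv.
have mh : measurable_fun [set: measurableTypeR R * measurableTypeR R]
    (fun z => v (z.1 + tau * z.2)).
  have := @measurable_pair_affine v 0 tau 1 mv.
  by under eq_fun do rewrite mul1r add0r.
have ma : measurable_fun [set: R] (avg tau v).
  exact: (@measurable_Rintegral R `[0, 1] _ (measurable_itv _) mh).
split; first exact: ma.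
split.
- move=> x; rewrite /avg; apply: eq_Rintegral => t _.
  by rewrite addrAC pv.
- exact: measurable_fun_lebesgueR.
- have NE : normLp p v = (fine (normLp p v))%:E.
    by rewrite fineK// ge0_fin_numE// normLp_ge0.
  have := @normLp_average R p (fine (normLp p v)) (fun x t => v (x + tau * t)) p1 _ mh.
  move=> /(_ (fine_ge0 (normLp_ge0 p v))) H.
  apply: (le_lt_trans (H _)); last by rewrite ltry.
  by move=> t _; rewrite (normLp_shift p (tau * t) lv pv) -NE.
Qed.

Lemma borelLp_iter_avg p tau k v : 1 <= p -> borelLp p v -> borelLp p (iter k (avg tau) v).
Proof. by move=> p1 bv; elim: k => [|k IH]; [exact: bv|exact: borelLp_avg p1 IH]. Qed.

Lemma mu_itv01 : mu (`[0, 1]%classic : set R) = 1%E.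
Proof. by rewrite lebesgue_measure_itv/= lte_fin ltr01 oppr0 adde0. Qed.

Lemma avg_zero_step v : avg 0 v = v.
Proof.
apply/funext => x; rewrite /avg.
transitivity (\int[mu]_(t in `[0, 1]) v x).
  by apply: eq_Rintegral => t _; rewrite mul0r addr0.
rewrite (Rintegral_cst mu (measurable_itv _) (v x)).
by rewrite [X in fine X]mu_itv01 mulr1.
Qed.

Lemma iter_avg_zero_step j v : iter j (avg 0) v = v.
Proof. by elim: j => //= j ->; exact: avg_zero_step. Qed.

Lemma avg_diff_quot p tau v : 1 <= p -> 0 <= tau -> borelLp p v ->
  diff_quot tau (avg tau v) = avg tau (diff_quot tau v).
Proof.
move=> p1 t0 bv; apply/funext => x; rewrite /diff_quot /avg.
have i1 := @borelLp_integrable_affine R p v tau (x + tau) 0 1 p1 t0 bv.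
have i2 := @borelLp_integrable_affine R p v tau x 0 1 p1 t0 bv.
have m01 : measurable (`[0, 1]%classic : set (measurableTypeR R)) by exact: measurable_itv.
rewrite -(RintegralB m01 i1 i2) -(RintegralZl _ m01); last first.
  by have := integrableB m01 i1 i2; apply: eq_integrable => // t _ /=; rewrite EFinB.
by apply: eq_Rintegral => t _; rewrite addrAC.
Qed.

Lemma iter_avg_diff_quot p tau j v : 1 <= p -> 0 <= tau -> borelLp p v ->
  diff_quot tau (iter j (avg tau) v) = iter j (avg tau) (diff_quot tau v).
Proof.
move=> p1 t0 bv; elim: j => [//|j IH] /=.
by rewrite (avg_diff_quot p1 t0 (borelLp_iter_avg tau j p1 bv)) IH.
Qed.

(** Difference quotients of the same step compose to the difference of order k. *)
Lemma iter_diff_quot_fdiff tau k v x : iter k (diff_quot tau) v x = tau^-1 ^+ k * fdiff k tau v x.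
Proof.
elim: k x => [|k IH] x; first by rewrite fdiff0 expr0 mul1r.
by rewrite /= /diff_quot !IH fdiffS exprS; ring.
Qed.

Definition fdiff_coef (s nu : nat) : R := 'C(s, nu)%:R * (-1) ^+ (s - nu).

(** The mean, over t in [0, 1]^j, of the difference of u of order s with step
a + h (t_1 + ... + t_j). *)
Definition avg_fdiff (s : nat) (h : R) (u : R -> R) (j : nat) (a x : R) : R :=
  \sum_(0 <= nu < s.+1) fdiff_coef s nu * iter j (avg (nu%:R * h)) u (x + nu%:R * a).

Lemma avg_fdiff0 s h u b x : avg_fdiff s h u 0 b x = fdiff s b u x.
Proof.
rewrite /avg_fdiff /fdiff big_nat_rev/= add0n !big_nat; apply: eq_bigr => nu /andP[_ ns].
by rewrite subSS /fdiff_coef bin_sub// subKn.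
Qed.

(** Integration over one parameter of the mean; the term nu sees the step multiplied by nu, hence
an average over a segment of length nu h. *)
Lemma avg_fdiffS p s h u j a x : 1 <= p -> 0 <= h -> borelLp p u ->
  avg_fdiff s h u j.+1 a x = \int[mu]_(t in `[0, 1]) avg_fdiff s h u j (a + h * t) x.
Proof.
move=> p1 h0 bu; rewrite /avg_fdiff.
pose f nu t := iter j (avg (nu%:R * h)) u (x + nu%:R * a + nu%:R * h * t).
have intf nu : (nu < s.+1)%N -> mu.-integrable `[0, 1] (EFin \o f nu).
  move=> _; apply: (borelLp_integrable_affine _ _ _ p1); first by rewrite mulr_ge0.
  exact: (borelLp_iter_avg _ j p1 bu).
have [_ E] := @Rintegral_lincomb _ _ R mu `[0, 1] s.+1 (fdiff_coef s) f (measurable_itv _) intf.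
transitivity (\sum_(0 <= i < s.+1) fdiff_coef s i * \int[mu]_(t in `[0, 1]) f i t).
  by apply: eq_bigr => nu _; rewrite iterS.
rewrite -E; apply: eq_Rintegral => t _; apply: eq_bigr => nu _.
by rewrite /f mulrDr addrA [nu%:R * (h * t)]mulrA.
Qed.

Lemma normLp_avg_fdiff_le p s h u j a (W : R) : 1 <= p -> 0 <= h -> borelLp p u -> 0 <= W ->
  0 <= a ->
  (forall b, 0 <= b <= a + j%:R * h -> (normLp p (fdiff s b u) <= W%:E)%E) ->
  (normLp p (avg_fdiff s h u j a) <= W%:E)%E.
Proof.
move=> p1 h0 bu W0; elim: j a => [|j IH] a a0 H.
  rewrite (@eq_normLp _ _ _ (fdiff s a u)); last by move=> x; exact: avg_fdiff0.
  by apply: H; rewrite mul0r addr0 a0 lexx.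
rewrite (@eq_normLp _ _ _ (fun x => (\int[mu]_(t in `[0, 1]) avg_fdiff s h u j (a + h * t) x)%R)); last first.
  by move=> x; exact: avg_fdiffS p1 h0 bu.
apply: (normLp_average p1 W0).
  apply: measurable_sum => nu; apply: measurable_funM; first exact: measurable_cst.
  have [mw _] := @borelLp_iter_avg p (nu%:R * h) j u p1 bu.
  have := @measurable_pair_affine _ (nu%:R * a) (nu%:R * h) 1 mw.
  by under eq_fun do rewrite mul1r -mulrA -mulrDr.
move=> t /andP[t0 t1]; apply: IH; first by rewrite addr_ge0// mulr_ge0.
move=> b /andP[b0 bj]; apply: H; rewrite b0 (le_trans bj)// -natr1 mulrDl mul1r.
have : h * t <= h by rewrite -[leRHS]mulr1 ler_wpM2l.
lra.
Qed.

End Averages.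

(** * The derivative of an average *)

Section AverageDerivative.
Context {R : realType}.
Notation mu := (@lebesgue_measure R).
Notation cmu := (@completed_lebesgue_measure R).
Implicit Types (u v w : R -> R) (p tau h a x : R).

Lemma Rintegral_affine (c y a b : R) (x1 x2 : bool) v : 0 < c -> measurable_fun [set: R] v ->
  mu.-integrable [set` Interval (BSide x1 (c * a + y)) (BSide x2 (c * b + y))] (EFin \o v) ->
  \int[mu]_(t in [set` Interval (BSide x1 a) (BSide x2 b)]) v (c * t + y) =
  c^-1 * \int[mu]_(t in [set` Interval (BSide x1 (c * a + y)) (BSide x2 (c * b + y))]) v t.
Proof.
move=> c0 mv iv; set D := [set` _] in iv *.
have mEv : measurable_fun [set: R] (EFin \o v) by exact/measurable_EFinP.
have mD : measurable (D : set (measurableTypeR R)) by exact: measurable_itv.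
have Pfin := integrable_fin_num mD (integrable_funepos mD iv).
have Nfin := integrable_fin_num mD (integrable_funeneg mD iv).
rewrite /Rintegral -[c^-1]/(fine c^-1%:E) -fineM//; last exact: integrable_fin_num.
congr fine; rewrite integralE [X in (_ * X)%E]integralE muleBr//; last first.
  by rewrite fin_num_adde_defl// fin_numN.
rewrite -(ge0_integral_affine y c0 mD (measurable_funepos mEv) (funepos_ge0 _)).
rewrite -(ge0_integral_affine y c0 mD (measurable_funeneg mEv) (funeneg_ge0 _)).
rewrite /D (preimage_affine_itv _ _ _ _ _ c0).
by congr (_ - _)%E; apply: eq_integral => t _; rewrite ?funeposE ?funenegE.
Qed.

Section OneAverage.
Variables (p tau : R) (v : R -> R).
Hypotheses (p1 : 1 <= p) (t0 : 0 < tau) (bv : borelLp p v).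

Let J a b := \int[mu]_(t in `]a, b]) v t.

Let intv (i : interval R) (a b : R) : [set` i] `<=` `[a, b]%classic ->
  mu.-integrable [set` i] (EFin \o v).
Proof.
move=> iab; have := borelLp_integrable a b p1 bv.
by apply: integrableS => //; exact: measurable_itv.
Qed.

Let Jcat a b c : a <= b -> b <= c -> J a c = J a b + J b c.
Proof.
move=> ab bc; have i : mu.-integrable `]a, c] (EFin \o v).
  by apply: (@intv `]a, c]%R a c); apply: subset_itv; rewrite bnd_simp.
have := Rintegral_itvB i (x := b).
rewrite !bnd_simp ab bc => /(_ isT isT) H.
by rewrite /J -H addrC subrK.
Qed.

Let avgJ x : avg tau v x = tau^-1 * J x (x + tau).
Proof.
have [mv _] := bv.
have H := @Rintegral_affine tau x 0 1 true false v t0 mv.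
rewrite mulr0 add0r mulr1 (addrC tau) in H.
rewrite /J Rintegral_itv_obnd_cbnd; last first.
  by apply: (@intv `]x, x + tau]%R x (x + tau)); apply: subset_itv; rewrite bnd_simp.
rewrite -H; last exact: (@intv `[x, x + tau]%R x (x + tau)).
by rewrite /avg; apply: eq_Rintegral => t _; rewrite addrC.
Qed.

(** Moving a segment from x to y adds a piece at one end and removes one at the other. *)
Lemma avg_increment x y : x <= y ->
  (avg tau v y - avg tau v x)%:E = (\int[mu]_(t in `]x, y]) (diff_quot tau v t)%:E)%E.
Proof.
move=> xy; have [mv _] := bv.
have mD : measurable (`]x, y]%classic : set (measurableTypeR R)) by exact: measurable_itv.
have iv a b : mu.-integrable `]a, b] (EFin \o v).
  by apply: (@intv `]a, b]%R a b); apply: subset_itv; rewrite bnd_simp.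
have ivt : mu.-integrable `]x, y] (EFin \o (fun t => v (t + tau))).
  have := borelLp_integrable x y p1 (borelLp_shift tau bv).
  by apply: integrableS => //; apply: subset_itv; rewrite bnd_simp.
have E : avg tau v y - avg tau v x = \int[mu]_(t in `]x, y]) diff_quot tau v t.
  rewrite !avgJ -mulrBr.
  transitivity (tau^-1 * \int[mu]_(t in `]x, y]) (v (t + tau) - v t)); last first.
    rewrite -(RintegralZl _ mD)//.
    by have := integrableB mD ivt (iv x y); apply: eq_integrable => // t _ /=; rewrite EFinB.
  congr (_ * _); rewrite (RintegralB mD ivt (iv x y)) -[X in _ - X = _]/(J x (x + tau)).
  have S : \int[mu]_(t in `]x, y]) v (t + tau) = J (x + tau) (y + tau).
    have H := @Rintegral_affine 1 tau x y false false v ltr01 mv.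
    rewrite !mul1r invr1 mul1r in H; rewrite /J -H; last exact: iv.
    by apply: eq_Rintegral => t _; rewrite mul1r.
  rewrite S -[X in _ = _ - X]/(J x y).
  have xt : x <= x + tau by rewrite lerDl ltW.
  have yt : y <= y + tau by rewrite lerDl ltW.
  have xyt : x + tau <= y + tau by rewrite lerD2r.
  have := Jcat xy yt; have := Jcat xt xyt; lra.
rewrite E /Rintegral fineK//; apply: integrable_fin_num => //.
have := borelLp_integrable x y p1 (borelLp_diff_quot tau p1 bv).
by apply: integrableS => //; apply: subset_itv; rewrite bnd_simp.
Qed.

Let dqN (a b : R) : R -> R := diff_quot tau v \_ `[a, b].

Let int_dqN a b : mu.-integrable [set: R] (EFin \o dqN a b).
Proof.
have := borelLp_integrable a b p1 (borelLp_diff_quot tau p1 bv).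
have mab : measurable (`[a, b]%classic : set (measurableTypeR R)) by exact: measurable_itv.
move=> H; have [H' _] := @integrable_mkcond _ _ R mu _ (EFin \o diff_quot tau v) mab.
have := H' H.
apply: eq_integrable => // t _.
by rewrite /dqN /= !patchE; case: ifP.
Qed.

Let dqNE a b x y : a <= x -> y <= b ->
  (\int[mu]_(t in `]x, y]) (diff_quot tau v t)%:E = \int[mu]_(t in `]x, y]) (dqN a b t)%:E)%E.
Proof.
move=> ax yb; apply: eq_integral => t; rewrite inE/= in_itv/= => /andP[xt ty].
by rewrite /dqN patchE mem_set//= in_itv/= (le_trans ax (ltW xt)) (le_trans ty yb).
Qed.

Lemma avg_ae_derivable :
  {ae mu, forall x, derivable (avg tau v) x 1 /\ derive1 (avg tau v) x = diff_quot tau v x}.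
Proof.
have H (n : nat) : {ae mu, forall x, - n%:R < x < n%:R ->
    derivable (avg tau v) x 1 /\ derive1 (avg tau v) x = dqN (- n%:R) n%:R x}.
  apply: primitive_derivable; first exact: int_dqN.
  by move=> x nx xn; rewrite avg_increment// (dqNE (lexx _) xn).
have : {ae mu, forall x (n : nat), - n%:R < x < n%:R ->
    derivable (avg tau v) x 1 /\ derive1 (avg tau v) x = dqN (- n%:R) n%:R x}.
  by apply/ae_foralln => n; exact: H.
apply: filterS; first exact: (ae_filter_ringOfSetsType mu).
move=> x Hx.
have xn : - (Num.bound `|x|)%:R < x < (Num.bound `|x|)%:R.
  by rewrite -ltr_norml; apply: archi_boundP; exact: normr_ge0.
have [dx ->] := Hx _ xn; split => //.
rewrite /dqN patchE mem_set//= in_itv/=; move/andP : xn => [? ?].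
by rewrite !ltW.
Qed.

(** By absolute continuity of the integral of the difference quotient. *)
Lemma avg_absolutely_continuous a b : absolutely_continuous_on a b (avg tau v).
Proof.
move=> e e0.
have [d [d0 Hd]] := integral_normr_continuous (int_dqN a b) e0.
exists d => // m x y Hxy Tr sd.
pose I (i : 'I_m) := `]x i, y i[%classic : set (measurableTypeR R).
have mI i : measurable (I i) by exact: measurable_itv.
pose A := \big[setU/set0]_(i < m) I i.
have mA : measurable A by exact: bigsetU_measurable.
have muI i : mu (I i) = (y i - x i)%:E.
  have [_ xy _] := Hxy i.
  rewrite /I lebesgue_measure_itv/= lte_fin; case: ltP => [_|yx]; first by rewrite -EFinB.
  by rewrite (@le_anti _ _ (x i) (y i)) ?xy ?yx// subrr.
have muA : (mu A < d%:E)%E.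
  rewrite /A (measure_semi_additive_ord mu mI Tr mA) -[X in (_ < X)%E]/(d%:E).
  rewrite (eq_bigr (fun i => (y i - x i)%:E)); last by move=> i _; exact: muI.
  by rewrite sumEFin lte_fin.
have mq : measurable_fun [set: R] (dqN a b).
  by apply/measurable_EFinP; exact: measurable_int (int_dqN a b).
have mnq : measurable_fun [set: R] (fun t => `|dqN a b t|%:E).
  by apply/measurable_EFinP; exact: measurableT_comp.
have iA : mu.-integrable A (fun t => `|dqN a b t|%:E).
  have := integrable_abse (integrableS measurableT mA (@subsetT _ A) (int_dqN a b)).
  by apply: eq_integrable => // t _.
rewrite -lte_fin -sumEFin.
apply: le_lt_trans (_ : (\sum_(i < m) \int[mu]_(t in I i) `|dqN a b t|%:E < e%:E)%E); last first.
  rewrite -(@ge0_integral_bigsetU _ _ R mu _ I _ (index_enum 'I_m) mI (index_enum_uniq _)); first last.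
  - by move=> t _; rewrite lee_fin.
  - exact: measurable_funTS mnq.
  - by move=> i j _ _; exact: Tr.
  rewrite -[X in (X < _)%E]fineK; first by rewrite lte_fin; exact: Hd mA muA.
  by have := integrable_fin_num mA iA; rewrite /A.
apply: lee_sum => i _; have [axi xyi ybi] := Hxy i.
rewrite -abse_EFin (avg_increment xyi) (dqNE axi ybi).
have mqx : measurable_fun (I i) (EFin \o dqN a b) by apply/measurable_funTS/measurable_EFinP.
rewrite -(integral_itv_bndo_bndc mqx).
exact: (le_abse_integral mu (mI i) mqx).
Qed.

End OneAverage.
End AverageDerivative.

(** * Derivatives of iterated averages *)

Section LinearCombinations.
Context {R : realType}.
Implicit Types (F G : R -> R).

Lemma derive1_lincomb (I : Type) (s : seq I) (c : I -> R) (G : I -> R -> R) x :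
  (forall i, derivable (G i) x 1) ->
  derivable (fun z => \sum_(i <- s) c i * G i z) x 1 /\
  derive1 (fun z => \sum_(i <- s) c i * G i z) x = \sum_(i <- s) c i * derive1 (G i) x.
Proof.
move=> dG; elim: s => [|i s [dS ES]].
  have -> : (fun z => \sum_(i <- [::]) c i * G i z) = cst 0 by apply/funext => z; rewrite big_nil.
  by rewrite big_nil derive1E derive_cst; split => //; exact: derivable_cst.
have -> : (fun z => \sum_(j <- i :: s) c j * G j z) =
    (c i \*: G i) + (fun z => \sum_(j <- s) c j * G j z).
  by apply/funext => z; rewrite big_cons.
have dcG : derivable (c i \*: G i) x 1 := @derivableZ _ _ _ _ (c i) _ _ (dG i).
split; first exact: derivableD dcG dS.
rewrite big_cons derive1E (deriveD dcG dS) (deriveZ (c i) (dG i)).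
by rewrite -!derive1E ES.
Qed.

Lemma derive1n_lincomb (I : Type) (s : seq I) (c : I -> R) (G : I -> R -> R) k :
  (forall i l x, (l < k)%N -> derivable (derive1n l (G i)) x 1) ->
  derive1n k (fun z => \sum_(i <- s) c i * G i z) =
  (fun z => \sum_(i <- s) c i * derive1n k (G i) z).
Proof.
elim: k => // k IH dG /=; rewrite IH; last by move=> i l x lk; apply: dG; exact: ltnW.
apply/funext => z.
by have [_] := @derive1_lincomb I s c (fun i => derive1n k (G i)) z (fun i => dG i k z (ltnSn k)).
Qed.

Lemma absolutely_continuous_lincomb (I : Type) (s : seq I) (c : I -> R) (G : I -> R -> R) u v :
  (forall i, absolutely_continuous_on u v (G i)) ->
  absolutely_continuous_on u v (fun z => \sum_(i <- s) c i * G i z).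
Proof.
move=> acG; elim: s => [|i s IH] e e0.
  exists 1 => // m a b _ _ _; rewrite big1// => j _.
  by rewrite !big_nil subrr normr0.
have ce0 : 0 < e / 2 / (`|c i| + 1) by rewrite !divr_gt0// ltr_wpDl.
have [d1 d10 H1] := acG i _ ce0.
have [d2 d20 H2] := IH (e / 2) (divr_gt0 e0 (ltr0n _ 2)).
exists (Num.min d1 d2); first by rewrite lt_min d10.
move=> m a b Hab Tr; rewrite lt_min => /andP[/(H1 _ _ _ Hab Tr) S1 /(H2 _ _ _ Hab Tr) S2].
rewrite [e]splitr.
apply: (@le_lt_trans _ _ ((`|c i| + 1) * \sum_(j < m) `|G i (b j) - G i (a j)| +
   \sum_(j < m) `|\sum_(k <- s) c k * G k (b j) - \sum_(k <- s) c k * G k (a j)|)).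
  rewrite mulr_sumr -big_split/=; apply: ler_sum => j _.
  rewrite !big_cons opprD addrACA -mulrBr.
  apply: le_trans (ler_normD _ _) _; rewrite lerD2r normrM ler_wpM2r//.
  by rewrite lerDl.
apply: ltrD => //; rewrite mulrC -ltr_pdivlMr//.
Qed.

End LinearCombinations.

Section IteratedAverages.
Context {R : realType}.
Notation mu := (@lebesgue_measure R).
Notation cmu := (@completed_lebesgue_measure R).
Implicit Types (u v w : R -> R) (p tau h a x : R).

Lemma avg_continuous p tau v : 1 <= p -> 0 < tau -> borelLp p v -> continuous (avg tau v).
Proof.
move=> p1 t0 bv; apply: absolutely_continuous_continuous => a b.
exact: (avg_absolutely_continuous p1 t0 bv).
Qed.

(** For continuous v the average is a primitive of a continuous function, so that the derivative
exists at every point, as the derivatives of lower order of a Sobolev function must. *)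
Lemma avg_derivable p tau v x : 1 <= p -> 0 < tau -> borelLp p v -> continuous v ->
  derivable (avg tau v) x 1 /\ derive1 (avg tau v) x = diff_quot tau v x.
Proof.
move=> p1 t0 bv cv.
have intf : mu.-integrable [set` Interval (BRight (x - 1)) (BRight (x + 1))] (EFin \o diff_quot tau v).
  have := borelLp_integrable (x - 1) (x + 1) p1 (borelLp_diff_quot tau p1 bv).
  by apply: integrableS => //; apply: subset_itv; rewrite bnd_simp.
have xx1 : x < x + 1 by rewrite ltrDl.
have x1x : x - 1 < x by rewrite ltrBlDr ltrDl.
have cd : {for x, continuous (diff_quot tau v)}.
  apply: cvgM; first exact: cvg_cst.
  apply: cvgB; last exact: cv.
  apply: (@continuous_comp _ _ _ (fun z => z + tau) v); last exact: cv.
  by apply: cvgD; [exact: cvg_id|exact: cvg_cst].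
have ax : (BRight (x - 1) < BRight x)%O by rewrite bnd_simp.
have [] := continuous_FTC1 xx1 intf ax cd.
set F0 := (fun y => _) => dF0 F0E.
pose A0 := avg tau v (x - 1).
have nF : \near x, A0 + F0 x = avg tau v x.
  have /near_in_itvoo : x \in `]x - 1, x + 1[%R by rewrite in_itv/= x1x xx1.
  apply: filterS => y; rewrite in_itv/= => /andP[/ltW uy /ltW yv].
  by rewrite /F0 /Rintegral -(avg_increment p1 t0 bv uy)/= /A0 addrC subrK.
have dA : derivable (cst A0 : R -> R) x 1 := @derivable_cst _ _ _ A0 x 1.
have dF : derivable (fun y => A0 + F0 y) x 1 := derivableD dA dF0.
split; first exact: near_eq_derivable nF dF.
rewrite derive1E -(near_eq_derive _ nF) (deriveD dA dF0).
by rewrite derive_cst add0r -derive1E.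
Qed.

(** Each derivative trades one average for one difference quotient, and the two operations
commute. *)
Lemma iter_avg_derive1n p tau u k j : 1 <= p -> 0 < tau -> borelLp p u -> (k <= j)%N ->
  derive1n k (iter j.+1 (avg tau) u) = iter (j - k).+1 (avg tau) (iter k (diff_quot tau) u).
Proof.
move=> p1 t0 bu; elim: k => [|k IH] kj; first by rewrite subn0.
rewrite derive1nS IH ?(ltnW kj)//.
have bw := borelLp_iter_diff_quot tau k p1 bu.
rewrite (subnSK kj); apply/funext => x.
have bi := borelLp_iter_avg tau (j - k) p1 bw.
have ci : continuous (iter (j - k) (avg tau) (iter k (diff_quot tau) u)).
  rewrite -(@prednK (j - k)) ?subn_gt0// iterS.
  exact: avg_continuous p1 t0 (borelLp_iter_avg tau _ p1 bw).
have [_] := avg_derivable x p1 t0 bi ci.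
rewrite -[avg tau (iter _ _ _)]/(iter (j - k).+1 _ _) => ->.
by rewrite (iter_avg_diff_quot _ p1 (ltW t0) bw).
Qed.

Lemma iter_avg_derivable p tau u k j x : 1 <= p -> 0 < tau -> borelLp p u -> (k < j)%N ->
  derivable (derive1n k (iter j.+1 (avg tau) u)) x 1.
Proof.
move=> p1 t0 bu kj; rewrite (iter_avg_derive1n p1 t0 bu (ltnW kj)).
have bw := borelLp_iter_diff_quot tau k p1 bu.
have bi := borelLp_iter_avg tau (j - k) p1 bw.
have ci : continuous (iter (j - k) (avg tau) (iter k (diff_quot tau) u)).
  rewrite -(@prednK (j - k)) ?subn_gt0// iterS.
  exact: avg_continuous p1 t0 (borelLp_iter_avg tau _ p1 bw).
by have [] := avg_derivable x p1 t0 bi ci.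
Qed.

End IteratedAverages.

(** * Realization of the modulus of smoothness *)

Section SmoothApproximation.
Context {R : realType}.
Notation mu := (@lebesgue_measure R).
Notation cmu := (@completed_lebesgue_measure R).
Implicit Types (u v w f : R -> R) (p tau h a x : R).

(** The differences of u - f have norm at most 2^s times that of u - f, which is 0. *)
Lemma normLp_fdiff_ae p s h f u : 1 <= p -> Lp p f -> Lp p u ->
  {ae cmu, forall x, f x = u x} ->
  (normLp p (fdiff s h u) <= normLp p (fdiff s h f))%E.
Proof.
move=> p1 Lf Lu fu; have Ld := LpB p1 Lu Lf.
have [_ mf _] := Lf; have [_ mu' _] := Lu; have [_ md _] := Ld.
have d0 : normLp p (u \- f) = 0%E.
  have -> : normLp p (u \- f) = normLp p (fun x => 0 * f x).
    apply: (ae_eq_normLp p md).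
      by apply: measurable_funM; [exact: measurable_cst|exact: mf].
    apply: filterS fu; first exact: (ae_filter_ringOfSetsType cmu).
    by move=> x fx; rewrite /= fx subrr mul0r.
  by rewrite (normLpZ 0 p1 mf) normr0 mul0e.
have [_ m1 _] := Lp_fdiff s h p1 Lf; have [_ m2 _] := Lp_fdiff s h p1 Ld.
rewrite (@eq_normLp _ _ _ (fdiff s h f \+ fdiff s h (u \- f))); last first.
  by move=> x /=; rewrite fdiffB addrC subrK.
apply: le_trans (normLpD p1 m1 m2) _.
rewrite -[leRHS]adde0; apply: leeD => //.
by apply: le_trans (normLp_fdiff_le s h p1 Ld) _; rewrite d0 mule0.
Qed.

(** The averaged difference with s parameters and a = 0 has the term (-1)^s u at nu = 0; this
function collects its other terms, so that u minus it is (-1)^s times the averaged difference. *)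
Definition smooth_approx (s : nat) (h : R) (u : R -> R) (x : R) : R :=
  \sum_(0 <= nu < s) - ((-1) ^+ s * fdiff_coef s nu.+1) * iter s (avg (nu.+1%:R * h)) u x.

Section Construction.
Variables (p h : R) (s : nat) (u : R -> R).
Hypotheses (p1 : 1 <= p) (h0 : 0 < h) (s0 : (0 < s)%N) (bu : borelLp p u).

Let tau (nu : nat) : R := nu.+1%:R * h.
Let c (nu : nat) : R := - ((-1) ^+ s * fdiff_coef s nu.+1).
Let G (nu : nat) : R -> R := iter s (avg (tau nu)) u.
Let F (x : R) : R := \sum_(0 <= nu < s) c nu * G nu x.
Let dF (x : R) : R := \sum_(0 <= nu < s) c nu * iter s (diff_quot (tau nu)) u x.

Let tau0 nu : 0 < tau nu. Proof. by rewrite mulr_gt0. Qed.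

Let borelLp_lincomb (H : nat -> R -> R) : (forall nu, borelLp p (H nu)) ->
  borelLp p (fun x => \sum_(0 <= nu < s) c nu * H nu x).
Proof.
move=> bH; split.
  apply: measurable_sum => nu; apply: measurable_funM; first exact: measurable_cst.
  by have [] := bH nu.
apply: (Lp_sum _ p1) => nu.
by have [_ LH] := bH nu; exact: (LpZ _ p1 LH).
Qed.

Let bF : borelLp p F.
Proof. by apply: borelLp_lincomb => nu; exact: borelLp_iter_avg. Qed.

Let bdF : borelLp p dF.
Proof. by apply: borelLp_lincomb => nu; exact: borelLp_iter_diff_quot. Qed.

Let GE nu k : (k < s)%N ->
  derive1n k (G nu) = iter (s - k) (avg (tau nu)) (iter k (diff_quot (tau nu)) u).
Proof.
move=> ks; rewrite /G -{1}(prednK s0).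
have ks1 : (k <= s.-1)%N by rewrite -ltnS prednK.
rewrite (iter_avg_derive1n p1 (tau0 nu) bu ks1).
by rewrite -subSn// prednK.
Qed.

Let derG nu k x : (k.+1 < s)%N -> derivable (derive1n k (G nu)) x 1.
Proof.
move=> ks; have ks1 : (k < s.-1)%N by rewrite -ltnS prednK.
by have := @iter_avg_derivable R p (tau nu) u k s.-1 x p1 (tau0 nu) bu ks1; rewrite prednK.
Qed.

Let FE k : (k < s)%N ->
  derive1n k F = (fun x => \sum_(0 <= nu < s) c nu * derive1n k (G nu) x).
Proof.
move=> ks; apply: derive1n_lincomb => nu l x lk.
by apply: derG; exact: leq_ltn_trans lk ks.
Qed.

Let F_ae : {ae cmu, forall x, dF x = derive1n s F x}.
Proof.
have ss : (s.-1 < s)%N by rewrite prednK.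
have H (nu : nat) : {ae cmu, forall x, derivable (derive1n s.-1 (G nu)) x 1 /\
    derive1 (derive1n s.-1 (G nu)) x = iter s (diff_quot (tau nu)) u x}.
  apply: ae_completed; rewrite (GE nu ss).
  have -> : (s - s.-1 = 1)%N by rewrite -{1}(prednK s0) subSnn.
  have -> : iter s (diff_quot (tau nu)) u = diff_quot (tau nu) (iter s.-1 (diff_quot (tau nu)) u).
    by rewrite -iterS prednK.
  exact: (avg_ae_derivable p1 (tau0 nu) (borelLp_iter_diff_quot (tau nu) s.-1 p1 bu)).
have : {ae cmu, forall x nu, derivable (derive1n s.-1 (G nu)) x 1 /\
    derive1 (derive1n s.-1 (G nu)) x = iter s (diff_quot (tau nu)) u x}.
  by apply/ae_foralln.
apply: filterS; first exact: (ae_filter_ringOfSetsType cmu).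
move=> x Hx; rewrite -[X in derive1n X](prednK s0) derive1nS (FE ss).
have [_ ->] := derive1_lincomb (index_iota 0 s) c (fun nu => (Hx nu).1).
by apply: eq_bigr => nu _; rewrite (Hx nu).2.
Qed.

Let pF : periodic F 1. Proof. by have [_ []] := bF. Qed.

Let ldF : leb_fun (derive1n s F).
Proof. by have [_ [_ m _]] := bdF; exact: leb_fun_ae m F_ae. Qed.

Let ndF : normLp p (derive1n s F) = normLp p dF.
Proof.
apply/esym; have [_ [_ m _]] := bdF.
exact: (ae_eq_normLp p m ldF F_ae).
Qed.

Lemma Wsp_smooth_approx : Wsp s p (smooth_approx s h u).
Proof.
rewrite -[smooth_approx s h u]/F; split.
- exact: pF.
- move=> k x ks; rewrite (FE (ltnW ks)).
  by have [] := @derive1_lincomb _ _ (index_iota 0 s) c (fun nu => derive1n k (G nu)) x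
    (fun nu => @derG nu k x ks).
- have ss : (s.-1 < s)%N by rewrite prednK.
  move=> a b; rewrite (FE ss); apply: absolutely_continuous_lincomb => nu.
  rewrite (GE nu ss).
  have -> : (s - s.-1 = 1)%N by rewrite -{1}(prednK s0) subSnn.
  exact: (avg_absolutely_continuous p1 (tau0 nu) (borelLp_iter_diff_quot (tau nu) s.-1 p1 bu)).
- split; [exact: periodic_derive1n pF|exact: ldF|].
  by rewrite ndF; have [_ []] := bdF.
Qed.

Lemma normLp_sub_smooth_approx (W : R) : 0 <= W ->
  (forall b, 0 <= b <= s%:R * h -> (normLp p (fdiff s b u) <= W%:E)%E) ->
  (normLp p (u \- smooth_approx s h u)%R <= W%:E)%E.
Proof.
move=> W0 H; rewrite -[smooth_approx s h u]/F.
rewrite (@eq_norm_normLp _ _ _ (avg_fdiff s h u s 0)); last first.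
  (* The term nu = 0 has step 0, where averaging is the identity. *)
  move=> x; suff E : u x - F x = (-1) ^+ s * avg_fdiff s h u s 0 x.
    by rewrite /= E normrM normr_sign mul1r.
  rewrite /avg_fdiff (big_nat_recl _ _ _ (leq0n s)) /= mul0r iter_avg_zero_step !mulr0 addr0.
  rewrite mulrDr {1}/fdiff_coef bin0 mul1r subn0 mulrA -expr2 sqrr_sign mul1r; congr (_ + _)%R.
  rewrite /F mulr_sumr -sumrN; apply: eq_bigr => nu _.
  by rewrite mulr0 addr0 /c mulNr opprK -mulrA.
by apply: (normLp_avg_fdiff_le p1 (ltW h0) bu W0 (lexx 0)) => b; rewrite add0r; exact: H.
Qed.

Lemma normLp_derive_smooth_approx (W : R) : 0 <= W ->
  (forall b, 0 <= b <= s%:R * h -> (normLp p (fdiff s b u) <= W%:E)%E) ->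
  (normLp p (derive1n s (smooth_approx s h u)) <= (2 ^+ s * h^-1 ^+ s * W)%:E)%E.
Proof.
move=> W0 H; rewrite -[smooth_approx s h u]/F; have hV0 : 0 <= h^-1 by rewrite invr_ge0; exact: ltW h0.
rewrite ndF; apply: le_trans (normLp_sum _ p1 _) _.
  move=> nu; apply: measurable_funM; first exact: measurable_cst.
  by have [_ []] := borelLp_iter_diff_quot (tau nu) s p1 bu.
apply: (@le_trans _ _ (\sum_(0 <= nu < s) ('C(s, nu.+1)%:R * (h^-1 ^+ s * W))%:E)%E); last first.
  rewrite sumEFin lee_fin -mulr_suml -mulrA; apply: ler_wpM2r.
    exact: mulr_ge0 (exprn_ge0 _ hV0) W0.
  (* The binomial coefficients C(s, nu), 1 <= nu <= s, sum to at most 2^s. *)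
  rewrite -natr_sum -natrX ler_nat -[2%N]/(1 + 1)%N expnDn.
  rewrite -(big_mkord xpredT (fun i => 'C(s, i) * (1 ^ (s - i) * 1 ^ i)))%N.
  rewrite (big_nat_recl _ _ _ (leq0n s)) -[leqLHS]add0n; apply: leq_add; first exact: leq0n.
  by apply: leq_sum => nu _; rewrite !exp1n !muln1.
rewrite big_nat [leRHS]big_nat; apply: lee_sum => nu /andP[_ nus].
have [_ [_ m _]] := borelLp_iter_diff_quot (tau nu) s p1 bu.
rewrite (normLpZ _ p1 m).
have -> : `|c nu| = 'C(s, nu.+1)%:R.
  by rewrite /c /fdiff_coef normrN !normrM !normrX normrN1 !expr1n mul1r mulr1 normr_nat.
rewrite EFinM; apply: lee_wpmul2l; first by rewrite lee_fin.
rewrite (@eq_normLp _ _ _ (fun x => (tau nu)^-1 ^+ s * fdiff s (tau nu) u x)); last first.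
  by move=> x; exact: iter_diff_quot_fdiff.
have [_ Lu] := bu; have [_ mfd _] := Lp_fdiff s (tau nu) p1 Lu.
rewrite (normLpZ _ p1 mfd) EFinM.
have t0 := tau0 nu.
have ht : h <= tau nu 
  by rewrite -[leLHS]mul1r; apply: ler_wpM2r; [exact: ltW h0|rewrite ler1n].
have ts : 0 <= tau nu <= s%:R * h.
  rewrite (ltW t0)/=; apply: ler_wpM2r; first exact: ltW h0.
  by rewrite ler_nat.
have tV0 : 0 <= (tau nu)^-1 by rewrite invr_ge0; exact: ltW t0.
apply: lee_pmul.
- by rewrite lee_fin normr_ge0.
- exact: normLp_ge0.
- rewrite lee_fin ger0_norm; last exact: exprn_ge0 _ tV0.
  by rewrite lerXn2r ?nnegrE ?tV0 ?hV0// lef_pV2 ?posrE.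
- exact: H ts.
Qed.

Lemma Lp_smooth_approx : Lp p (smooth_approx s h u).
Proof. by have [] := bF. Qed.

End Construction.

(** A Borel version of f is approximated. The step h = 1 / ((s + 1) n), rather than 1 / (s n),
keeps all steps up to s h strictly below 1 / n, as the modulus is a supremum over an open
interval. *)
Lemma smooth_approximation p (s n : nat) f (W : R) : 1 <= p -> (0 < s)%N -> (0 < n)%N ->
  Lp p f -> 0 <= W ->
  (forall b, 0 < b < n%:R^-1 -> (normLp p (fdiff s b f) <= W%:E)%E) ->
  exists F : R -> R, [/\ Wsp s p F, Lp p F, (normLp p (f \- F)%R <= W%:E)%E &
    ((n%:R ^- s)%:E * normLp p (derive1n s F) <= ((2 ^+ s * s.+1%:R ^+ s) * W)%:E)%E].
Proof.
move=> p1 s0 n0 Lf W0 H.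
have [u bu fu] := Lp_borel_version p1 Lf; have [_ Lu] := bu.
have nR : 0 < n%:R :> R by rewrite ltr0n.
have sR : 0 < s.+1%:R :> R by rewrite ltr0n.
pose h : R := (s.+1%:R * n%:R)^-1.
have h0 : 0 < h by rewrite invr_gt0 mulr_gt0.
have Hu b : 0 <= b <= s%:R * h -> (normLp p (fdiff s b u) <= W%:E)%E.
  move=> /andP[b0 bsh]; apply: le_trans (normLp_fdiff_ae s b p1 Lf Lu fu) _.
  (* The step b = 0 is not among those of the modulus, but its difference vanishes as s > 0. *)
  move: b0; rewrite le_eqVlt => /predU1P[<-|b0].
    rewrite (@eq_normLp _ _ _ (fun x => 0 * f x)); last first.
      by move=> x; rewrite fdiff_zero_step// mul0r.
    by have [_ mf _] := Lf; rewrite (normLpZ 0 p1 mf) normr0 mul0e lee_fin.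
  apply: H; rewrite b0 (le_lt_trans bsh)// /h invfM mulrA.
  by rewrite gtr_pMl ?invr_gt0// ltr_pdivrMr// mul1r ltr_nat.
exists (smooth_approx s h u); split.
- exact: (Wsp_smooth_approx p1 h0 s0 bu).
- exact: (Lp_smooth_approx h s p1 bu).
- have Lw := normLp_sub_smooth_approx p1 h0 bu W0 Hu.
  have [_ m1 _] := LpB p1 Lf (Lp_smooth_approx h s p1 bu).
  have [_ m2 _] := LpB p1 Lu (Lp_smooth_approx h s p1 bu).
  rewrite (ae_eq_normLp p m1 m2)//.
  apply: filterS fu; first exact: (ae_filter_ringOfSetsType cmu).
  by move=> x /= ->.
- have nV : (0 <= (n%:R ^- s)%:E :> \bar R)%E by rewrite lee_fin invr_ge0 exprn_ge0// ltW.
  apply: le_trans (lee_wpmul2l nV (normLp_derive_smooth_approx p1 h0 s0 bu W0 Hu)) _.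
  rewrite -EFinM lee_fin le_eqVlt; apply/orP; left; apply/eqP.
  rewrite /h invrK exprMn mulrA; congr (_ * W).
  by rewrite [LHS]mulrC -!mulrA mulfV ?mulr1// gt_eqF// exprn_gt0.
Qed.

End SmoothApproximation.

(** * The norm at the nodes and the modulus of smoothness *)

Section DiscreteNorm.
Context {R : realType}.
Implicit Types (u v w : R -> R) (p : R) (n : nat) (x : nat -> R).

Lemma normlp_ge0 p n x u : 0 <= normlp p n x u.
Proof. exact: powR_ge0. Qed.

Lemma eq_norm_normlp p n x u v : (forall y, `|u y| = `|v y|) -> normlp p n x u = normlp p n x v.
Proof. by move=> uv; rewrite /normlp; under eq_bigr do rewrite uv. Qed.

Lemma powR_normD_le p (a b : R) : 0 <= p ->
  `|a + b| `^ p <= 2 `^ p * (`|a| `^ p + `|b| `^ p).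
Proof.
move=> p0; wlog ab : a b / `|a| <= `|b|.
  move=> H; have [/H//|/ltW/H] := leP `|a| `|b|.
  by rewrite addrC [X in _ * X]addrC.
apply: (@le_trans _ _ ((2 * `|b|) `^ p)).
  apply: ge0_ler_powR => //; rewrite ?nnegrE ?mulr_ge0//.
  apply: le_trans (ler_normD a b) _; rewrite mulr_natl mulr2n.
  by rewrite lerD2r.
by rewrite powRM// ler_wpM2l ?powR_ge0// lerDr powR_ge0.
Qed.

(** A quasi-triangle inequality: |u + v| <= 2 max(|u|, |v|) at each node, and then the larger of
the two sums, whose factor 2 <= 2^p costs another 2. *)
Lemma normlpD_le p n x u v : 1 <= p ->
  normlp p n x (u \+ v) <= 4 * (normlp p n x u + normlp p n x v).
Proof.
move=> p1; have p0 : 0 < p by apply: lt_le_trans p1.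
wlog uv : u v / \sum_(1 <= k < n.+1) `|u (x k)| `^ p <= \sum_(1 <= k < n.+1) `|v (x k)| `^ p.
  move=> H; have [/H//|/ltW/H] := leP (\sum_(1 <= k < n.+1) `|u (x k)| `^ p)
    (\sum_(1 <= k < n.+1) `|v (x k)| `^ p).
  move=> vu; rewrite (@eq_norm_normlp _ _ _ _ (v \+ u)); last by move=> y /=; rewrite addrC.
  by rewrite [X in 4 * X]addrC.
apply: (@le_trans _ _ (4 * normlp p n x v)); last by rewrite ler_wpM2l// lerDr normlp_ge0.
have -> : 4 * normlp p n x v =
    (4 `^ p * (n%:R^-1 * \sum_(1 <= k < n.+1) `|v (x k)| `^ p)) `^ p^-1 :> R.
  rewrite [RHS]powRM ?powR_ge0//; last first.
    by rewrite mulr_ge0// sumr_ge0// => k _; exact: powR_ge0.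
  by rewrite -powRrM mulfV ?gt_eqF// powRr1.
have Sge0 w : 0 <= \sum_(1 <= k < n.+1) `|w (x k)| `^ p.
  by rewrite sumr_ge0// => k _; exact: powR_ge0.
apply: ge0_ler_powR; rewrite ?nnegrE ?mulr_ge0 ?powR_ge0 ?invr_ge0 ?(ltW p0)//.
rewrite mulrCA ler_wpM2l//.
apply: (@le_trans _ _ (2 `^ p * (\sum_(1 <= k < n.+1) `|u (x k)| `^ p +
    \sum_(1 <= k < n.+1) `|v (x k)| `^ p))).
  rewrite -big_split/= mulr_sumr; apply: ler_sum => k _.
  exact: powR_normD_le (ltW p0).
have -> : 4 `^ p = 2 `^ p * 2 `^ p :> R by rewrite -powRM//; congr (_ `^ _); ring.
rewrite -mulrA ler_wpM2l ?powR_ge0//.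
apply: (@le_trans _ _ (2 * \sum_(1 <= k < n.+1) `|v (x k)| `^ p)).
  by rewrite mulr_natl mulr2n lerD2r.
by rewrite ler_wpM2r// -[leLHS]powRr1// ler_powR// ler1n.
Qed.

Lemma normlpD3_le p n x u v w : 1 <= p ->
  normlp p n x (fun y => u y + v y + w y) <=
  16 * (normlp p n x u + normlp p n x v + normlp p n x w).
Proof.
move=> p1; apply: (le_trans (normlpD_le n x (u \+ v) w p1)).
move: (normlpD_le n x u v p1) (normlp_ge0 p n x w).
move: (normlp p n x (u \+ v)) (normlp p n x u) (normlp p n x v) (normlp p n x w).
by move=> A a b c; lra.
Qed.

End DiscreteNorm.

Section Modulus.
Context {R : realType}.
Notation cmu := (@completed_lebesgue_measure R).
Implicit Types (f g : R -> R) (p delta h : R).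

Lemma modulus_ub s f delta p h : 0 < h < delta ->
  (normLp p (fdiff s h f) <= modulus s f delta p)%E.
Proof. by move=> hd; apply: ereal_sup_ubound; exists h => //=; rewrite in_itv. Qed.

Lemma modulus_le s f delta p (M : \bar R) :
  (forall h, 0 < h < delta -> (normLp p (fdiff s h f) <= M)%E) -> (modulus s f delta p <= M)%E.
Proof. by move=> H; apply: ge_ereal_sup => z [h hd <-]; apply: H; move: hd; rewrite /= in_itv. Qed.

Lemma modulus_ge0 s f delta p : 0 < delta -> (0 <= modulus s f delta p)%E.
Proof.
move=> d0; apply: le_trans (normLp_ge0 p (fdiff s (delta / 2) f)) (modulus_ub _ _ _ _).
by rewrite divr_gt0//= ltr_pdivrMr// ltr_pMr// ltr1n.
Qed.

Lemma modulus_le_normLp s f delta p : 1 <= p -> Lp p f ->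
  (modulus s f delta p <= (2 ^+ s)%:E * normLp p f)%E.
Proof. by move=> p1 Lf; apply: modulus_le => h _; exact: normLp_fdiff_le. Qed.

(** The modulus is subadditive, and that of f - g is at most 2^s times its norm. *)
Lemma modulus_leD s f g delta p : 1 <= p -> Lp p f -> Lp p g ->
  (modulus s f delta p <= modulus s g delta p + (2 ^+ s)%:E * normLp p (f \- g)%R)%E.
Proof.
move=> p1 Lf Lg; apply: modulus_le => h hd; have Ld := LpB p1 Lf Lg.
have [_ m1 _] := Lp_fdiff s h p1 Lg; have [_ m2 _] := Lp_fdiff s h p1 Ld.
rewrite (@eq_normLp _ _ _ (fdiff s h g \+ fdiff s h (f \- g))); last first.
  by move=> y /=; rewrite fdiffB addrC subrK.
apply: le_trans (normLpD p1 m1 m2) _.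
by apply: leeD; [exact: modulus_ub|exact: normLp_fdiff_le].
Qed.

Lemma modulus_Wsp s g (n : nat) p : 1 <= p -> (0 < s)%N -> (0 < n)%N -> Wsp s p g ->
  (modulus s g n%:R^-1 p <= s%:R%:E * ((n%:R ^- s)%:E * normLp p (derive1n s g)))%E.
Proof.
move=> p1 s0 n0 Wg; apply: modulus_le => h /andP[h0 hn].
apply: le_trans (normLp_fdiff_Wsp p1 s0 h0 Wg) _.
rewrite muleA -EFinM; apply: lee_wpmul2r; first exact: normLp_ge0.
rewrite lee_fin; apply: ler_wpM2l => //.
by rewrite -exprVn lerXn2r// ?nnegrE ?invr_ge0// ltW.
Qed.

End Modulus.

(** * Equivalence of the sampling error and the modulus of smoothness *)

Section SteklovAtNodes.
Context {R : realType}.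
Implicit Types (u g : R -> R) (p gamma : R) (x : nat -> nat -> R).

Lemma normlp_steklov_le p gamma x n r u : 1 <= p -> 0 < gamma -> separated_nodes gamma x ->
  (0 < n)%N -> Lp p u ->
  ((normlp p n (x n) (steklov (gamma / n%:R) r u))%:E <=
   (steklov_const r * gamma^-1 `^ p^-1)%:E * normLp p u)%E.
Proof.
move=> p1 g0 sx n0 Lu.
apply: (normlp_le_window p1 g0 sx n0 (steklov_const_ge0 r) Lu) => y.
by apply: (steklov_le _ _ p1 _ Lu); rewrite divr_gt0// ltr0n.
Qed.

(** The window estimate has the factor (gamma / n)^s, at most n^-s as gamma <= 1. *)
Lemma normlp_steklov_sub_le p gamma x n r s g : 1 <= p -> (0 < r)%N -> (0 < s)%N ->
  (s <= 2 * r)%N -> 0 < gamma -> gamma <= 1 -> separated_nodes gamma x ->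
  (0 < n)%N -> Lp p g -> Wsp s p g ->
  ((normlp p n (x n) (steklov (gamma / n%:R) r g \- g)%R)%:E <=
   (('C(2 * r, r)%:R)^-1 * 2 ^+ (2 * r - s) * gamma^-1 `^ p^-1)%:E *
   ((n%:R ^- s)%:E * normLp p (derive1n s g)))%E.
Proof.
move=> p1 r0 s0 s2r g0 g1 sx n0 Lg Wg; have [_ _ _ Ls] := Wg.
have d0 : 0 < gamma / n%:R by rewrite divr_gt0// ltr0n.
pose K : R := ('C(2 * r, r)%:R)^-1 * 2 ^+ (2 * r - s).
have K0 : 0 <= K by rewrite mulr_ge0// ?invr_ge0// exprn_ge0.
have B0 : 0 <= K * (gamma / n%:R) ^+ s by rewrite mulr_ge0// exprn_ge0// ltW.
apply: le_trans (normlp_le_window p1 g0 sx n0 B0 Ls _) _.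
  by move=> y; exact: (steklov_sub_le y r0 s0 s2r p1 d0 Lg Wg).
rewrite muleA -EFinM; apply: lee_wpmul2r; first exact: normLp_ge0.
rewrite lee_fin -/K expr_div_n.
have -> : K * (gamma ^+ s / n%:R ^+ s) * gamma^-1 `^ p^-1 =
  gamma ^+ s * (K * gamma^-1 `^ p^-1 * n%:R ^- s) by ring.
rewrite -[leRHS]mul1r; apply: ler_wpM2r; last exact: exprn_ile1 (ltW g0) g1.
by rewrite !mulr_ge0// ?powR_ge0// invr_ge0 exprn_ge0.
Qed.

End SteklovAtNodes.

Section Sampling.
Context {R : realType}.
Implicit Types (f g : R -> R) (x : nat -> nat -> R) (phi : nat -> nat -> R -> R).

Lemma samplingB x phi n f g y :
  sampling x phi n (f \- g) y = sampling x phi n f y - sampling x phi n g y.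
Proof. by rewrite /sampling -sumrB; apply: eq_bigr => k _; rewrite mulrBl. Qed.

End Sampling.

(** The constants of the upper estimate: Y and Z stand for L(g_d - g) and L(g - f). *)
Lemma direct_arith (R : realFieldType) (C1 C2 K t c a D l Y Z W : R) :
  0 <= C1 -> 0 <= C2 -> 0 <= K -> 0 <= t -> 0 <= c -> 0 <= a -> 0 <= D ->
  l <= 16 * (C1 * a + Y + Z) -> Y <= C2 * D -> Z <= K * D -> W <= t * a + c * D ->
  l + W <= (16 * (C1 + C2 + K) + t + c) * (a + D).
Proof.
move=> C10 C20 K0 t0 c0 a0 D0 hl hY hZ hW.
have := mulr_ge0 C10 D0; have := mulr_ge0 C20 a0; have := mulr_ge0 K0 a0.
have := mulr_ge0 t0 D0; have := mulr_ge0 c0 a0; lra.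
Qed.

(** The constants of the lower estimate: t stands for 2^s, M for the constant of the realization
and l for L(f_d - f). *)
Lemma realization_arith (R : realFieldType) (K1 K3 K5 C1 C2 M t W l a D A : R) :
  0 <= K1 -> 0 <= K3 -> 0 <= K5 -> 0 <= C1 -> 0 <= C2 -> 0 <= M -> 0 <= t ->
  0 <= W -> 0 <= l ->
  a <= W + K3 * (M * W) + K1 * (16 * (C2 * (M * W) + C1 * W + l)) ->
  D <= K5 * (W + t * a) ->
  A = 1 + K3 * M + K1 * (16 * (C2 * M + C1 + 1)) ->
  a + D <= (l + W) * (A + K5 * (1 + t * A)).
Proof.
move=> K10 K30 K50 C10 C20 M0 t0 W0 l0 ha hD AE.
have A0 : 0 <= A.
  by rewrite AE !addr_ge0// ?mulr_ge0// !addr_ge0// mulr_ge0.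
have aA : a <= A * (l + W).
  apply: le_trans ha _; rewrite -subr_ge0.
  have -> : A * (l + W) - (W + K3 * (M * W) + K1 * (16 * (C2 * (M * W) + C1 * W + l))) =
    l + K3 * M * l + K1 * (16 * ((C2 * M + C1) * l + W)) by rewrite AE; ring.
  by rewrite !addr_ge0// !mulr_ge0// !addr_ge0// !mulr_ge0// addr_ge0// mulr_ge0.
have hD' : D <= K5 * (l + W + t * (A * (l + W))).
  apply: le_trans hD _; apply: ler_wpM2l => //; apply: lerD; first by rewrite lerDr.
  exact: ler_wpM2l t0 _ _ aA.
by apply: le_trans (lerD aA hD') _; rewrite le_eqVlt; apply/orP; left; apply/eqP; ring.
Qed.

Theorem theorem4p5 (R : realType) (p : R) (r s : nat) (gamma : R)
    (x : nat -> nat -> R) (phi : nat -> nat -> R -> R)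
    (K1 K2 K3 K5 : R)
    (p_ge1 : 1 <= p) (r_gt0 : (0 < r)%N) (s_gt0 : (0 < s)%N)
    (s_le_2r : (s <= 2 * r)%N)
    (gamma_gt0 : 0 < gamma) (gamma_le1 : gamma <= 1)
    (nodes : separated_nodes gamma x)
    (phi_Lp : forall n k, (1 <= k <= n)%N -> Lp p (phi n k))
    (K1_gt0 : 0 < K1) (K2_gt0 : 0 < K2) (K3_gt0 : 0 < K3) (K5_gt0 : 0 < K5)
    (stable : forall f n, Lp p f -> (0 < n)%N ->
      ((K2 * normlp p n (x n) f)%:E <= normLp p (sampling x phi n f)
         <= (K1 * normlp p n (x n) f)%:E)%E)
    (jackson : forall f n, Wsp s p f -> (0 < n)%N ->
      (normLp p (f \- sampling x phi n f)%R
         <= (K3 * n%:R ^- s)%:E * normLp p (f^`(s)))%E)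
    (smooth : forall f n, Lp p f -> (0 < n)%N -> Wsp s p (sampling x phi n f))
    (bernstein : forall f n, Lp p f -> (0 < n)%N ->
      ((n%:R ^- s)%:E * normLp p ((sampling x phi n f)^`(s))
         <= K5%:E * modulus s (sampling x phi n f) n%:R^-1 p)%E) :
  exists c C : R, [/\ 0 < c, 0 < C &
    forall f n, Lp p f -> (0 < n)%N ->
      let lhs := ((normlp p n (x n) (steklov (gamma / n%:R) r f \- f)%R)%:E
                    + modulus s f n%:R^-1 p)%E in
      let rhs := (normLp p (f \- sampling x phi n f)%R
                    + (n%:R ^- s)%:E
                      * normLp p ((sampling x phi n f)^`(s)))%E in
      (c%:E * rhs <= lhs <= C%:E * rhs)%E].
Proof.
pose C1 : R := steklov_const r * gamma^-1 `^ p^-1.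
pose C2 : R := ('C(2 * r, r)%:R)^-1 * 2 ^+ (2 * r - s) * gamma^-1 `^ p^-1.
pose M : R := 2 ^+ s * s.+1%:R ^+ s.
pose A : R := 1 + K3 * M + K1 * (16 * (C2 * M + C1 + 1)).
pose B : R := A + K5 * (1 + 2 ^+ s * A).
pose C : R := 16 * (C1 + C2 + K2^-1 * K3) + 2 ^+ s + s%:R.
have C1_ge0 : 0 <= C1 by rewrite mulr_ge0 ?powR_ge0// steklov_const_ge0.
have C2_ge0 : 0 <= C2.
  by rewrite mulr_ge0 ?powR_ge0// mulr_ge0 ?exprn_ge0// invr_ge0.
have M_ge0 : 0 <= M by rewrite mulr_ge0 ?exprn_ge0.
have two_s : 0 < 2 ^+ s :> R by rewrite exprn_gt0.
have A_gt0 : 0 < A.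
  rewrite /A -addrA ltr_pwDl// addr_ge0// mulr_ge0 ?(ltW K1_gt0) ?(ltW K3_gt0)//.
  by rewrite mulr_ge0// !addr_ge0// mulr_ge0.
have B_gt0 : 0 < B.
  by rewrite /B ltr_pwDl// mulr_ge0 ?(ltW K5_gt0)// addr_ge0// mulr_ge0 ?ltW.
have C_gt0 : 0 < C.
  rewrite /C ltr_pwDr ?ltr0n// addr_ge0 ?(ltW two_s)// mulr_ge0// !addr_ge0//.
  by rewrite mulr_ge0 ?invr_ge0 ?ltW.
exists B^-1, C; split => //; first by rewrite invr_gt0.
move=> f n Lf n0; lazy zeta.
set g := sampling x phi n f.
have Wg : Wsp s p g by exact: smooth.
(* Continuity gives measurability, and stability gives a finite norm. *)
have LG u : Lp p u -> Lp p (sampling x phi n u).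
  move=> Lu; have Wu := smooth u n Lu n0; have [pu _ _ _] := Wu.
  split; [exact: pu|exact: leb_fun_continuous (Wsp_continuous s_gt0 Wu)|].
  by have /andP[_ /le_lt_trans] := stable u n Lu n0; apply; rewrite ltry.
have Lg : Lp p g by exact: LG.
have nV0 : 0 < n%:R^-1 :> R by rewrite invr_gt0 ltr0n.
have q0 : 0 < n%:R ^- s :> R by rewrite -exprVn exprn_gt0.
have [_ _ _ Lgs] := Wg.
have Lfg := LpB p_ge1 Lf Lg; have Lgf := LpB p_ge1 Lg Lf.
(* All quantities are finite, so that the estimates are between real numbers. *)
pose N u := fine (normLp p u); pose L u := normlp p n (x n) u.
have NE u : Lp p u -> normLp p u = (N u)%:E by exact: normLp_fine.
have N_ge0 u : 0 <= N u by rewrite fine_ge0// normLp_ge0.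
have NC u v : N (u \- v) = N (v \- u).
  by rewrite /N (@eq_norm_normLp _ _ (u \- v) (v \- u))// => y /=; rewrite distrC.
pose W := fine (modulus s f n%:R^-1 p).
have WE : modulus s f n%:R^-1 p = W%:E.
  rewrite /W fineK// ge0_fin_numE ?modulus_ge0//.
  apply: le_lt_trans (modulus_le_normLp _ _ p_ge1 Lf) _.
  by rewrite (NE _ Lf) -EFinM ltry.
have W_ge0 : 0 <= W by rewrite fine_ge0// modulus_ge0.
pose D := n%:R ^- s * N (derive1n s g).
have DE : ((n%:R ^- s)%:E * normLp p (derive1n s g) = D%:E)%E by rewrite (NE _ Lgs) EFinM.
have D_ge0 : 0 <= D by rewrite mulr_ge0 ?(ltW q0).
pose a := N (f \- g); have a_ge0 : 0 <= a := N_ge0 _.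
pose l := L (steklov (gamma / n%:R) r f \- f).
have l_ge0 : 0 <= l := normlp_ge0 _ _ _ _.
have L_steklov u : Lp p u -> L (steklov (gamma / n%:R) r u) <= C1 * N u.
  move=> Lu; have := normlp_steklov_le r p_ge1 gamma_gt0 nodes n0 Lu.
  by rewrite (NE _ Lu) -EFinM lee_fin.
have L_steklov_sub u : Lp p u -> Wsp s p u ->
    L (steklov (gamma / n%:R) r u \- u) <= C2 * (n%:R ^- s * N (derive1n s u)).
  move=> Lu Wu; have [_ _ _ Lus] := Wu.
  have := normlp_steklov_sub_le p_ge1 r_gt0 s_gt0 s_le_2r gamma_gt0 gamma_le1 nodes n0 Lu Wu.
  by rewrite (NE _ Lus) -!EFinM lee_fin.
have jacksonN u : Wsp s p u -> Lp p u ->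
    N (u \- sampling x phi n u) <= K3 * (n%:R ^- s * N (derive1n s u)).
  move=> Wu Lu; have [_ _ _ Lus] := Wu; have := jackson u n Wu n0.
  by rewrite (NE _ (LpB p_ge1 Lu (LG _ Lu))) (NE _ Lus) -EFinM lee_fin -mulrA.
have steklov_triangle u v : Lp p u -> Lp p v ->
    L (steklov (gamma / n%:R) r u \- u) <=
    16 * (C1 * N (u \- v) + L (steklov (gamma / n%:R) r v \- v) + L (v \- u)).
  move=> Lu Lv.
  have -> : steklov (gamma / n%:R) r u \- u = fun y => steklov (gamma / n%:R) r (u \- v) y +
      (steklov (gamma / n%:R) r v \- v) y + (v \- u) y.
    by apply/funext => y /=; rewrite (steklovB _ _ _ p_ge1 Lu Lv); ring.
  apply: le_trans (normlpD3_le _ _ _ _ _ p_ge1) _.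
  rewrite ler_wpM2l// !lerD2r; exact: L_steklov (LpB p_ge1 Lu Lv).
rewrite WE DE (NE _ Lfg) -!EFinD -!EFinM !lee_fin -/l -/a; apply/andP; split.
- rewrite mulrC ler_pdivrMr//.
  have [b /andP[b0 bn]|F [WF LF]] := smooth_approximation p_ge1 s_gt0 n0 Lf W_ge0.
    by rewrite -WE; apply: modulus_ub; rewrite b0.
  have [_ _ _ LFs] := WF; have LfF := LpB p_ge1 Lf LF; have LFf := LpB p_ge1 LF Lf.
  have LGF := LG F LF; have LFGF := LpB p_ge1 LF LGF; have LGFg := LpB p_ge1 LGF Lg.
  rewrite (NE _ LfF) (NE _ LFs) -EFinM !lee_fin -/M => H1 H2.
  have H3 : N (F \- sampling x phi n F) <= K3 * (M * W).
    by apply: le_trans (jacksonN F WF LF) _; apply: ler_wpM2l; [exact: ltW K3_gt0|].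
  have H4 : N (sampling x phi n F \- g) <= K1 * L (F \- f).
    have /andP[_] := stable (F \- f) n LFf n0.
    rewrite (NE _ (LG _ LFf)) lee_fin; apply: le_trans.
    by rewrite le_eqVlt; apply/orP; left; apply/eqP; congr (fine (normLp p _));
      apply/funext => y; rewrite samplingB.
  have H5 : L (F \- f) <= 16 * (C2 * (M * W) + C1 * W + l).
    rewrite /L (@eq_norm_normlp _ _ _ _ _ (fun y => (steklov (gamma / n%:R) r F \- F) y +
        steklov (gamma / n%:R) r (f \- F) y + (fun z => - (steklov (gamma / n%:R) r f \- f) z) y)); last first.
      move=> y /=; rewrite (steklovB _ _ _ p_ge1 Lf LF) -normrN; congr (Num.norm _); ring.
    apply: le_trans (normlpD3_le _ _ _ _ _ p_ge1) _.
    apply: ler_wpM2l; first exact: ler0n.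
    apply: lerD; first apply: lerD.
    + apply: le_trans (L_steklov_sub F LF WF) _.
      exact: ler_wpM2l C2_ge0 _ _ H2.
    + apply: le_trans (L_steklov _ LfF) _.
      exact: ler_wpM2l C1_ge0 _ _ H1.
    + by rewrite (@eq_norm_normlp _ _ _ _ _ (steklov (gamma / n%:R) r f \- f)); [exact: lexx|move=> y; rewrite normrN].
  have H6 : a <= N (f \- F) + N (F \- sampling x phi n F) + N (sampling x phi n F \- g).
    have [_ m1 _] := LfF; have [_ m2 _] := LFGF; have [_ m3 _] := LGFg.
    have [_ m12 _] := LpD p_ge1 LfF LFGF.
    have E : ((f \- F) \+ (F \- sampling x phi n F)) \+ (sampling x phi n F \- g) = f \- g.
      by apply/funext => y /=; ring.
    have H := le_trans (normLpD p_ge1 m12 m3) (leeD (normLpD p_ge1 m1 m2) (lexx _)).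
    rewrite E (NE _ Lfg) (NE _ LfF) (NE _ LFGF) (NE _ LGFg) -!EFinD lee_fin in H.
    exact: H.
  have H7 := le_trans H6 (lerD (lerD H1 H3) (le_trans H4 (ler_wpM2l (ltW K1_gt0) H5))).
  have H8 : D <= K5 * (W + 2 ^+ s * a).
    rewrite -lee_fin -DE; apply: le_trans (bernstein f n Lf n0) _.
    rewrite EFinM; apply: lee_wpmul2l; first by rewrite lee_fin ltW.
    apply: le_trans (modulus_leD s _ p_ge1 Lg Lf) _.
    by rewrite WE (NE _ Lgf) (NC g f) -/a -EFinM -EFinD.
  exact: realization_arith (ltW K1_gt0) (ltW K3_gt0) (ltW K5_gt0) C1_ge0 C2_ge0 M_ge0
    (ltW two_s) W_ge0 l_ge0 H7 H8 erefl.
- have H1 := steklov_triangle f g Lf Lg.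
  have H2 := L_steklov_sub g Lg Wg.
  have H3 : L (g \- f) <= K2^-1 * K3 * D.
    have /andP[+ _] := stable (g \- f) n Lgf n0.
    rewrite (NE _ (LG _ Lgf)) lee_fin => H.
    rewrite -mulrA mulrC ler_pdivlMr// mulrC; apply: (le_trans H).
    have -> : sampling x phi n (g \- f) = sampling x phi n g \- g.
      by apply/funext => y; rewrite samplingB.
    by rewrite NC; exact: jacksonN g Wg Lg.
  have H4 : W <= 2 ^+ s * a + s%:R * D.
    rewrite -lee_fin -WE; apply: le_trans (modulus_leD s _ p_ge1 Lf Lg) _.
    rewrite EFinD EFinM addeC -(NE _ Lfg); apply: leeD => //.
    by apply: le_trans (modulus_Wsp p_ge1 s_gt0 n0 Wg) _; rewrite DE -EFinM.
  have K23 : 0 <= K2^-1 * K3 by rewrite mulr_ge0 ?invr_ge0 ?ltW.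
  exact: direct_arith C1_ge0 C2_ge0 K23 (ltW two_s) (ler0n R s) a_ge0 D_ge0 H1 H2 H3 H4.
Qed.
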